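(* Assume that $X$ is a complex Banach space satisfying at least one of the following conditions: (1) $X$ has a shrinking and monotone finite-dimensional decomposition; (2) $X=L_p(\mu)$, where $\mu$ is a finite measure and $1\le p<\infty$. Then the set of all polynomials $Q\in\mathcal{P}(X:X)$ for which there exist a finite dimensional subspace $F$ of $X$ and a norm-one projection $\pi:X\to F$ such that $\pi\circ Q\circ\pi=Q$ and $Q|_F$ is both a (norm) peak function and a numerical peak function as a mapping from $B_F$ to $F$, is dense in $A_{wu}(B_X:X)$.
   Context: All Banach spaces are complex; $B_X,S_X$ are the closed unit ball and unit sphere. $\mathcal{P}(X:X)$ is the space of continuous polynomials from $X$ to $X$, regarded as functions on the unit ball by restriction. $A_{wu}(B_X:X)$ is the Banach space (sup norm) of bounded functions $f:B_X\to X$ that are uniformly continuous (in norm), holomorphic on the open unit ball, and weakly uniformly continuous on $B_X$ (i.e. uniformly continuous from the weak uniformity on $B_X$ to the norm of $X$). A finite-dimensional (Schauder) decomposition of $X$ is a sequence $\{X_n\}$ of finite-dimensional subspaces such that every $x\in X$ has a unique representation $x=\sum_{n=1}^\infty x_n$ with $x_n\in X_n$; the associated projections $P_n(x)=\sum_{i=1}^n x_i$ are bounded. It is shrinking if $\|P_n^*x^*-x^*\|\to0$ for every $x^*\in X^*$, and monotone if $\|P_n\|=1$ for every $n$. For a Banach space $Y$ and $f:B_Y\to Y$ bounded continuous: $\Pi(Y)=\{(y,y^* )\in S_Y\times S_{Y^*}:y^*(y)=1\}$, $v(f)=\sup\{|y^*(f(y))|:(y,y^* )\in\Pi(Y)\}$.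 $f$ is a (norm) peak function if there is a unique $y\in B_Y$ with $\|f(y)\|=\|f\|:=\sup_{B_Y}\|f\|$, and a numerical peak function if there is a unique $(y,y^* )\in\Pi(Y)$ with $|y^*(f(y))|=v(f)$. *)

(* Defs.v *)
From HB Require Import structures.
From mathcomp Require Import all_boot all_order all_algebra.
From mathcomp Require Import complex.
From mathcomp Require Import all_classical all_reals all_analysis.

Set Implicit Arguments.
Unset Strict Implicit.
Unset Printing Implicit Defensive.
Import Order.TTheory GRing.Theory Num.Theory.
Import numFieldNormedType.Exports.
Local Open Scope classical_set_scope.
Local Open Scope ring_scope.

(* The norm of a [normedModType R[i]] takes its (nonnegative real) values in
   [R[i]]; [rnorm] is the same norm with values in [R]. *)
Definition rnorm (R : realType) (V : normedModType R[i]) (x : V) : R :=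
  complex.Re `|x|.

Definition unit_ball (R : realType) (V : normedModType R[i]) : set V :=
  [set x | rnorm x <= 1].
Arguments unit_ball {R} V.

(* Both the sup norm of a bounded function on the closed unit ball and the
   operator norm of a bounded linear map.  [sup] is 0 on unbounded sets. *)
Definition ball_norm (R : realType) (V W : normedModType R[i])
    (f : V -> W) : R :=
  sup [set rnorm (f x) | x in unit_ball V].

Definition dual (R : realType) (V : normedModType R[i]) : set (V -> R[i]^o) :=
  [set phi : V -> R[i]^o | linear phi /\ continuous phi].
Arguments dual {R} V.

Section Subspaces.
Variables (R : realType) (V : normedModType R[i]).
Implicit Types F : submodClosed V.

Definition finite_dimensional F : Prop :=
  exists (n : nat) (e : 'I_n -> V),
    forall x : V, x \in F <-> exists a : 'I_n -> R[i], x = \sum_i a i *: e i.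

Definition subspace_of F : Type := {x : V | x \in F}.

HB.instance Definition _ F := Choice.on (subspace_of F).
HB.instance Definition _ F := SubChoice.on (subspace_of F).
HB.instance Definition _ F :=
  [SubChoice_isSubLmodule of subspace_of F by <:].

Section Norm.
Variable F : submodClosed V.

Definition subspace_norm (x : subspace_of F) : R[i] := `|val x|.

Fact subspace_normD x y :
  subspace_norm (x + y) <= subspace_norm x + subspace_norm y.
Proof. by rewrite /subspace_norm raddfD ler_normD. Qed.

Fact subspace_normZ (a : R[i]) x :
  subspace_norm (a *: x) = `|a| * subspace_norm x.
Proof. by rewrite /subspace_norm linearZ normrZ. Qed.

Fact subspace_norm_eq0 x : subspace_norm x = 0 -> x = 0.
Proof. by move=> /normr0_eq0 x0; apply: val_inj; rewrite x0 raddf0. Qed.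

HB.instance Definition _ := @Lmodule_isNormed.Build R[i] (subspace_of F)
  subspace_norm subspace_normD subspace_normZ subspace_norm_eq0.
End Norm.

(* The restriction of [Q] to [F], for [Q] mapping [F] into [F]; the default
   value of [insubd] is irrelevant in that case. *)
Definition restrict_to F (Q : V -> V) : subspace_of F -> subspace_of F :=
  fun y => insubd (0 : subspace_of F) (Q (val y)).

Definition norm_one_projection F (pi : V -> subspace_of F) : Prop :=
  [/\ linear pi, (forall y, pi (val y) = y) & ball_norm pi = 1].

End Subspaces.

Section Peak.
Variables (R : realType) (Y : normedModType R[i]).
Implicit Types f : Y -> Y.

Definition Pi_set : set (Y * (Y -> R[i]^o)) :=
  [set p | [/\ rnorm p.1 = 1, dual Y p.2, ball_norm p.2 = 1 & p.2 p.1 = 1]].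

Definition numerical_radius f : R :=
  sup [set rnorm (p.2 (f p.1)) | p in Pi_set].

Definition peak_function f : Prop :=
  exists! y : Y, unit_ball Y y /\ rnorm (f y) = ball_norm f.

Definition numerical_peak_function f : Prop :=
  exists! p : Y * (Y -> R[i]^o),
    Pi_set p /\ rnorm (p.2 (f p.1)) = numerical_radius f.

End Peak.

Section Polynomials.
Variables (R : realType) (X : normedModType R[i]).

Definition multilinear k (A : ('I_k -> X) -> X) : Prop :=
  forall (u : 'I_k -> X) (i : 'I_k),
    linear (fun x : X => A (dfwith u i x)).

(* [{ptws 'I_k -> X}] is the finite product X^k with the product topology. *)
Definition homogeneous_polynomial k (P : X -> X) : Prop :=
  exists A : ('I_k -> X) -> X,
    [/\ multilinear A, continuous (A : {ptws 'I_k -> X} -> X) &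
        forall x, P x = A (fun=> x)].

Definition polynomials : set (X -> X) :=
  [set Q | exists (n : nat) (P : 'I_n -> X -> X),
     (forall k : 'I_n, homogeneous_polynomial k (P k)) /\
     forall x, Q x = \sum_(k < n) P k x].

End Polynomials.
Arguments polynomials {R} X.

Section Awu.
Variables (R : realType) (X : normedModType R[i]).
Implicit Types f : X -> X.

Definition uniformly_continuous_on_ball f : Prop :=
  forall eps : R, 0 < eps -> exists2 delta : R, 0 < delta &
    forall x y, unit_ball X x -> unit_ball X y ->
      rnorm (x - y) < delta -> rnorm (f x - f y) < eps.

(* The sets {(x, y) : |phi_i (x - y)| < delta for all i} form a base of the
   weak uniformity. *)
Definition weakly_uniformly_continuous_on_ball f : Prop :=
  forall eps : R, 0 < eps ->
    exists (n : nat) (phi : 'I_n -> X -> R[i]^o) (delta : R),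
      [/\ forall i, dual X (phi i), 0 < delta &
          forall x y, unit_ball X x -> unit_ball X y ->
            (forall i, rnorm (phi i (x - y)) < delta) ->
            rnorm (f x - f y) < eps].

(* A_wu(B_X : X); the values of [f] outside the unit ball are irrelevant.
   Holomorphy is Frechet differentiability over the complex field. *)
Definition A_wu : set (X -> X) :=
  [set f | [/\ [bounded f x | x in unit_ball X],
     uniformly_continuous_on_ball f,
     forall x, rnorm x < 1 -> differentiable f x &
     weakly_uniformly_continuous_on_ball f]].

(* Density, for the sup norm on the unit ball, in a set [A] of functions
   bounded on that ball. *)
Definition dense_in (D A : set (X -> X)) : Prop :=
  D `<=` A /\
  forall f, A f -> forall eps : R, 0 < eps ->
    exists2 Q, D Q & ball_norm (f - Q) < eps.

End Awu.
Arguments A_wu {R} X.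

Section Decompositions.
Variables (R : realType) (X : normedModType R[i]).

(* [c n x] is the n-th component of x, i.e. the unique representation of x
   is the sum of the [c n x]. *)
Definition fd_decomposition (E : nat -> submodClosed X) (c : nat -> X -> X) :=
  (forall n, finite_dimensional (E n)) /\
  forall x : X,
    [/\ forall n, c n x \in E n,
        series (c^~ x) @ \oo --> x &
        forall u : nat -> X, (forall n, u n \in E n) ->
          series u @ \oo --> x -> u = c^~ x].

(* The first component has index 0, so this is the sum of n + 1 components. *)
Definition decomposition_proj (c : nat -> X -> X) (n : nat) (x : X) : X :=
  \sum_(i < n.+1) c i x.

Definition shrinking (c : nat -> X -> X) : Prop :=
  forall phi, dual X phi ->
    (fun n => ball_norm (phi \o decomposition_proj c n - phi)) @ \oo
      --> (0 : R).

Definition monotone (c : nat -> X -> X) : Prop :=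
  forall n, ball_norm (decomposition_proj c n) = 1.

Definition has_shrinking_monotone_fdd : Prop :=
  exists (E : nat -> submodClosed X) (c : nat -> X -> X),
    [/\ fd_decomposition E c, shrinking c & monotone c].

End Decompositions.
Arguments has_shrinking_monotone_fdd {R} X.

Section Lp.
Variable R : realType.

Definition complex_Lnorm d (T : measurableType d)
    (mu : {measure set T -> \bar R}) (p : R) (f : T -> R[i]) : \bar R :=
  Lnorm mu p%:E (fun t => (rnorm (f t : R[i]^o))%:E).

Definition complex_Lfun d (T : measurableType d)
    (mu : {measure set T -> \bar R}) (p : R) : set (T -> R[i]) :=
  [set f | [/\ measurable_fun setT (fun t => complex.Re (f t)),
     measurable_fun setT (fun t => complex.Im (f t)) &
     (complex_Lnorm mu p f < +oo)%E]].

(* X is (isometrically) the complex space L_p(mu): [cls] plays the role of the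
   quotient map sending a p-integrable function to its class modulo equality
   almost everywhere. *)
Definition is_Lp d (T : measurableType d) (mu : {measure set T -> \bar R})
    (p : R) (X : normedModType R[i]) : Prop :=
  exists cls : (T -> R[i]) -> X,
    [/\ forall (a : R[i]) (f g : T -> R[i]),
          complex_Lfun mu p f -> complex_Lfun mu p g ->
          cls (fun t => a * f t + g t) = a *: cls f + cls g,
        forall f, complex_Lfun mu p f ->
          (rnorm (cls f))%:E = complex_Lnorm mu p f &
        forall x : X, exists2 f, complex_Lfun mu p f & cls f = x].

Definition is_Lp_finite_measure (X : normedModType R[i]) : Prop :=
  exists (d : measure_display) (T : measurableType d)
    (mu : {finite_measure set T -> \bar R}) (p : R),
    1 <= p /\ is_Lp mu p X.

End Lp.

Definition peak_numerical_peak_polynomials (R : realType)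
    (X : normedModType R[i]) : set (X -> X) :=
  [set Q | polynomials X Q /\
    exists (F : submodClosed X) (pi : X -> subspace_of F),
      [/\ finite_dimensional F, norm_one_projection pi,
          forall x, val (pi (Q (val (pi x)))) = Q x,
          peak_function (restrict_to (F := F) Q) &
          numerical_peak_function (restrict_to (F := F) Q)]].
Arguments peak_numerical_peak_polynomials {R} X.

(* Main.v *)
(* All that is used of [X] is that it has norm-one projections [pi] with
   finite-dimensional ranges that are close to the identity both in norm at
   finitely many given points and, uniformly on the ball, after composition
   with finitely many given functionals [phi]. Then [f] in A_wu is close to
   [pi \o f \o pi]: weak uniform continuity controls [f \o pi], and the
   range of [f] is totally bounded. A holomorphic map on the ball of the
   range [F] of [pi] is close to a polynomial by Fejer's theorem on the
   circles [z |-> f (z x)]; the homogeneous components are means over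
   circles, and Cauchy's theorem and Liouville's theorem make them
   polynomials. A polynomial [Q] on [F] becomes a peak and numerical peak
   function after adding an affine map [P]: the convex function [P |-> |Q +
   P| + v (Q + P)] is differentiable at points [P] arbitrarily close to 0,
   where a concave paraboloid touches its graph from above, and the
   derivative determines the points where the two suprema are attained.

   The partial sum projections of a shrinking monotone decomposition have
   the property above. In L_p, so have the conditional expectations on
   finite partitions: averaging over a cell changes [phi] little on the
   functions living on cells where the Radon-Nikodym density of [A |-> phi
   (1_A)] is almost constant, and [phi] is small on the functions living
   where that density is large. *)

From HB Require Import structures.
Require Import Defs.
From mathcomp Require Import all_boot all_order all_algebra.
From mathcomp Require Import complex.
From mathcomp Require Import all_classical all_reals all_analysis.
From mathcomp Require Import measurable_realfun qpoly zify ring lra.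
Set Implicit Arguments.
Unset Strict Implicit.
Unset Printing Implicit Defensive.
Import Order.TTheory GRing.Theory Num.Theory.
Import numFieldNormedType.Exports.
Local Open Scope classical_set_scope.
Local Open Scope ring_scope.

(** * Real-valued moduli and limits *)

(** One perturbation has to produce both kinds of peak; producing them one after the other could
    destroy the first. The sum of the two suprema avoids this: a maximizer of the norm and one of
    the numerical radius together give a subgradient of the sum, so at a point of differentiability
    one of them can be exchanged while the other is kept. Affine maps suffice because constants
    recover the functional from the derivative and rank-one maps then recover the point. Circle
    means are limits of averages over roots of unity, for which Cauchy's theorem is a statement on
    finite sums in logarithmic polar coordinates. A mean only sees the ball; homogeneity extends it
    to the whole space, where growth of order k on each complex line forces a polynomial.
    Polynomials are built from vectors by sums and multiplication by functionals. This class is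
    weakly uniformly continuous, and a polynomial that factors through a finite-dimensional
    projection belongs to it, which gives the inclusion contained in density. In L_p the density of
    a functional is used only on indicators; an estimate for simple functions does the rest. *)

Section RealNorm.
Variables (R : realType) (V : normedModType R[i]).
Implicit Types (x y z : V) (a b : R[i]).

Definition nc (a : R[i]) : R := complex.Re `|a|.

Lemma rnormE x : `|x| = (rnorm x)%:C%C.
Proof. by rewrite /rnorm RRe_real// ger0_real. Qed.

Lemma ncE a : `|a| = (nc a)%:C%C.
Proof. by rewrite /nc RRe_real// ger0_real. Qed.

Lemma rnormC (a : R[i]^o) : rnorm a = nc a. Proof. by []. Qed.

Lemma realc_inj : injective (fun r : R => r%:C%C).
Proof. by move=> r s h; have := congr1 (@complex.Re _) h. Qed.

Lemma lecr (r s : R) : (r%:C%C <= s%:C%C) = (r <= s).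
Proof. by rewrite lecE eqxx. Qed.

Lemma ltcr (r s : R) : (r%:C%C < s%:C%C) = (r < s).
Proof. by rewrite ltcE eqxx. Qed.

Lemma rnorm_ge0 x : 0 <= rnorm x.
Proof. rewrite -lecr -rnormE; exact: normr_ge0. Qed.

Lemma nc_ge0 a : 0 <= nc a.
Proof. rewrite -lecr -ncE; exact: normr_ge0. Qed.

Lemma rnorm0 : rnorm (0 : V) = 0.
Proof. by rewrite /rnorm normr0. Qed.

Lemma nc0 : nc 0 = 0. Proof. by rewrite /nc normr0. Qed.

Lemma nc1 : nc 1 = 1. Proof. by rewrite /nc normr1. Qed.

Lemma rnorm0_eq0 x : rnorm x = 0 -> x = 0.
Proof. by move=> h; apply: normr0_eq0; rewrite rnormE h. Qed.

Lemma nc0_eq0 a : nc a = 0 -> a = 0.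
Proof. by move=> h; apply: normr0_eq0; rewrite ncE h. Qed.

Lemma rnorm_gt0 x : x <> 0 -> 0 < rnorm x.
Proof.
by move=> h; rewrite lt_neqAle rnorm_ge0 andbT eq_sym; apply/eqP => /rnorm0_eq0.
Qed.

Lemma nc_gt0 a : a <> 0 -> 0 < nc a.
Proof.
by move=> h; rewrite lt_neqAle nc_ge0 andbT eq_sym; apply/eqP => /nc0_eq0.
Qed.

Lemma rnormD x y : rnorm (x + y) <= rnorm x + rnorm y.
Proof.
by have := ler_normD x y; rewrite !rnormE -rmorphD lecr.
Qed.

Lemma ncD a b : nc (a + b) <= nc a + nc b.
Proof. by have := ler_normD a b; rewrite !ncE -rmorphD lecr. Qed.

Lemma rnormN x : rnorm (- x) = rnorm x.
Proof. by rewrite /rnorm normrN. Qed.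

Lemma ncN a : nc (- a) = nc a.
Proof. by rewrite /nc normrN. Qed.

Lemma rnormBC x y : rnorm (x - y) = rnorm (y - x).
Proof. by rewrite -rnormN opprB. Qed.

Lemma ncBC a b : nc (a - b) = nc (b - a).
Proof. by rewrite -ncN opprB. Qed.

Lemma rnormZ a x : rnorm (a *: x) = nc a * rnorm x.
Proof. by apply: realc_inj; rewrite /= -rnormE normrZ rmorphM ncE rnormE. Qed.

Lemma ncM a b : nc (a * b) = nc a * nc b.
Proof. by apply: realc_inj; rewrite /= -ncE normrM rmorphM !ncE. Qed.

Lemma ncX a n : nc (a ^+ n) = nc a ^+ n.
Proof. by elim: n => [|n ih]; rewrite ?nc1// !exprS ncM ih. Qed.

Lemma ncV a : nc (a^-1) = (nc a)^-1.
Proof.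
have [->|a0] := eqVneq a 0; first by rewrite invr0 nc0 invr0.
have h : nc a * nc a^-1 = 1 by rewrite -ncM divff// nc1.
have n0 : nc a != 0 by apply/eqP => e; move: h; rewrite e mul0r; lra.
by apply: (mulfI n0); rewrite h divff.
Qed.

Lemma nc_real (r : R) : nc r%:C%C = `|r|.
Proof. by rewrite /nc normc_def /= expr0n /= addr0 sqrtr_sqr. Qed.

Lemma nc_conj a : nc a^*%C = nc a.
Proof. by rewrite /nc !normc_def; case: a => x y /=; rewrite sqrrN. Qed.

Lemma mulc_conj a : a * a^*%C = ((nc a) ^+ 2)%:C%C.
Proof. by rewrite rmorphXn /= -ncE sqr_normc. Qed.

Lemma normRe_le a : `|complex.Re a| <= nc a.
Proof. by rewrite -lecr -ncE normc_ge_Re. Qed.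

Lemma Re_le a : complex.Re a <= nc a.
Proof. exact: le_trans (ler_norm _) (normRe_le a). Qed.

Lemma nci : nc 'i%C = 1.
Proof. by rewrite /nc normc_def /= expr0n /= add0r expr1n sqrtr1. Qed.

Lemma normIm_le a : `|complex.Im a| <= nc a.
Proof.
have := normRe_le (a * 'i%C); rewrite ncM nci mulr1.
by rewrite ReiNIm normrN.
Qed.

Lemma nc_le_ReIm a : nc a <= `|complex.Re a| + `|complex.Im a|.
Proof.
rewrite {1}(complexE a); apply: le_trans (ncD _ _) _.
by rewrite ncM nci mul1r !nc_real.
Qed.

Lemma rnorm_sum (I : Type) (r : seq I) (P : pred I) (F : I -> V) :
  rnorm (\sum_(i <- r | P i) F i) <= \sum_(i <- r | P i) rnorm (F i).
Proof.
elim/big_ind2 : _ => //; first by rewrite rnorm0.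
by move=> x1 r1 x2 r2 h1 h2; apply: le_trans (rnormD _ _) (lerD _ _).
Qed.

Lemma nc_sum (I : Type) (r : seq I) (P : pred I) (F : I -> R[i]) :
  nc (\sum_(i <- r | P i) F i) <= \sum_(i <- r | P i) nc (F i).
Proof.
elim/big_ind2 : _ => //; first by rewrite nc0.
by move=> x1 r1 x2 r2 h1 h2; apply: le_trans (ncD _ _) (lerD _ _).
Qed.

Lemma rnormB_le x y z : rnorm (x - z) <= rnorm (x - y) + rnorm (y - z).
Proof. by rewrite -[x - z](subrKA y); exact: rnormD. Qed.

Lemma ncB_le a b c : nc (a - c) <= nc (a - b) + nc (b - c).
Proof. by rewrite -[a - c](subrKA b); exact: ncD. Qed.

Lemma rnorm_sub_norm x y : `|rnorm x - rnorm y| <= rnorm (x - y).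
Proof.
have h1 := rnormD (x - y) y; have h2 := rnormD (y - x) x.
rewrite ?subrK (rnormBC y x) in h1 h2.
by rewrite ler_norml; apply/andP; split; lra.
Qed.

Lemma nc_sub_norm a b : `|nc a - nc b| <= nc (a - b).
Proof.
have h1 := ncD (a - b) b; have h2 := ncD (b - a) a.
rewrite ?subrK (ncBC b a) in h1 h2.
by rewrite ler_norml; apply/andP; split; lra.
Qed.

Lemma phase_ex a : exists c, nc c = 1 /\ c * a = (nc a)%:C%C.
Proof.
have [->|a0] := eqVneq a 0; first by exists 1; rewrite nc1 nc0 mulr0.
have n0 : nc a != 0 by apply/eqP => /nc0_eq0 e; rewrite e eqxx in a0.
exists (a^*%C / (nc a)%:C%C); split.
  by rewrite ncM ncV nc_real nc_conj ger0_norm ?nc_ge0// divff.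
rewrite mulrAC [_ * a]mulrC mulc_conj rmorphXn /= expr2 mulfK//.
by rewrite (inj_eq realc_inj).
Qed.

End RealNorm.

Section ComplexLimit.
Variable R : realType.
Implicit Types (u v : nat -> R[i]) (a b c : R[i]).

Definition clim u c := forall e : R, 0 < e ->
  exists n0, forall n, (n0 <= n)%N -> nc (u n - c) < e.

Lemma clim_unique u a b : clim u a -> clim u b -> a = b.
Proof.
move=> ha hb; apply: contrapT => ne.
have e0 : 0 < nc (a - b) / 2.
  by rewrite divr_gt0//; apply: nc_gt0 => /subr0_eq.
have [n1 h1] := ha _ e0; have [n2 h2] := hb _ e0.
have := h1 (maxn n1 n2) (leq_maxl _ _); have := h2 (maxn n1 n2) (leq_maxr _ _).
by have := ncB_le a (u (maxn n1 n2)) b; rewrite (ncBC a (u _)); lra.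
Qed.

Lemma clim_cst a : clim (fun=> a) a.
Proof. by move=> e e0; exists 0%N => n _; rewrite subrr nc0. Qed.

Lemma climD u v a b : clim u a -> clim v b -> clim (fun n => u n + v n) (a + b).
Proof.
move=> ha hb e e0; have e2 : 0 < e / 2 by rewrite divr_gt0.
have [n1 h1] := ha _ e2; have [n2 h2] := hb _ e2.
exists (maxn n1 n2) => n; rewrite geq_max => /andP[/h1 + /h2].
have := ncD (u n - a) (v n - b); rewrite (_ : u n - a + _ = u n + v n - (a + b)).
  lra.
by rewrite opprD addrACA.
Qed.

Lemma climZ u a c : clim u a -> clim (fun n => c * u n) (c * a).
Proof.
move=> ha e e0; have c1 : 0 < nc c + 1 by have := nc_ge0 c; lra.
have [n1 h1] := ha (e / (nc c + 1)) (divr_gt0 e0 c1).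
exists n1 => n /h1; rewrite -mulrBr ncM ltr_pdivlMr// => h.
by apply: le_lt_trans h; rewrite mulrC ler_wpM2l ?nc_ge0//; lra.
Qed.

Lemma clim_sum (I : Type) (r : seq I) (P : pred I) (F : I -> nat -> R[i]) f :
  (forall i, clim (F i) (f i)) ->
  clim (fun n => \sum_(i <- r | P i) F i n) (\sum_(i <- r | P i) f i).
Proof.
move=> h; elim: r => [|i r ih].
  by rewrite big_nil; under eq_fun do rewrite big_nil; exact: clim_cst.
rewrite big_cons; under eq_fun do rewrite big_cons.
by case: (P i) => //; apply: climD.
Qed.

Lemma clim_bound u a b (e : R) :
  clim u a -> (exists n0, forall n, (n0 <= n)%N -> nc (u n - b) <= e) ->
  nc (a - b) <= e.
Proof.
move=> ha [n1 h1]; apply/ler_addgt0Pr => d d0.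
have [n2 h2] := ha _ d0.
have := h1 (maxn n1 n2) (leq_maxl _ _); have := h2 (maxn n1 n2) (leq_maxr _ _).
by have := ncB_le a (u (maxn n1 n2)) b; rewrite (ncBC a (u _)); lra.
Qed.

Lemma real_cauchy_cvg (u : nat -> R) :
  (forall e : R, 0 < e -> exists n0, forall m n, (n0 <= m)%N -> (n0 <= n)%N ->
     `|u m - u n| < e) ->
  exists l, forall e : R, 0 < e -> exists n0, forall n, (n0 <= n)%N -> `|u n - l| < e.
Proof.
move=> h.
have : cvg (u @ \oo).
  apply/cauchy_cvgP/cauchy_exP => e e0; have [n0 hn] := h _ e0.
  by exists (u n0), n0 => // n /= hle; rewrite /ball /= hn.
move=> /cvg_ex[l /cvgrPdist_lt hl]; exists l => e e0.
have [n0 _ hn] := hl _ e0; exists n0 => n hle.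
by rewrite distrC; apply: hn.
Qed.

Lemma clim_cauchy u :
  (forall e : R, 0 < e -> exists n0, forall m n, (n0 <= m)%N -> (n0 <= n)%N ->
     nc (u m - u n) < e) -> exists a, clim u a.
Proof.
move=> h.
have [a ha] : exists l, forall e : R, 0 < e ->
    exists n0, forall n, (n0 <= n)%N -> `|complex.Re (u n) - l| < e.
  apply: real_cauchy_cvg => e /h[n0 hn]; exists n0 => m n hm hk.
  by apply: le_lt_trans (hn _ _ hm hk); rewrite -raddfB normRe_le.
have [b hb] : exists l, forall e : R, 0 < e ->
    exists n0, forall n, (n0 <= n)%N -> `|complex.Im (u n) - l| < e.
  apply: real_cauchy_cvg => e /h[n0 hn]; exists n0 => m n hm hk.
  by apply: le_lt_trans (hn _ _ hm hk); rewrite -raddfB normIm_le.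
exists (a +i* b)%C => e e0; have e2 : 0 < e / 2 by rewrite divr_gt0.
have [n1 h1] := ha _ e2; have [n2 h2] := hb _ e2.
exists (maxn n1 n2) => n; rewrite geq_max => /andP[/h1 + /h2].
have := nc_le_ReIm (u n - (a +i* b)%C); rewrite !raddfB /=; lra.
Qed.

End ComplexLimit.

(** * Cauchy's theorem *)

Section Goursat.
Variables (R : realType) (a b : R).
Implicit Types (u : R -> R -> R[i]) (s t h c : R) (m : nat).

(* Left-endpoint Riemann sum of [u dz] along the boundary of the square of side
   [h] at [(s, t)], where [dz] is [a ds + i b dt]; it vanishes exactly when [u] is
   affine in [a s + i b t]. *)
Definition boundary_sum u s t h m : R[i] :=
  (m%:R)^-1 * \sum_(q < m)
    ('i%C * b%:C%C * (u (s + h) (t + h * (q%:R / m%:R)) -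
                      u s (t + h * (q%:R / m%:R))) -
     a%:C%C * (u (s + h * (q%:R / m%:R)) (t + h) -
               u (s + h * (q%:R / m%:R)) t)).

Lemma line_sum_split (V : zmodType) (f : R -> V) t h m : (0 < m)%N ->
  \sum_(q < m + m) f (t + h * (q%:R / (m + m)%:R)) =
  \sum_(q < m) f (t + h / 2 * (q%:R / m%:R)) +
  \sum_(q < m) f (t + h / 2 + h / 2 * (q%:R / m%:R)).
Proof.
move=> m0; have mr : m%:R != 0 :> R by rewrite pnatr_eq0 -lt0n.
have m2 : m%:R + m%:R != 0 :> R by rewrite -natrD pnatr_eq0 -lt0n addn_gt0 m0.
rewrite big_split_ord /=; congr (_ + _); apply: eq_bigr => q _; congr f.
  by rewrite natrD; field; rewrite mr m2.
by rewrite /= !natrD; field; rewrite mr m2.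
Qed.

(** Each inner side is shared by two quarters with opposite orientations and cancels. The factor 1/2
    appears because [boundary_sum] is the Riemann sum of the integral divided by the side [h]. *)
Lemma boundary_sum_split u s t h m : (0 < m)%N ->
  boundary_sum u s t h (m + m) = 2^-1 *
    (boundary_sum u s t (h / 2) m + boundary_sum u (s + h / 2) t (h / 2) m +
     (boundary_sum u s (t + h / 2) (h / 2) m +
      boundary_sum u (s + h / 2) (t + h / 2) (h / 2) m)).
Proof.
move=> m0; have mr : m%:R != 0 :> R[i] by rewrite pnatr_eq0 -lt0n.
rewrite /boundary_sum !sumrB -!mulr_sumr !sumrB.
rewrite (line_sum_split (fun y => u (s + h) y))// (line_sum_split (u s))//.
rewrite (line_sum_split (fun x => u x (t + h)))// (line_sum_split (u^~ t))//.
have hh z : z + h / 2 + h / 2 = z + h by lra.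
rewrite !hh natrD.
have -> : (m%:R + m%:R : R[i])^-1 = 2^-1 * m%:R^-1.
  by rewrite -mulr2n -[_ *+ 2]mulr_natl invfM.
ring.
Qed.

(** The affine part contributes nothing, so that only the error [d] counts: [2 * d] for each of the
    two differences in a term, with weights [|b|] and [|a|]. *)
Lemma boundary_sum_le u s t h m (D k : R[i]) (s0 t0 d : R) : (0 < m)%N ->
  0 <= h ->
  (forall x y, s <= x <= s + h -> t <= y <= t + h ->
    nc (u x y - k - D * ((a * (x - s0))%:C%C + 'i%C * (b * (y - t0))%:C%C)) <= d) ->
  nc (boundary_sum u s t h m) <= 2 * (`|a| + `|b|) * d.
Proof.
move=> m0 h0 hu; rewrite /boundary_sum ncM ncV.
have mr : 0 < m%:R :> R by rewrite ltr0n.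
have -> : nc (m%:R : R[i]) = m%:R.
  by rewrite -(rmorph_nat (real_complex R)) nc_real ger0_norm// ltW.
rewrite ler_pdivrMl//; apply: le_trans (nc_sum _ _ _) _.
rewrite [leRHS]mulr_natl.
have -> : 2 * (`|a| + `|b|) * d *+ m = \sum_(q < m) 2 * (`|a| + `|b|) * d.
  by rewrite sumr_const card_ord.
apply: ler_sum => q _.
set r := fun x y => u x y - k - D * ((a * (x - s0))%:C%C + 'i%C * (b * (y - t0))%:C%C).
set z := h * _.
have z1 : q%:R / m%:R <= 1 :> R by rewrite ler_pdivrMr// mul1r ler_nat ltnW.
have zh : 0 <= z <= h.
  apply/andP; split; last by rewrite /z ler_piMr.
  by rewrite /z mulr_ge0// divr_ge0// ltW.
(* The affine part cancels term by term: its increments across the square are [D * a * h] and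
   [i * D * b * h], and their weights are [i * b] and [- a]. *)
have -> : 'i%C * b%:C%C * (u (s + h) (t + z) - u s (t + z)) -
     a%:C%C * (u (s + z) (t + h) - u (s + z) t) =
  'i%C * b%:C%C * (r (s + h) (t + z) - r s (t + z)) -
     a%:C%C * (r (s + z) (t + h) - r (s + z) t).
  by rewrite /r !(rmorphM, rmorphB, rmorphD) /=; ring.
have hr x y : s <= x <= s + h -> t <= y <= t + h -> nc (r x y) <= d by exact: hu.
have h1 : nc (r (s + h) (t + z)) <= d by apply: hr; lra.
have h2 : nc (r s (t + z)) <= d by apply: hr; lra.
have h3 : nc (r (s + z) (t + h)) <= d by apply: hr; lra.
have h4 : nc (r (s + z) t) <= d by apply: hr; lra.
apply: le_trans (ncD _ _) _; rewrite ncN !ncM nci mul1r !nc_real.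
have h5 : nc (r (s + h) (t + z) - r s (t + z)) <= 2 * d.
  by apply: le_trans (ncD _ _) _; rewrite ncN; lra.
have h6 : nc (r (s + z) (t + h) - r (s + z) t) <= 2 * d.
  by apply: le_trans (ncD _ _) _; rewrite ncN; lra.
have h7 : `|b| * nc (r (s + h) (t + z) - r s (t + z)) <= `|b| * (2 * d).
  by rewrite ler_wpM2l.
have h8 : `|a| * nc (r (s + z) (t + h) - r (s + z) t) <= `|a| * (2 * d).
  by rewrite ler_wpM2l.
lra.
Qed.

(** Complex differentiability in the variable a s + i b t, expressed in the parameters. *)
Definition polar_differentiable u s t := exists D : R[i],
  forall e, 0 < e -> exists2 d, 0 < d & forall x y,
    `|x - s| < d -> `|y - t| < d ->
    nc (u x y - u s t - D * ((a * (x - s))%:C%C + 'i%C * (b * (y - t))%:C%C))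
      <= e * (`|x - s| + `|y - t|).

Lemma exp_half_small (d : R) : 0 < d -> exists k, (2^-1 : R) ^+ k < d.
Proof.
move=> d0; have /cvgrPdist_lt/(_ _ d0)[k _ /(_ k (leqnn _))] :
    (fun k => (2^-1 : R) ^+ k) @ \oo --> (0 : R).
  by apply: cvg_expr; rewrite ger0_norm//; lra.
rewrite /= sub0r normrN => h; exists k.
exact: le_lt_trans (ler_norm _) h.
Qed.

(** Nested squares with dyadic sides: each coordinate of the lower left corners increases and stays
    below that of every upper right corner, so the suprema lie in all the squares. *)
Lemma bisection (P : R -> R -> R -> Prop) :
  (forall s t h, 0 < h -> P s t h ->
     P s t (h / 2) \/ P (s + h / 2) t (h / 2) \/
     P s (t + h / 2) (h / 2) \/ P (s + h / 2) (t + h / 2) (h / 2)) ->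
  P 0 0 1 -> exists s0 t0, [/\ 0 <= s0 <= 1, 0 <= t0 <= 1 &
    forall k, exists s t, [/\ s <= s0 <= s + 2^-1 ^+ k, t <= t0 <= t + 2^-1 ^+ k &
      P s t (2^-1 ^+ k)]].
Proof.
move=> hP hP0.
have hk0 k : 0 < (2^-1 : R) ^+ k by rewrite exprn_gt0//; lra.
have hkS k : (2^-1 : R) ^+ k.+1 = 2^-1 ^+ k / 2 by rewrite exprSr.
have /choice[f hf] : forall x : nat * (R * R), exists y : R * R,
    P x.2.1 x.2.2 (2^-1 ^+ x.1) -> [/\ P y.1 y.2 (2^-1 ^+ x.1.+1),
     x.2.1 <= y.1 <= x.2.1 + 2^-1 ^+ x.1.+1 &
     x.2.2 <= y.2 <= x.2.2 + 2^-1 ^+ x.1.+1].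
  move=> -[k [s t]] /=.
  have := hkS k; have := hk0 k; set h := _ ^+ k => h0 hS; rewrite !hS.
  have [p|np] := pselect (P s t h); last by exists (s, t).
  have [q|[q|[q|q]]] := hP _ _ _ h0 p.
  - by exists (s, t) => _ /=; split => //; lra.
  - by exists (s + h / 2, t) => _ /=; split => //; lra.
  - by exists (s, t + h / 2) => _ /=; split => //; lra.
  - by exists (s + h / 2, t + h / 2) => _ /=; split => //; lra.
pose g := fix g k := if k is k'.+1 then f (k', g k') else (0, 0).
have gP k : P (g k).1 (g k).2 (2^-1 ^+ k).
  elim: k => [|k ih]; first by rewrite expr0.
  by have [] := hf (k, g k) ih.
have gS k : (g k).1 <= (g k.+1).1 <= (g k).1 + 2^-1 ^+ k.+1 /\
            (g k).2 <= (g k.+1).2 <= (g k).2 + 2^-1 ^+ k.+1.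
  by have [] := hf (k, g k) (gP k).
have nested (x : nat -> R) :
    (forall k, x k <= x k.+1 <= x k + 2^-1 ^+ k.+1) ->
    exists l, forall k, x k <= l <= x k + 2^-1 ^+ k.
  move=> hx.
  have up k j : x k <= x (k + j)%N.
    elim: j => [|j ih]; first by rewrite addn0.
    by rewrite addnS; apply: le_trans ih _; have := hx (k + j)%N; lra.
  have dn k j : x (k + j)%N + 2^-1 ^+ (k + j) <= x k + 2^-1 ^+ k.
    elim: j => [|j ih]; first by rewrite addn0.
    rewrite addnS; apply: le_trans ih; have := hx (k + j)%N.
    by rewrite hkS; lra.
  have bd j k : x j <= x k + 2^-1 ^+ k.
    have [jk|/ltnW kj] := leqP j k.
      have := up j (k - j)%N; rewrite subnKC// => h.
      by have := hk0 k; lra.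
    have := dn k (j - k)%N; rewrite subnKC// => h.
    by have := hk0 j; lra.
  exists (sup (range x)) => k; apply/andP; split.
    apply: ub_le_sup; last by exists k.
    by exists (x 0%N + 2^-1 ^+ 0) => _ [j _ <-].
  by apply: ge_sup; [exists (x 0%N), 0%N|move=> _ [j _ <-]].
have [s0 hs0] := nested _ (fun k => (gS k).1).
have [t0 ht0] := nested _ (fun k => (gS k).2).
exists s0, t0; split.
- by have := hs0 0%N; rewrite /= expr0; lra.
- by have := ht0 0%N; rewrite /= expr0; lra.
- by move=> k; exists (g k).1, (g k).2.
Qed.

(** Goursat's argument for sums that are not known to converge: [P s t h] says that the sums over a
    square are at least [c * h] for arbitrarily fine subdivisions, and this passes to one of the
    four quarters. The derivative at the limit point contradicts it. *)
Lemma goursat u :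
  (forall s t, 0 <= s <= 1 -> 0 <= t <= 1 -> polar_differentiable u s t) ->
  clim (fun N => boundary_sum u 0 0 1 (2 ^ N)) 0.
Proof.
move=> hu; apply: contrapT => /existsNP[c /not_implyP[c0 hc]].
pose P s t h := forall N0, exists2 N, (N0 <= N)%N &
  c * h <= nc (boundary_sum u s t h (2 ^ N)).
have P0 : P 0 0 1.
  move=> N0; apply: contrapT => hN; apply: hc; exists N0 => n hn.
  rewrite subr0 ltNge; apply/negP => h; apply: hN; exists n => //.
  by rewrite mulr1.
have PS s t h : 0 < h -> P s t h ->
     P s t (h / 2) \/ P (s + h / 2) t (h / 2) \/
     P s (t + h / 2) (h / 2) \/ P (s + h / 2) (t + h / 2) (h / 2).
  move=> h0 p; apply: contrapT => /not_orP[n1 /not_orP[n2 /not_orP[n3 n4]]].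
  have low s' t' : ~ P s' t' (h / 2) -> exists N0, forall N, (N0 <= N)%N ->
      nc (boundary_sum u s' t' (h / 2) (2 ^ N)) < c * (h / 2).
    move=> /existsNP[N0 hN0]; exists N0 => N hN; rewrite ltNge; apply/negP => q.
    by apply: hN0; exists N.
  have [N1 h1] := low _ _ n1; have [N2 h2] := low _ _ n2.
  have [N3 h3] := low _ _ n3; have [N4 h4] := low _ _ n4.
  (* One more than the four thresholds: splitting the square halves the number of nodes on a
     side. *)
  have [[//|N] hN] := p (maxn (maxn N1 N2) (maxn N3 N4)).+1.
  move: hN; rewrite ltnS !geq_max => /andP[/andP[/h1 g1 /h2 g2] /andP[/h3 g3 /h4 g4]].
  rewrite expnS mul2n -addnn boundary_sum_split ?expn_gt0// ncM ncV.
  have -> : nc (2 : R[i]) = 2.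
    by rewrite -(rmorph_nat (real_complex R)) nc_real ger0_norm.
  set x1 := boundary_sum _ _ _ _ _ in g1 *.
  set x2 := boundary_sum _ _ _ _ _ in g2 *.
  set x3 := boundary_sum _ _ _ _ _ in g3 *.
  set x4 := boundary_sum _ _ _ _ _ in g4 *.
  have := ncD (x1 + x2) (x3 + x4); have := ncD x1 x2; have := ncD x3 x4.
  lra.
have [s0 [t0 [hs0 ht0 hk]]] := bisection PS P0.
have [D hD] := hu _ _ hs0 ht0.
(* With the factor 8 the sum is at most [c * h / 2]: the remainder is the tolerance times [2 * h],
   and [boundary_sum_le] multiplies it by [2 * (|a| + |b|)]. *)
have K0 : 0 < 8 * (`|a| + `|b| + 1) by have := normr_ge0 a; have := normr_ge0 b; lra.
have [d d0 hd] := hD (c / (8 * (`|a| + `|b| + 1))) (divr_gt0 c0 K0).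
have [k kd] := exp_half_small d0.
have [s [t [hs ht /(_ 0%N)[N _ hN]]]] := hk k.
have h0 : 0 < (2^-1 : R) ^+ k by rewrite exprn_gt0//; lra.
move: kd hs ht hN h0; set h := _ ^+ k => kd hs ht hN h0.
have := @boundary_sum_le u s t h (2 ^ N) D (u s0 t0) s0 t0
  (c / (8 * (`|a| + `|b| + 1)) * (2 * h)).
rewrite expn_gt0/= ltW// => /(_ isT isT) H.
have : nc (boundary_sum u s t h (2 ^ N)) <=
    2 * (`|a| + `|b|) * (c / (8 * (`|a| + `|b| + 1)) * (2 * h)).
  apply: H => x y hx hy.
  have xs : `|x - s0| <= h by rewrite ler_norml; lra.
  have yt : `|y - t0| <= h by rewrite ler_norml; lra.
  apply: le_trans (hd _ _ _ _) _; try lra.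
  by rewrite ler_pM2l ?divr_gt0//; lra.
have -> : 2 * (`|a| + `|b|) * (c / (8 * (`|a| + `|b| + 1)) * (2 * h)) =
  c * h * 2^-1 * ((`|a| + `|b|) / (`|a| + `|b| + 1)).
  field; have := normr_ge0 a; have := normr_ge0 b; lra.
have q1 : (`|a| + `|b|) / (`|a| + `|b| + 1) <= 1.
  by rewrite ler_pdivrMr; have := normr_ge0 a; have := normr_ge0 b; lra.
have ch : 0 < c * h by rewrite mulr_gt0.
have : c * h * 2^-1 * ((`|a| + `|b|) / (`|a| + `|b| + 1)) <= c * h * 2^-1.
  by rewrite ler_piMr//; lra.
lra.
Qed.

End Goursat.

(** * Logarithmic polar coordinates *)

Section Cis.
Variable R : realType.
Implicit Types (s t e : R) (z w : R[i]).

Definition cis t : R[i] := (cos (2 * pi * t) +i* sin (2 * pi * t))%C.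

Lemma cis0 : cis 0 = 1.
Proof. by rewrite /cis mulr0 cos0 sin0. Qed.

Lemma cis1 : cis 1 = 1.
Proof. by rewrite /cis mulr1 mulr_natl cos2pi sin2pi. Qed.

Lemma cisD s t : cis (s + t) = cis s * cis t.
Proof.
rewrite /cis mulrDr cosD sinD; apply/eqP; rewrite eq_complex /=.
by apply/andP; split; apply/eqP; ring.
Qed.

Lemma cisX t n : cis (n%:R * t) = cis t ^+ n.
Proof.
elim: n => [|n ih]; first by rewrite mul0r cis0 expr0.
by rewrite -natr1 mulrDl mul1r cisD ih exprSr.
Qed.

Lemma nc_cis t : nc (cis t) = 1.
Proof. by rewrite /nc normc_def /= cos2Dsin2 sqrtr1. Qed.

Lemma cis_neq1 t : 0 < t < 1 -> cis t != 1.
Proof.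
move=> ht; apply/eqP => /(congr1 (@complex.Re _)) /=.
have -> : 2 * pi * t = (pi * t) *+ 2 :> R by rewrite -mulrA mulr_natl.
rewrite cos_mulr2n => h.
have p0 := pi_gt0 R.
have h1 : 0 < sin (pi * t).
  by apply: sin_gt0_pi; rewrite mulr_gt0 ?gtr_pMr//; lra.
have := cos2Dsin2 (pi * t); nra.
Qed.

Lemma is_derive_bound (f : R -> R) (x df : R) : is_derive x 1 f df ->
  forall e, 0 < e -> exists2 d : R, 0 < d & forall y, `|y - x| < d ->
    `|f y - f x - df * (y - x)| <= e * `|y - x|.
Proof.
move=> [fd <-] e e0.
have /cvgrPdist_le/(_ _ e0)[d /= d0 hd] :
  (h^-1 *: ((f \o shift x) (h *: 1) - f x)) @[h --> 0^'] --> 'D_1 f x := fd.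
exists d => // y yx; have [->|ne] := eqVneq y x.
  by rewrite !subrr mulr0 subrr normr0 mulr0.
have yx0 : y - x != 0 by rewrite subr_eq0.
have := hd (y - x); rewrite /ball_ /= sub0r normrN => /(_ yx yx0).
rewrite /shift /= -[(y - x) *: 1]/((y - x) * 1) mulr1 subrK.
rewrite -[_ *: _]/((y - x)^-1 * (f y - f x)) => h.
have -> : f y - f x - 'D_1 f x * (y - x) =
   - (('D_1 f x - (y - x)^-1 * (f y - f x)) * (y - x)).
  by field.
by rewrite normrN normrM ler_wpM2r.
Qed.

Lemma expR_bound (a e : R) : 0 < e -> exists2 d : R, 0 < d & forall h, `|h| < d ->
  `|expR (a * h) - 1 - a * h| <= e * `|h|.
Proof.
move=> e0; have a1 : 0 < `|a| + 1 by have := normr_ge0 a; lra.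
have [d d0 hd] := is_derive_bound (is_derive_expR 0) (divr_gt0 e0 a1).
exists (d / (`|a| + 1)); first exact: divr_gt0.
move=> h; rewrite ltr_pdivlMr// => hh.
have := hd (a * h); rewrite !subr0 expR0 mul1r normrM.
have ah : `|a| * `|h| <= `|h| * (`|a| + 1) by have := normr_ge0 h; lra.
move=> /(_ (le_lt_trans ah hh)) /le_trans; apply.
rewrite mulrAC ler_pdivrMr//; rewrite -mulrA ler_pM2l//.
Qed.

Lemma cis_bound e : 0 < e -> exists2 d : R, 0 < d & forall k, `|k| < d ->
  nc (cis k - 1 - 'i%C * (2 * pi * k)%:C%C) <= e * `|k|.
Proof.
move=> e0; have p0 := pi_gt0 R.
have q0 : 0 < 4 * pi :> R by lra.
have [d1 d10 h1] := is_derive_bound (is_derive_cos 0) (divr_gt0 e0 q0).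
have [d2 d20 h2] := is_derive_bound (is_derive_sin 0) (divr_gt0 e0 q0).
exists (Num.min d1 d2 / (2 * pi)); first by rewrite divr_gt0 ?lt_min ?d10//; lra.
move=> k; rewrite ltr_pdivlMr; last lra.
have n2 : `|2 * pi * k| = `|k| * (2 * pi).
  by rewrite normrM mulrC [`|2 * pi|]ger0_norm//; lra.
rewrite -n2 lt_min => /andP[k1 k2].
have := h1 (2 * pi * k); have := h2 (2 * pi * k).
rewrite !subr0 sin0 cos0 oppr0 mul0r subr0 mul1r => /(_ k2) g2 /(_ k1) g1.
apply: le_trans (nc_le_ReIm _) _; rewrite /cis /= !(mul0r, mul1r, subr0, add0r, oppr0, addr0, mulr0).
move: g1 g2; rewrite n2 ?addr0.
have -> : e / (4 * pi) * (`|k| * (2 * pi)) = e * `|k| / 2 by field; lra.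
lra.
Qed.

Lemma cis_small e : 0 < e -> exists2 d : R, 0 < d & forall k, `|k| < d ->
  nc (cis k - 1) <= e.
Proof.
move=> e0; have p0 := pi_gt0 R.
have [d d0 hd] := cis_bound ltr01.
have q0 : 0 < 2 * pi + 1 :> R by lra.
exists (Num.min d (e / (2 * pi + 1))); first by rewrite lt_min d0 divr_gt0.
move=> k; rewrite lt_min ltr_pdivlMr// => /andP[/hd h1 h2].
rewrite -[cis k - 1](subrK ('i%C * (2 * pi * k)%:C%C)).
apply: le_trans (ncD _ _) _; rewrite ncM nci mul1r nc_real normrM ger0_norm; lra.
Qed.

Lemma cis_unif e : 0 < e -> exists2 d : R, 0 < d & forall s t, `|s - t| < d ->
  nc (cis s - cis t) <= e.
Proof.
move=> /cis_small[d d0 hd]; exists d => // s t /hd.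
have -> : cis s - cis t = (cis (s - t) - 1) * cis t.
  by rewrite mulrBl -cisD subrK mul1r.
by rewrite ncM nc_cis mulr1.
Qed.

(** First-order expansion of exp (a h + 2 pi i k) at 0; the product of the radial and the angular
    increment is of second order. *)
Lemma polar_bound (a e : R) : 0 < e -> exists2 d : R, 0 < d & forall h k,
  `|h| < d -> `|k| < d ->
  nc ((expR (a * h))%:C%C * cis k - 1 -
      ((a * h)%:C%C + 'i%C * (2 * pi * k)%:C%C)) <= e * (`|h| + `|k|).
Proof.
move=> e0; pose e1 := e / 2; have e10 : 0 < e1 by rewrite divr_gt0.
have a1 : 0 < `|a| + e1 by have := normr_ge0 a; lra.
have [d1 d10 h1] := expR_bound a e10.
have [d2 d20 h2] := cis_bound e10.
have [d3 d30 h3] := cis_small (divr_gt0 e10 a1).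
exists (Num.min d1 (Num.min d2 d3)); first by rewrite !lt_min d10 d20 d30.
move=> h k; rewrite !lt_min => /and3P[+ _ _] /and3P[_ + +].
move=> /h1 {}h1 /h2 {}h2 /h3 {}h3.
set E := expR _ in h1 *; set c := cis k in h2 h3 *.
have -> : E%:C%C * c - 1 - ((a * h)%:C%C + 'i%C * (2 * pi * k)%:C%C) =
  ((E - 1)%:C%C * (c - 1) + (E - 1 - a * h)%:C%C) +
   (c - 1 - 'i%C * (2 * pi * k)%:C%C).
  by rewrite !(rmorphB, rmorph1) /=; ring.
have hE : `|E - 1| <= (`|a| + e1) * `|h|.
  rewrite -[E - 1](subrK (a * h)); apply: le_trans (ler_normD _ _) _.
  by rewrite normrM; lra.
apply: le_trans (ncD _ _) _.
have : nc ((E - 1)%:C%C * (c - 1)) <= e1 * `|h|.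
  rewrite ncM nc_real; have := ler_pM (normr_ge0 _) (nc_ge0 _) hE h3.
  move=> /le_trans; apply; rewrite le_eqVlt; apply/orP; left; apply/eqP.
  by field; lra.
have := ncD ((E - 1)%:C%C * (c - 1)) (E - 1 - a * h)%:C%C.
rewrite nc_real; rewrite /e1 in h1 h2 *; have := mulr_ge0 (ltW e0) (normr_ge0 k).
have := normr_ge0 h.
lra.
Qed.

Definition cdiff (H : R[i] -> R[i]) z := exists D, forall e, 0 < e ->
  exists2 d : R, 0 < d & forall w, nc (w - z) < d ->
    nc (H w - H z - D * (w - z)) <= e * nc (w - z).

(** Chain rule for z = r exp (a s + 2 pi i t), whose differential is z (a ds + 2 pi i dt); hence the
    derivative [D * z]. *)
Lemma cdiff_polar (H : R[i] -> R[i]) (r a s t : R) : 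
  cdiff H ((r * expR (a * s))%:C%C * cis t) ->
  polar_differentiable a (2 * pi)
    (fun s t => H ((r * expR (a * s))%:C%C * cis t)) s t.
Proof.
set z := _ * cis t => -[D hD]; exists (D * z) => e e0.
have p0 := pi_gt0 R.
(* The centre is reached only for [r = 0], and then the composed map is constant. *)
have [zz|/nc_gt0 z0] := pselect (z = 0).
  have r0 : r = 0.
    move: zz => /(congr1 (@nc R)); rewrite /z ncM nc_cis mulr1 nc_real nc0.
    move=> /eqP; rewrite normr_eq0 mulf_eq0 => /orP[/eqP//|].
    by rewrite gt_eqF// expR_gt0.
  exists 1 => // x y _ _; rewrite zz r0 !mul0r mulr0 mul0r !subrr nc0.
  by rewrite mulr_ge0// ?addr_ge0//; lra.
pose L (h k : R) : R[i] := (a * h)%:C%C + 'i%C * (2 * pi * k)%:C%C.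
pose B := `|a| + 2 * pi + 1.
have B0 : 0 < B by rewrite /B; have := normr_ge0 a; lra.
have e1 : 0 < e / (2 * B * nc z) by rewrite !(divr_gt0, mulr_gt0).
have D1 : 0 < nc D + 1 by have := nc_ge0 D; lra.
have e2 : 0 < e / (2 * (nc D + 1) * nc z) by rewrite !(divr_gt0, mulr_gt0).
have [d1 d10 h1] := hD _ e1.
have [d2 d20 h2] := polar_bound a e2.
have [d3 d30 h3] := polar_bound a ltr01.
pose d4 := d1 / (2 * B * nc z).
have d40 : 0 < d4 by rewrite !(divr_gt0, mulr_gt0).
exists (Num.min d2 (Num.min d3 d4)); first by rewrite !lt_min d20 d30.
move=> x y; rewrite !lt_min => /and3P[x2 x3 x4] /and3P[y2 y3 y4].
have {}h2 := h2 _ _ x2 y2; have {}h3 := h3 _ _ x3 y3.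
set w := _ * cis y.
pose E := (expR (a * (x - s)))%:C%C * cis (y - t).
have wz : w = z * E.
  rewrite /w /z /E -[x in LHS](subrK s) -[y in LHS](subrK t) cisD mulrDr expRD.
  by rewrite !rmorphM /=; ring.
rewrite -/E -/(L (x - s) (y - t)) in h2 h3 *.
have nL : nc (L (x - s) (y - t)) <= (B - 1) * (`|x - s| + `|y - t|).
  apply: le_trans (ncD _ _) _; rewrite ncM nci mul1r !nc_real !normrM.
  rewrite [`|2|]ger0_norm// [`|pi|]ger0_norm//; last exact: ltW.
  rewrite /B; have := normr_ge0 a; have := normr_ge0 (x - s).
  by have := normr_ge0 (y - t); nra.
have nE : nc (E - 1) <= B * (`|x - s| + `|y - t|).
  rewrite -[E - 1](subrK (L (x - s) (y - t))).
  by apply: le_trans (ncD _ _) _; lra.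
have wzE : w - z = z * (E - 1) by rewrite wz; ring.
have nwz : nc (w - z) <= nc z * (B * (`|x - s| + `|y - t|)).
  by rewrite wzE ncM ler_pM2l.
have wd : nc (w - z) < d1.
  apply: le_lt_trans nwz _; move: x4 y4; rewrite /d4 !ltr_pdivlMr ?mulr_gt0//.
  lra.
have -> : H w - H z - D * z * L (x - s) (y - t) =
  (H w - H z - D * (w - z)) + D * z * (E - 1 - L (x - s) (y - t)).
  by rewrite wzE; ring.
apply: le_trans (ncD _ _) _; rewrite (ncM (D * z)) (ncM D z).
have g1 : nc (H w - H z - D * (w - z)) <= e / 2 * (`|x - s| + `|y - t|).
  apply: le_trans (h1 _ wd) _.
  apply: le_trans (ler_wpM2l (ltW e1) nwz) _.
  by rewrite le_eqVlt; apply/orP; left; apply/eqP; field; lra.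
have g2 : nc D * nc z * nc (E - 1 - L (x - s) (y - t)) <=
    e / 2 * (`|x - s| + `|y - t|).
  apply: le_trans (ler_wpM2l _ h2) _; first by rewrite mulr_ge0 ?nc_ge0.
  have -> : nc D * nc z * (e / (2 * (nc D + 1) * nc z) * (`|x - s| + `|y - t|))
    = nc D / (nc D + 1) * (e / 2 * (`|x - s| + `|y - t|)).
    by field; lra.
  apply: ler_piMl; first by rewrite mulr_ge0// ?addr_ge0//; lra.
  by rewrite ler_pdivrMr//; lra.
lra.
Qed.

(** The dyadic number of nodes fits the bisections of [goursat] and makes every finer average a
    refinement of the coarser ones. *)
Definition circle_avg m (f : R[i] -> R[i]) : R[i] :=
  ((2 ^ m)%:R)^-1 * \sum_(j < 2 ^ m) f (cis (j%:R / (2 ^ m)%:R)).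

(* Cauchy's theorem in polar coordinates; no contour integral is needed, only
   Riemann sums over roots of unity. *)
Lemma cauchy_circles (H : R[i] -> R[i]) (r1 r2 : R) : 0 < r1 -> r1 <= r2 ->
  (forall z, r1 <= nc z <= r2 -> cdiff H z) ->
  clim (fun m => circle_avg m (fun z => H (r2%:C%C * z)) -
                 circle_avg m (fun z => H (r1%:C%C * z))) 0.
Proof.
move=> r10 r12 hH; have r20 : 0 < r2 by lra.
have p0 := pi_gt0 R.
(* With this [a] the unit square covers the annulus: [s = 0] and [s = 1] give the two circles, while
   [t = 0] and [t = 1] give the same radius and cancel. *)
pose a := ln (r2 / r1).
have a0 : 0 <= a by rewrite ln_ge0// ler_pdivlMr//; lra.
have ea : expR a = r2 / r1 by rewrite lnK// posrE divr_gt0.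
pose u s t := H ((r1 * expR (a * s))%:C%C * cis t).
have hu s t : 0 <= s <= 1 -> 0 <= t <= 1 -> polar_differentiable a (2 * pi) u s t.
  move=> hs _; apply: cdiff_polar; apply: hH.
  rewrite ncM nc_cis mulr1 nc_real ger0_norm; last first.
    by rewrite mulr_ge0 ?expR_ge0// ltW.
  have s0 : 0 <= a * s by rewrite mulr_ge0//; lra.
  have sa : a * s <= a by rewrite ler_piMr//; lra.
  have ge1 : 1 <= expR (a * s) by rewrite -[leLHS]expR0 ler_expR.
  apply/andP; split; first by apply: ler_peMr => //; apply: ltW.
  by rewrite -ler_pdivlMl// [leRHS]mulrC -ea ler_expR.
have := climZ ('i%C * (2 * pi)%:C%C)^-1 (goursat hu); rewrite mulr0.
rewrite (_ : (fun n => _) = fun m =>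
    circle_avg m (fun z => H (r2%:C%C * z)) -
    circle_avg m (fun z => H (r1%:C%C * z)))//.
apply/funext => m; rewrite /boundary_sum /circle_avg.
have b0 : 'i%C * (2 * pi)%:C%C != 0 :> R[i].
  apply/eqP => /(congr1 (@nc R)); rewrite ncM nci nc0 mul1r nc_real ger0_norm; lra.
rewrite -mulrBr -sumrB mulrCA mulr_sumr; congr (_ * _); apply: eq_bigr => q _.
have u1 s : u s (0 + 1) = u s 0 by rewrite /u add0r cis1 cis0.
rewrite u1 subrr mulr0 subr0 mulrA mulVf// mul1r /u !add0r mul1r mulr1 mulr0 expR0.
by rewrite !mulr1 ea [r1 * _]mulrC divfK// gt_eqF.
Qed.

End Cis.

(** * Circle means and Fejer's estimate *)

Section CircleMean.
Variable R : realType.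
Implicit Types (e d r : R) (z w c : R[i]) (f g : R[i] -> R[i]).

Definition circle_cont f := forall e, 0 < e -> exists2 d : R, 0 < d &
  forall z w, nc z = 1 -> nc w = 1 -> nc (z - w) < d -> nc (f z - f w) <= e.

Lemma sum_ord_mul (V : nmodType) (F : nat -> V) (a b : nat) :
  \sum_(j < a * b) F j = \sum_(i < a) \sum_(q < b) F (i * b + q)%N.
Proof.
elim: a => [|a ih]; first by rewrite !big_ord0.
by rewrite mulSnr big_split_ord /= ih big_ord_recr.
Qed.

Lemma pow2_neq0 (K : numDomainType) m : (2 ^ m)%:R != 0 :> K.
Proof. by rewrite pnatr_eq0 expn_eq0. Qed.

Lemma nc_nat n : nc (n%:R : R[i]) = n%:R.
Proof. by rewrite -(rmorph_nat (real_complex R)) nc_real ger0_norm. Qed.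

Lemma circle_avg_le m f e : (forall z, nc z = 1 -> nc (f z) <= e) ->
  nc (circle_avg m f) <= e.
Proof.
move=> h; rewrite /circle_avg ncM ncV nc_nat ler_pdivrMl; last first.
  by rewrite ltr0n expn_gt0.
apply: le_trans (nc_sum _ _ _) _.
have -> : (2 ^ m)%:R * e = \sum_(i < 2 ^ m) e.
  by rewrite sumr_const card_ord mulr_natl.
by apply: ler_sum => i _; apply: h; rewrite nc_cis.
Qed.

Lemma circle_avgB m f g :
  circle_avg m f - circle_avg m g = circle_avg m (fun z => f z - g z).
Proof. by rewrite /circle_avg -mulrBr -sumrB. Qed.

Lemma circle_avgZ m f c : circle_avg m (fun z => c * f z) = c * circle_avg m f.
Proof. by rewrite /circle_avg -mulr_sumr mulrCA. Qed.

Lemma eq_circle_avg m f g : (forall z, nc z = 1 -> f z = g z) ->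
  circle_avg m f = circle_avg m g.
Proof.
move=> h; congr (_ * _); apply: eq_bigr => i _.
by apply: h; rewrite nc_cis.
Qed.

Lemma circle_avg_sum m (I : Type) (s : seq I) (P : pred I) (F : I -> R[i] -> R[i]) :
  circle_avg m (fun z => \sum_(i <- s | P i) F i z) =
  \sum_(i <- s | P i) circle_avg m (F i).
Proof. by rewrite /circle_avg exchange_big mulr_sumr. Qed.

(** The fine nodes are grouped in blocks, each compared with the coarse node where it starts. The
    threshold depends on [d] alone and not on [f], so that one average can replace the means of a
    whole family of functions. *)
Lemma circle_avg_mesh d : 0 < d -> exists m0, forall f e,
  (forall z w, nc z = 1 -> nc w = 1 -> nc (z - w) < d -> nc (f z - f w) <= e) ->
  forall m k, (m0 <= m)%N -> nc (circle_avg (m + k) f - circle_avg m f) <= e.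
Proof.
move=> d0; have d20 : 0 < d / 2 by lra.
have [n n0 hn] := cis_unif d20.
have [m0 hm0] := exp_half_small n0.
exists m0 => f e hf m k m0m.
have hm : (2 ^ m)%:R^-1 < n.
  apply: le_lt_trans hm0; rewrite natrX -exprVn.
  by apply: ler_wiXn2l => //; lra.
have a0 : (0 : R) < (2 ^ m)%:R by rewrite ltr0n expn_gt0.
have b0 : (0 : R) < (2 ^ k)%:R by rewrite ltr0n expn_gt0.
have -> : circle_avg (m + k) f - circle_avg m f = ((2 ^ m)%:R)^-1 *
   \sum_(i < 2 ^ m) (((2 ^ k)%:R)^-1 * \sum_(q < 2 ^ k)
     (f (cis ((i * 2 ^ k + q)%N%:R / (2 ^ (m + k))%:R)) -
      f (cis (i%:R / (2 ^ m)%:R)))).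
  rewrite /circle_avg.
  have E (F : nat -> R[i]) c : (2 ^ k)%:R^-1 * (\sum_(q < 2 ^ k) (F q - c)) =
      (2 ^ k)%:R^-1 * (\sum_(q < 2 ^ k) F q) - c.
    by rewrite sumrB sumr_const card_ord mulrBr -[c *+ _]mulr_natl mulKf ?pow2_neq0.
  under [in RHS]eq_bigr => i _ do
    rewrite (E (fun q => f (cis ((i * 2 ^ k + q)%N%:R / (2 ^ (m + k))%:R)))).
  rewrite sumrB -mulr_sumr mulrBr mulrA; congr (_ - _).
  rewrite expnD natrM invfM; congr (_ * _).
  by rewrite (sum_ord_mul (fun j => f (cis (j%:R / (2 ^ m * 2 ^ k)%:R)))).
rewrite ncM ncV nc_nat ler_pdivrMl//; apply: le_trans (nc_sum _ _ _) _.
have -> : (2 ^ m)%:R * e = \sum_(i < 2 ^ m) e.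
  by rewrite sumr_const card_ord mulr_natl.
apply: ler_sum => i _; rewrite ncM ncV nc_nat ler_pdivrMl//.
apply: le_trans (nc_sum _ _ _) _.
have -> : (2 ^ k)%:R * e = \sum_(i < 2 ^ k) e.
  by rewrite sumr_const card_ord mulr_natl.
apply: ler_sum => q _; apply: hf; rewrite ?nc_cis//.
apply: (@le_lt_trans _ _ (d / 2)); last lra.
apply: hn; rewrite expnD !natrD !natrM.
have -> : (i%:R * (2 ^ k)%:R + q%:R) / ((2 ^ m)%:R * (2 ^ k)%:R) - i%:R / (2 ^ m)%:R
  = q%:R / (2 ^ k)%:R * (2 ^ m)%:R^-1 :> R.
  by field; rewrite !pow2_neq0.
rewrite ger0_norm; last by rewrite !(divr_ge0, mulr_ge0)// ?invr_ge0.
apply: le_lt_trans hm; apply: ler_piMl; first by rewrite invr_ge0.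
by rewrite ler_pdivrMr// mul1r ler_nat ltnW.
Qed.

(** The normalized integral over the unit circle, with default value 0 when the averages do not
    converge. *)
Definition circle_mean f : R[i] := xget 0 [set c : R[i] | clim (fun m => circle_avg m f) c].

Lemma circle_meanP f : circle_cont f -> clim (fun m => circle_avg m f) (circle_mean f).
Proof.
move=> hf; apply: xgetPex; apply: clim_cauchy => e e0.
have e3 : 0 < e / 3 by lra.
have [d d0 hd] := hf _ e3; have [m0 hm] := circle_avg_mesh d0.
exists m0 => m n hm0 hn0.
have := hm _ _ hd m0 (m - m0)%N (leqnn _).
have := hm _ _ hd m0 (n - m0)%N (leqnn _).
rewrite !subnKC//; have := ncB_le (circle_avg m f) (circle_avg m0 f) (circle_avg n f).
rewrite [nc (circle_avg m0 f - _)]ncBC; lra.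
Qed.

Lemma eq_circle_mean f g : (forall z, nc z = 1 -> f z = g z) ->
  circle_mean f = circle_mean g.
Proof.
move=> h; rewrite /circle_mean.
have -> // : (fun m => circle_avg m f) = (fun m => circle_avg m g).
by apply/funext => m; apply: eq_circle_avg.
Qed.

Lemma circle_mean_mesh d : 0 < d -> exists m0, forall f e, circle_cont f ->
  (forall z w, nc z = 1 -> nc w = 1 -> nc (z - w) < d -> nc (f z - f w) <= e) ->
  forall m, (m0 <= m)%N -> nc (circle_avg m f - circle_mean f) <= e.
Proof.
move=> /circle_avg_mesh[m0 hm0]; exists m0 => f e hc hf m m0m; rewrite ncBC.
apply: clim_bound (circle_meanP hc) _; exists m => n mn.
by have := hm0 _ _ hf m (n - m)%N m0m; rewrite subnKC.
Qed.

Lemma circle_mean_close f g e : circle_cont f -> circle_cont g ->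
  (forall z, nc z = 1 -> nc (f z - g z) <= e) ->
  nc (circle_mean f - circle_mean g) <= e.
Proof.
move=> hf hg h; have := climD (circle_meanP hf) (climZ (-1) (circle_meanP hg)).
rewrite mulN1r => hc; rewrite -[_ - _]subr0.
apply: (clim_bound hc); exists 0%N => n _; rewrite subr0 mulN1r circle_avgB.
exact: circle_avg_le.
Qed.

Lemma circle_mean_le f e : circle_cont f ->
  (forall z, nc z = 1 -> nc (f z) <= e) -> nc (circle_mean f) <= e.
Proof.
move=> hf h; rewrite -[circle_mean _]subr0.
apply: (clim_bound (circle_meanP hf)); exists 0%N => n _; rewrite subr0.
exact: circle_avg_le.
Qed.

Lemma circle_contM f g (B : R) : circle_cont f -> circle_cont g ->
  (forall z, nc z = 1 -> nc (f z) <= B) -> (forall z, nc z = 1 -> nc (g z) <= B) ->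
  circle_cont (fun z => f z * g z).
Proof.
move=> hf hg bf bg e e0.
have B0 : 0 <= B by apply: le_trans (bf 1 (nc1 R)); exact: nc_ge0.
have e1 : 0 < e / (2 * (B + 1)) by rewrite divr_gt0//; lra.
have [d1 d10 h1] := hf _ e1; have [d2 d20 h2] := hg _ e1.
exists (Num.min d1 d2); first by rewrite lt_min d10.
move=> z w z1 w1; rewrite lt_min => /andP[/h1 g1 /h2 g2].
have -> : f z * g z - f w * g w = (f z - f w) * g z + f w * (g z - g w) by ring.
apply: le_trans (ncD _ _) _; rewrite !ncM.
have k1 := ler_pM (nc_ge0 _) (nc_ge0 _) (g1 z1 w1) (bg z z1).
have k2 := ler_pM (nc_ge0 _) (nc_ge0 _) (bf w w1) (g2 z1 w1).
apply: le_trans (lerD k1 k2) _.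
have -> : e / (2 * (B + 1)) * B + B * (e / (2 * (B + 1))) = e * (B / (B + 1)).
  by field; lra.
by apply: ler_piMr; [exact: ltW|rewrite ler_pdivrMr; lra].
Qed.

Lemma circle_conj z : nc z = 1 -> z^*%C = z^-1.
Proof.
move=> z1; have z0 : z != 0 by apply/eqP => h; move: z1; rewrite h nc0; lra.
by apply: (mulfI z0); rewrite mulc_conj z1 expr1n divff.
Qed.

Lemma nc_expz z (n : int) : nc z = 1 -> nc (z ^ n) = 1.
Proof.
move=> z1; case: n => n; first by rewrite -exprnP ncX z1 expr1n.
by rewrite NegzE -exprnN ncV ncX z1 expr1n invr1.
Qed.

Lemma circle_cont_cst c : circle_cont (fun=> c).
Proof. by move=> e e0; exists 1 => // z w _ _ _; rewrite subrr nc0 ltW. Qed.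

Lemma circle_cont_expz (n : int) : circle_cont (fun z => z ^ n).
Proof.
have pos (k : nat) : circle_cont (fun z => z ^+ k).
  elim: k => [|k ih].
    by under eq_fun do rewrite expr0; exact: circle_cont_cst.
  under eq_fun do rewrite exprS.
  apply: (@circle_contM _ _ 1) => //.
  - by move=> e e0; exists e => // z w _ _ /ltW.
  - by move=> z ->.
  - by move=> z z1; rewrite ncX z1 expr1n.
case: n => k; first exact: pos.
move=> e e0; have [d d0 hd] := pos k.+1 e e0; exists d => // z w z1 w1 zw.
rewrite NegzE -!exprnN -!exprVn -!circle_conj//; apply: hd; rewrite ?nc_conj//.
by rewrite -rmorphB nc_conj.
Qed.

Lemma circle_cont_expzM (n : int) f B : circle_cont f ->
  (forall z, nc z = 1 -> nc (f z) <= B) -> circle_cont (fun z => z ^ n * f z).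
Proof.
move=> hf hB; apply: (@circle_contM _ _ (Num.max 1 B)) => //.
- exact: circle_cont_expz.
- by move=> z z1; rewrite nc_expz// le_max lexx.
- by move=> z z1; rewrite le_max hB// orbT.
Qed.

(** A geometric sum of powers of a root of unity; the bound on [n] ensures that this root is not
    1. *)
Lemma circle_avg_expz m (n : int) : n != 0 -> (absz n < 2 ^ m)%N ->
  circle_avg m (fun z => z ^ n) = 0.
Proof.
have pos (k : nat) : (0 < k < 2 ^ m)%N -> circle_avg m (fun z => z ^+ k) = 0.
  move=> /andP[k0 km]; rewrite /circle_avg.
  have m0 : (0 : R) < (2 ^ m)%:R by rewrite ltr0n expn_gt0.
  pose w : R[i] := @cis R (k%:R / (2 ^ m)%:R).
  have -> : \sum_(j < 2 ^ m) @cis R (j%:R / (2 ^ m)%:R) ^+ k =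
      \sum_(j < 2 ^ m) w ^+ j :> R[i].
    by apply: eq_bigr => j _; rewrite -!cisX; congr cis; ring.
  have w1 : w != 1.
    apply: cis_neq1; apply/andP; split; first by apply: divr_gt0; rewrite // ltr0n.
    by rewrite ltr_pdivrMr// mul1r ltr_nat.
  have : (w - 1) * \sum_(j < 2 ^ m) w ^+ j = 0.
    rewrite -subrX1 /w -cisX mulrC divfK ?pow2_neq0//.
    by rewrite -[k%:R]mulr1 cisX cis1 expr1n subrr.
  by move/eqP; rewrite mulf_eq0 subr_eq0 (negPf w1) /= => /eqP ->; rewrite mulr0.
case: n => k /= k0 km; first by apply: pos; rewrite lt0n k0.
have := congr1 (@conjc R) (pos k.+1 km); rewrite rmorph0 => <-.
rewrite /circle_avg rmorphM rmorph_sum fmorphV rmorph_nat; congr (_ * _).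
apply: eq_bigr => j _; rewrite NegzE -exprnN -exprVn -circle_conj ?nc_cis//.
by rewrite -rmorphXn.
Qed.

Lemma circle_avg1 m : circle_avg m (fun=> 1) = 1 :> R[i].
Proof.
by rewrite /circle_avg sumr_const card_ord mulVf// pow2_neq0.
Qed.

(* Fejer's kernel is [|\sum_(j < N) (z / z0) ^ j| ^ 2 / N]. *)
Lemma fejer_estimate f z0 (e H n : R) (N : nat) :
  nc z0 = 1 -> circle_cont f -> (0 < N)%N -> 0 < n -> 0 <= e ->
  (forall z, nc z = 1 -> nc (f z) <= H) ->
  (forall z, nc z = 1 -> nc (z - z0) < n -> nc (f z - f z0) <= e) ->
  nc (N%:R^-1 * \sum_(j < N) \sum_(k < N)
        z0 ^ (k%:Z - j%:Z) * circle_mean (fun z => z ^ (j%:Z - k%:Z) * f z) - f z0)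
    <= e + 8 * H / (N%:R * n ^+ 2).
Proof.
move=> z01 hf N0 n0 e0 hH hn.
have z00 : z0 != 0 by apply/eqP => h; move: z01; rewrite h nc0; lra.
have Nr : (0 : R) < N%:R by rewrite ltr0n.
have H0 : 0 <= H by apply: le_trans (hH 1 (nc1 R)); exact: nc_ge0.
pose S z : R[i] := \sum_(j < N) (z / z0) ^+ j.
pose K z : R := nc (S z) ^+ 2 / N%:R.
have KE z : nc z = 1 -> (K z)%:C%C = N%:R^-1 * \sum_(j < N) \sum_(k < N)
    z0 ^ (k%:Z - j%:Z) * z ^ (j%:Z - k%:Z).
  move=> z1; rewrite /K rmorphM /= -mulc_conj mulrC fmorphV rmorph_nat; congr (_ * _).
  rewrite /S rmorph_sum mulr_suml; apply: eq_bigr => j _.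
  rewrite mulr_sumr; apply: eq_bigr => k _.
  have zz : nc (z / z0) = 1 by rewrite ncM ncV z1 z01 divr1.
  have z00' : z != 0 by apply/eqP => h; move: z1; rewrite h nc0; lra.
  rewrite rmorphXn /= circle_conj// !expfzDr// -!exprnP -!exprnN.
  by rewrite invfM invrK !exprMn !exprVn; ring.
have K0 z : 0 <= K z by rewrite /K divr_ge0 ?exprn_ge0 ?nc_ge0.
(* The frequencies of the kernel are below [N], so the average is exact, not only in the limit. *)
have avgK m : (N <= 2 ^ m)%N -> circle_avg m (fun z => (K z)%:C%C) = 1.
  move=> Nm; rewrite (eq_circle_avg _ KE) circle_avgZ circle_avg_sum.
  rewrite (eq_bigr (fun=> 1)); first by rewrite sumr_const card_ord mulVf// pnatr_eq0 -lt0n.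
  move=> j _; rewrite circle_avg_sum (bigD1 j)//= big1.
    rewrite addr0 -[RHS](circle_avg1 m); apply: eq_circle_avg => z _.
    by rewrite subrr !expr0z mulr1.
  move=> k kj; rewrite circle_avgZ circle_avg_expz ?mulr0//.
    by rewrite subr_eq0 eqz_nat eq_sym.
  have := ltn_ord j; have := ltn_ord k; lia.
(* The geometric sum satisfies |z / z0 - 1| |S z| <= 2. *)
have Kfar z : nc z = 1 -> n <= nc (z - z0) -> K z <= 4 / (N%:R * n ^+ 2).
  move=> z1 hz; have nw : n <= nc (z / z0 - 1).
    have -> : z / z0 - 1 = (z - z0) / z0 by field.
    by rewrite ncM ncV z01 divr1.
  have : nc (z / z0 - 1) * nc (S z) <= 2.
    rewrite -ncM -subrX1; apply: le_trans (ncD _ _) _.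
    by rewrite ncN nc1 ncX ncM ncV z1 z01 divr1 expr1n; lra.
  move=> hS; rewrite /K ler_pdivrMr// invfM mulrA mulrAC divfK ?gt_eqF//.
  rewrite ler_pdivlMr ?exprn_gt0// -exprMn.
  have -> : 4 = 2 ^+ 2 :> R by ring.
  rewrite ler_sqr ?nnegrE ?mulr_ge0 ?nc_ge0 ?(ltW n0)//.
  by apply: le_trans hS; rewrite mulrC ler_wpM2r// nc_ge0.
(* Near [z0] the kernel weights an error of at most [e]; far from it the bound 4 / (N n^2) meets |f
   z - f z0| <= 2 H, whence the constant 8. *)
have avg_le m : (N <= 2 ^ m)%N ->
    nc (circle_avg m (fun z => (K z)%:C%C * f z) - f z0) <=
    e + 8 * H / (N%:R * n ^+ 2).
  move=> Nm.
  have -> : circle_avg m (fun z => (K z)%:C%C * f z) - f z0 =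
      circle_avg m (fun z => (K z)%:C%C * (f z - f z0)).
    rewrite -{1}[f z0]mulr1 -(avgK _ Nm) -circle_avgZ circle_avgB.
    by congr circle_avg; apply/funext => z; ring.
  have : nc (circle_avg m (fun z => (K z)%:C%C * (f z - f z0))) <=
      complex.Re (circle_avg m (fun z => (K z)%:C%C * e%:C%C +
        (8 * H / (N%:R * n ^+ 2))%:C%C)).
    rewrite /circle_avg -(rmorph_nat (real_complex R)) -fmorphV /=.
    have -> : \sum_(j < 2 ^ m) ((K (cis (j%:R / (2 ^ m)%:R)))%:C%C * e%:C%C +
        (8 * H / (N%:R * n ^+ 2))%:C%C) = (\sum_(j < 2 ^ m)
        (K (cis (j%:R / (2 ^ m)%:R)) * e + 8 * H / (N%:R * n ^+ 2)))%:C%C.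
      rewrite rmorph_sum; apply: eq_bigr => j _.
      by rewrite [RHS]rmorphD [X in _ = X + _]rmorphM.
    rewrite -rmorphM ncM nc_real /= ger0_norm ?invr_ge0// ler_wpM2l ?invr_ge0//.
    apply: le_trans (nc_sum _ _ _) _; apply: ler_sum => j _.
    set z := cis _; have z1 : nc z = 1 by rewrite nc_cis.
    rewrite ncM nc_real ger0_norm//.
    have [near|far] := ltP (nc (z - z0)) n.
      have := ler_wpM2l (K0 z) (hn _ z1 near).
      suff : 0 <= 8 * H / (N%:R * n ^+ 2) by lra.
      by rewrite divr_ge0 ?mulr_ge0 ?exprn_ge0// ltW.
    have d2 : nc (f z - f z0) <= 2 * H.
      by apply: le_trans (ncD _ _) _; rewrite ncN; have := hH z z1; have := hH z0 z01; lra.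
    have := ler_pM (K0 z) (nc_ge0 _) (Kfar _ z1 far) d2.
    have -> : 4 / (N%:R * n ^+ 2) * (2 * H) = 8 * H / (N%:R * n ^+ 2) by field; lra.
    by have := mulr_ge0 (K0 z) e0; lra.
  have -> : circle_avg m (fun z => (K z)%:C%C * e%:C%C +
        (8 * H / (N%:R * n ^+ 2))%:C%C) = (e + 8 * H / (N%:R * n ^+ 2))%:C%C.
    have -> : (fun z => (K z)%:C%C * e%:C%C + (8 * H / (N%:R * n ^+ 2))%:C%C) =
       (fun z => e%:C%C * (K z)%:C%C - - (8 * H / (N%:R * n ^+ 2))%:C%C * 1).
      by apply/funext => z; ring.
    rewrite -circle_avgB !circle_avgZ avgK// circle_avg1 rmorphD /=.
    by ring.
  by [].
apply: (@clim_bound _ (fun m => circle_avg m (fun z => (K z)%:C%C * f z))).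
  rewrite (_ : (fun m => _) = fun m => N%:R^-1 * \sum_(j < N) \sum_(k < N)
     z0 ^ (k%:Z - j%:Z) * circle_avg m (fun z => z ^ (j%:Z - k%:Z) * f z)).
    apply: climZ; apply: clim_sum => j; apply: clim_sum => k; apply: climZ.
    by apply: circle_meanP; apply: circle_cont_expzM hH.
  apply/funext => m; pose G z := N%:R^-1 * \sum_(j < N) \sum_(k < N)
     (z0 ^ (k%:Z - j%:Z) * (z ^ (j%:Z - k%:Z) * f z)).
  rewrite (@eq_circle_avg _ _ G).
    rewrite circle_avgZ circle_avg_sum; congr (_ * _); apply: eq_bigr => j _.
    by rewrite circle_avg_sum; apply: eq_bigr => k _; rewrite circle_avgZ.
  move=> z z1; rewrite KE// /G -mulrA; congr (_ * _).
  rewrite mulr_suml; apply: eq_bigr => j _; rewrite mulr_suml.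
  by apply: eq_bigr => k _; rewrite mulrA.
exists N => m Nm; apply: avg_le; apply: leq_trans Nm _.
by rewrite ltnW// ltn_expl.
Qed.

End CircleMean.

(** * Polynomial approximation of holomorphic functions *)

Section Holomorphic.
Variable R : realType.
Implicit Types (e d r : R) (z w c : R[i]) (f g : R[i] -> R[i]).

Definition hol f z := derivable (f : R[i]^o -> R[i]^o) z 1.

Lemma hol_cdiff f z : hol f z -> cdiff f z.
Proof.
move=> fd; exists (derive (f : R[i]^o -> R[i]^o) z 1) => e e0.
have e0' : 0 < e%:C%C by rewrite ltcr.
move: (fd); rewrite /hol /derivable => /cvgrPdist_le/(_ _ e0')[d /= d0 hd].
have dE : d = (complex.Re d)%:C%C by rewrite RRe_real// ger0_real// ltW.
exists (complex.Re d); first by rewrite -ltcr -dE.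
move=> w wz; have [->|ne] := eqVneq w z.
  by rewrite !subrr mulr0 subrr nc0 mulr0.
have wz0 : w - z != 0 by rewrite subr_eq0.
have := hd (w - z); rewrite /ball_ /= sub0r normrN => /(_ _ wz0).
rewrite ncE dE ltcr => /(_ wz).
rewrite -[(w - z) *: 1]/((w - z) * 1) mulr1 /shift /= subrK.
rewrite -[_ *: _]/((w - z)^-1 * (f w - f z)) => h.
have {}h : nc (derive (f : R[i]^o -> R[i]^o) z 1 - (w - z)^-1 * (f w - f z)) <= e.
  by rewrite -lecr -ncE.
set D := derive _ _ _ in h *.
have -> : f w - f z - D * (w - z) = - ((D - (w - z)^-1 * (f w - f z)) * (w - z)).
  by field.
by rewrite ncN ncM ler_wpM2r// nc_ge0.
Qed.

Lemma eq_hol f g z : f =1 g -> hol f z -> hol g z.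
Proof. by move=> /funext ->. Qed.

Lemma hol_expz (n : int) z : z != 0 -> hol (fun w => w ^ n) z.
Proof.
move=> z0; have pos k : hol (fun w => w ^+ k) z.
  by apply: exprn_derivable.
case: n => k; first exact: pos.
apply: (@eq_hol (fun w => (w ^+ k.+1)^-1)).
  by move=> w; rewrite NegzE -exprnN.
by apply: derivableV; [rewrite expf_neq0|exact: pos].
Qed.

Arguments eq_hol [f g z] _ _.
Arguments hol_expz n z _ : clear implicits.

Lemma holM f g z : hol f z -> hol g z -> hol (fun w => f w * g w) z.
Proof. exact: derivableM. Qed.

Arguments holM [f g] z _ _.

Lemma hol_cst c z : hol (fun=> c) z.
Proof. by refine (derivable_cst _ _ _). Qed.
Arguments hol_cst c z : clear implicits.

Lemma holZ f c z : hol f z -> hol (fun w => c * f w) z.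
Proof. exact: holM (hol_cst c z). Qed.
Arguments holZ [f] c z _.

Lemma hol_sum m (F : 'I_m -> R[i] -> R[i]) z :
  (forall i, hol (F i) z) -> hol (fun w => \sum_(i < m) F i w) z.
Proof.
move=> h; rewrite /hol (_ : (fun w => _) = \sum_(i < m) (F i : R[i]^o -> R[i]^o)).
  exact: derivable_sum.
by apply/funext => w; rewrite fct_sumE.
Qed.

(** The n-th Laurent coefficient does not depend on the radius: Cauchy's theorem for z |-> z^(-n) f
    z. *)
Lemma cauchy_coef f (r1 r2 B : R) (n : int) : 0 < r1 -> r1 <= r2 ->
  (forall z, r1 <= nc z <= r2 -> hol f z) ->
  circle_cont (fun z => f (r1%:C%C * z)) -> circle_cont (fun z => f (r2%:C%C * z)) ->
  (forall z, nc z = 1 -> nc (f (r1%:C%C * z)) <= B) ->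
  (forall z, nc z = 1 -> nc (f (r2%:C%C * z)) <= B) ->
  r1%:C%C ^ (- n) * circle_mean (fun z => z ^ (- n) * f (r1%:C%C * z)) =
  r2%:C%C ^ (- n) * circle_mean (fun z => z ^ (- n) * f (r2%:C%C * z)).
Proof.
move=> r10 r12 hf c1 c2 b1 b2; have r20 : 0 < r2 by lra.
have := @cauchy_circles R (fun z => z ^ (- n) * f z) r1 r2 r10 r12.
have hz z : r1 <= nc z <= r2 -> cdiff (fun z => z ^ (- n) * f z) z.
  move=> hr; apply: hol_cdiff; apply: holM; last exact: hf.
  apply: hol_expz; apply/eqP => z0; move: hr; rewrite z0 nc0; lra.
move=> /(_ hz) lim0.
have k1 := circle_cont_expzM (- n) c1 b1.
have k2 := circle_cont_expzM (- n) c2 b2.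
have E (r : R) m : circle_avg m (fun z => (r%:C%C * z) ^ (- n) * f (r%:C%C * z)) =
    r%:C%C ^ (- n) * circle_avg m (fun z => z ^ (- n) * f (r%:C%C * z)).
  rewrite -circle_avgZ; congr circle_avg; apply/funext => z.
  by rewrite expfzMl mulrA.
have := climD (climZ (r2%:C%C ^ (- n)) (circle_meanP k2))
  (climZ (- r1%:C%C ^ (- n)) (circle_meanP k1)).
rewrite (_ : (fun m => _) = (fun m =>
  circle_avg m (fun z => (r2%:C%C * z) ^ (- n) * f (r2%:C%C * z)) -
  circle_avg m (fun z => (r1%:C%C * z) ^ (- n) * f (r1%:C%C * z)))); last first.
  by apply/funext => m; rewrite !E mulNr.
move=> /clim_unique/(_ lim0)/eqP; rewrite mulNr subr_eq0 => /eqP.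
by move/esym.
Qed.

Lemma climM (u v : nat -> R[i]) a b : clim u a -> clim v b ->
  clim (fun n => u n * v n) (a * b).
Proof.
move=> hu hv e e0.
have k0 : 0 < nc a + nc b + 1 by have := nc_ge0 a; have := nc_ge0 b; lra.
pose d := Num.min 1 (e / (nc a + nc b + 1)).
have d0 : 0 < d by rewrite lt_min ltr01 divr_gt0.
have [n1 h1] := hu _ d0; have [n2 h2] := hv _ d0.
exists (maxn n1 n2) => n; rewrite geq_max => /andP[/h1 {}h1 /h2 {}h2].
have -> : u n * v n - a * b = (u n - a) * (v n - b) + (a * (v n - b) + (u n - a) * b).
  by ring.
apply: le_lt_trans (ncD _ _) _.
have := ncD (a * (v n - b)) ((u n - a) * b); rewrite !ncM => h3.
have d1 : d <= 1 by rewrite ge_min lexx.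
have d2 : d * (nc a + nc b + 1) <= e.
  by rewrite -ler_pdivlMr// ge_min lexx orbT.
have g1 : nc (u n - a) * nc (v n - b) <= d * nc (v n - b).
  by rewrite ler_wpM2r ?nc_ge0// ltW.
have g2 : d * nc (v n - b) < d by rewrite gtr_pMr//; lra.
have g3 : nc a * nc (v n - b) <= nc a * d by rewrite ler_wpM2l ?nc_ge0// ltW.
have g4 : nc (u n - a) * nc b <= d * nc b by rewrite ler_wpM2r ?nc_ge0// ltW.
lra.
Qed.

Lemma clim_horner (p : {poly R[i]}) u a : clim u a -> clim (fun n => p.[u n]) p.[a].
Proof.
move=> hu; elim/poly_ind: p => [|p c ih].
  by rewrite horner0; under eq_fun do rewrite horner0; exact: clim_cst.
rewrite !hornerE; under eq_fun do rewrite !hornerE.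
by apply: climD; [exact: climM|exact: clim_cst].
Qed.

Lemma clim_inv_nat : clim (fun m => (m.+1%:R : R[i])^-1) 0.
Proof.
move=> e e0; exists (Num.truncn e^-1) => n hn; rewrite subr0 ncV nc_nat.
rewrite -[ltRHS]invrK ltf_pV2 ?posrE ?invr_gt0 ?ltr0n//.
by apply: lt_le_trans (truncnS_gt _) _; rewrite ler_nat.
Qed.

End Holomorphic.

(** Polynomials of finite type. As an inductive class they allow boundedness, weak uniform
    continuity and differentiability to be proved by induction, without multilinear maps. *)
Inductive fpoly (R : realType) (V : normedModType R[i]) (W : lmodType R[i]) :
    (V -> W) -> Prop :=
| fpoly_cst w : fpoly (fun=> w)
| fpoly_add P Q : fpoly P -> fpoly Q -> fpoly (fun x => P x + Q x)
| fpoly_scale phi P : dual V phi -> fpoly P -> fpoly (fun x => (phi x : R[i]) *: P x).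

Section FpolyTheory.
Variables (R : realType) (V : normedModType R[i]) (W : lmodType R[i]).
Implicit Types (P Q : V -> W).

Lemma fpoly_cscale (c : R[i]) P : fpoly P -> fpoly (fun x => c *: P x).
Proof.
elim => [w|P1 Q1 _ h1 _ h2|phi P1 hphi _ h].
- exact: fpoly_cst.
- by under eq_fun do rewrite scalerDr; exact: fpoly_add.
- by under eq_fun do rewrite scalerA mulrC -scalerA; exact: fpoly_scale.
Qed.

Lemma fpoly_sum (I : Type) (s : seq I) (b : pred I) (F : I -> V -> W) :
  (forall i, fpoly (F i)) -> fpoly (fun x => \sum_(i <- s | b i) F i x).
Proof.
move=> h; elim: s => [|i s ih].
  by under eq_fun do rewrite big_nil; exact: fpoly_cst.
under eq_fun do rewrite big_cons.
by case: (b i) => //; apply: fpoly_add.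
Qed.

Lemma fpoly_horner (p : {poly R[i]}) phi P : dual V phi -> fpoly P ->
  fpoly (fun x => p.[phi x] *: P x).
Proof.
move=> hphi hP; elim/poly_ind: p => [|p c ih].
  by under eq_fun do rewrite horner0 scale0r; exact: fpoly_cst.
under eq_fun do rewrite !hornerE scalerDl mulrC -scalerA.
by apply: fpoly_add; [exact: fpoly_scale|exact: fpoly_cscale].
Qed.

End FpolyTheory.

(** * Homogeneous components and Fejer means of a holomorphic function *)

Section Approximation.
Variables (R : realType) (V : normedModType R[i]) (h : V -> R[i]) (H : R).
Implicit Types (e d r s t : R) (z w c : R[i]) (x y : V).
Hypothesis hB : forall x, rnorm x <= 1 -> nc (h x) <= H.
Hypothesis hU : forall e, 0 < e -> exists2 d : R, 0 < d &
  forall x y, rnorm x <= 1 -> rnorm y <= 1 -> rnorm (x - y) < d -> nc (h x - h y) <= e.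
(** Holomorphy on lines is asked up to the sphere; it will hold for a dilation x |-> f (s x) with s
    < 1. *)
Hypothesis hD : forall x y z, rnorm (x + z *: y) <= 1 ->
  hol (fun w => h (x + w *: y)) z.

Let H0 : 0 <= H.
Proof. by apply: le_trans (hB (x := 0) _); rewrite ?nc_ge0// rnorm0. Qed.

Let rnormZ1 z x : nc z = 1 -> rnorm (z *: x) = rnorm x.
Proof. by move=> z1; rewrite rnormZ z1 mul1r. Qed.

Lemma twisted_cont (n : int) e : 0 < e -> exists2 d : R, 0 < d & forall x z w,
  rnorm x <= 1 -> nc z = 1 -> nc w = 1 -> nc (z - w) < d ->
  nc (z ^ n * h (z *: x) - w ^ n * h (w *: x)) <= e.
Proof.
move=> e0; have hH := H0; have e20 : 0 < e / 2 by lra.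
have e1 : 0 < e / (2 * (H + 1)) by rewrite divr_gt0//; lra.
have [d1 d10 h1] := hU e20; have [d2 d20 h2] := circle_cont_expz n e1.
exists (Num.min d1 d2); first by rewrite lt_min d10.
move=> x z w x1 z1 w1; rewrite lt_min => /andP[zw1 zw2].
have -> : z ^ n * h (z *: x) - w ^ n * h (w *: x) =
  z ^ n * (h (z *: x) - h (w *: x)) + (z ^ n - w ^ n) * h (w *: x) by ring.
apply: le_trans (ncD _ _) _; rewrite !ncM nc_expz// mul1r.
have g1 : nc (h (z *: x) - h (w *: x)) <= e / 2.
  apply: h1; rewrite ?rnormZ1// -scalerBl rnormZ.
  by apply: le_lt_trans zw1; rewrite ler_piMr ?nc_ge0.
have g2 := ler_pM (nc_ge0 _) (nc_ge0 _) (h2 _ _ z1 w1 zw2)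
  (hB (x := w *: x) (eq_ind_r (fun r => r <= 1) x1 (rnormZ1 x w1))).
have : e / (2 * (H + 1)) * H <= e / 2.
  have -> : e / (2 * (H + 1)) * H = e / 2 * (H / (H + 1)) by field; lra.
  by apply: ler_piMr; [exact: ltW|rewrite ler_pdivrMr; lra].
lra.
Qed.

Lemma orbit_cont x : rnorm x <= 1 -> circle_cont (fun z => h (z *: x)).
Proof.
move=> x1 e /(twisted_cont 0)[d d0 hd]; exists d => // z w z1 w1 zw.
by have := hd _ _ _ x1 z1 w1 zw; rewrite !expr0z !mul1r.
Qed.

Lemma orbit_le x z : rnorm x <= 1 -> nc z = 1 -> nc (h (z *: x)) <= H.
Proof. by move=> x1 z1; apply: hB; rewrite rnormZ1. Qed.

(** The n-th Fourier coefficient of [h] on the circle through [x]; for [n >= 0] this is the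
    n-homogeneous Taylor component. *)
Definition coef (n : int) x := circle_mean (fun z => z ^ (- n) * h (z *: x)).

Lemma coef_cont n x : rnorm x <= 1 -> circle_cont (fun z => z ^ n * h (z *: x)).
Proof.
move=> x1; apply: (@circle_cont_expzM _ _ _ H); first exact: orbit_cont.
by move=> z; exact: orbit_le.
Qed.

Lemma coef_le n x : rnorm x <= 1 -> nc (coef n x) <= H.
Proof.
move=> x1; apply: circle_mean_le; first exact: coef_cont.
by move=> z z1; rewrite ncM nc_expz// mul1r orbit_le.
Qed.

Lemma coef_unif n e : 0 < e -> exists2 d : R, 0 < d & forall x y,
  rnorm x <= 1 -> rnorm y <= 1 -> rnorm (x - y) < d -> nc (coef n x - coef n y) <= e.
Proof.
move=> /hU[d d0 hd]; exists d => // x y x1 y1 xy.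
apply: circle_mean_close; [exact: coef_cont..|move=> z z1].
rewrite -mulrBr ncM nc_expz// mul1r; apply: hd; rewrite ?rnormZ1//.
by rewrite -scalerBr rnormZ1.
Qed.

Lemma rnorm_rscale r x : 0 <= r -> rnorm (r%:C%C *: x) = r * rnorm x.
Proof. by move=> r0; rewrite rnormZ nc_real ger0_norm. Qed.

(** Independence of the radius for z |-> h (z x), on the circles of radius [r] and 1. *)
Lemma coef_homogeneous n x r : 0 < r <= 1 -> rnorm x <= 1 ->
  coef n (r%:C%C *: x) = r%:C%C ^ n * coef n x.
Proof.
move=> /andP[r0 r1] x1.
have rx : rnorm (r%:C%C *: x) <= 1.
  by rewrite rnorm_rscale ?(ltW r0)//; apply: mulr_ile1; rewrite ?rnorm_ge0 ?(ltW r0).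
have E (s : R) z : h ((s%:C%C * z) *: x) = h (z *: (s%:C%C *: x)).
  by rewrite scalerA mulrC.
have x1' : rnorm ((1 : R)%:C%C *: x) <= 1 by rewrite scale1r.
have := @cauchy_coef R (fun z => h (z *: x)) r 1 H n r0 r1.
have hh z : r <= nc z <= 1 -> hol (fun z => h (z *: x)) z.
  move=> /andP[_ z1]; apply: (@eq_hol _ (fun z => h (0 + z *: x))).
    by move=> w; rewrite add0r.
  by apply: hD; rewrite add0r rnormZ mulr_ile1 ?nc_ge0 ?rnorm_ge0.
have Ef s : (fun z => h ((s%:C%C * z) *: x)) = (fun z => h (z *: (s%:C%C *: x))).
  by apply/funext => z; exact: E.
rewrite /= !Ef => /(_ hh (orbit_cont rx) (orbit_cont x1')).
have b1 z : nc z = 1 -> nc (h ((r%:C%C * z) *: x)) <= H.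
  by move=> z1; rewrite E orbit_le.
have b2 z : nc z = 1 -> nc (h (((1 : R)%:C%C * z) *: x)) <= H.
  by move=> z1; rewrite E orbit_le.
move=> /(_ b1 b2).
have Em (s : R) : circle_mean (fun z => z ^ (- n) * h ((s%:C%C * z) *: x)) =
    coef n (s%:C%C *: x).
  by apply: eq_circle_mean => z _; rewrite E.
rewrite !Em scale1r.
rewrite (_ : (1 : R)%:C%C = 1)// exp1rz mul1r => <-.
by rewrite mulrA -expfzDr ?subrr ?expr0z ?mul1r// (inj_eq (@realc_inj R)) gt_eqF.
Qed.

(** By homogeneity |coef n x| = r^(-n) |coef n (r x)| <= r^(-n) H, which tends to 0 with [r]. *)
Lemma coef_neg n x : n < 0 -> rnorm x <= 1 -> coef n x = 0.
Proof.
have hH := H0; case: n => // k _ x1; apply: nc0_eq0; apply/eqP; rewrite eq_le nc_ge0 andbT.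
apply/ler_addgt0Pr => e e0; rewrite add0r.
pose r := Num.min 1 (e / (H + 1)).
have r0 : 0 < r by rewrite lt_min ltr01 divr_gt0//; lra.
have r1 : r <= 1 by rewrite ge_min lexx.
have rx : rnorm (r%:C%C *: x) <= 1.
  by rewrite rnorm_rscale ?(ltW r0)//; apply: mulr_ile1; rewrite ?rnorm_ge0 ?(ltW r0).
have := @coef_homogeneous (Negz k) x r; rewrite r0 r1 => /(_ isT x1) hc.
have := coef_le (Negz k) rx; rewrite hc ncM NegzE -exprnN ncV ncX nc_real.
rewrite ger0_norm ?(ltW r0)// ler_pdivrMl ?exprn_gt0// => /le_trans; apply.
have : r ^+ k.+1 <= r by rewrite exprS ler_piMr ?exprn_ile1// ltW.
have : r * (H + 1) <= e by rewrite -ler_pdivlMr; [rewrite ge_min lexx orbT|lra].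
by have := H0; nra.
Qed.

(* The [k]-homogeneous extension of [coef k] from the unit ball to the space. *)
Definition homog (k : nat) x : R[i] :=
  ((1 + rnorm x)^-1)%:C%C ^- k * coef k (((1 + rnorm x)^-1)%:C%C *: x).

Lemma homogE k x t : 0 < t -> t * rnorm x <= 1 ->
  homog k x = t%:C%C ^- k * coef k (t%:C%C *: x).
Proof.
have aux s1 s2 : 0 < s1 -> s1 <= s2 -> s2 * rnorm x <= 1 ->
    s1%:C%C ^- k * coef k (s1%:C%C *: x) = s2%:C%C ^- k * coef k (s2%:C%C *: x).
  move=> s10 s12 hs; have s20 : 0 < s2 by lra.
  have -> : s1%:C%C *: x = (s1 / s2)%:C%C *: (s2%:C%C *: x).
    by rewrite scalerA -rmorphM /= divfK// gt_eqF.
  rewrite coef_homogeneous; last 2 first.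
  - by rewrite divr_gt0//= ler_pdivrMr// mul1r.
  - by rewrite rnorm_rscale// ltW.
  rewrite -exprnP mulrA; congr (_ * _); rewrite rmorphM fmorphV /= exprMn exprVn.
  by rewrite mulKf// expf_neq0// (inj_eq (@realc_inj R)) gt_eqF.
move=> t0 tx; rewrite /homog; set s := (1 + rnorm x)^-1.
have x0 := rnorm_ge0 x.
have s0 : 0 < s by rewrite invr_gt0; lra.
have sx : s * rnorm x <= 1 by rewrite /s mulrC ler_pdivrMr; lra.
have [st|/ltW ts] := leP s t; first exact: aux.
by apply/esym/aux.
Qed.

Lemma homog_ball k x : rnorm x <= 1 -> homog k x = coef k x.
Proof.
move=> x1; rewrite (@homogE k x 1) ?ltr01 ?mul1r//.
by rewrite scale1r expr1n invr1 mul1r.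
Qed.

Lemma homog_le k x B : 1 + rnorm x <= B -> nc (homog k x) <= B ^+ k * H.
Proof.
move=> xB; have x0 := rnorm_ge0 x; have B0 : 0 < B by lra.
have hx : B^-1 * rnorm x <= 1 by rewrite mulrC ler_pdivrMr//; lra.
rewrite (@homogE k x B^-1) ?invr_gt0//.
rewrite ncM ncV ncX nc_real ger0_norm ?invr_ge0 ?(ltW B0)// exprVn invrK.
rewrite ler_wpM2l ?exprn_ge0 ?(ltW B0)// coef_le//.
by rewrite rnorm_rscale// invr_ge0 ltW.
Qed.

(** * Homogeneous components on a complex line *)

Section Line.
Variables (k : nat) (x y : V).
Let q z := homog k (x + z *: y).
Let K := (1 + rnorm x + rnorm y) ^+ k * H.

Let K0 : 0 <= K.
Proof.
by rewrite mulr_ge0 ?exprn_ge0 ?H0//; have := rnorm_ge0 x; have := rnorm_ge0 y; lra.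
Qed.

Let rnorm_line z r : nc z <= r -> rnorm (x + z *: y) <= rnorm x + r * rnorm y.
Proof.
move=> zr; apply: le_trans (rnormD _ _) _.
by rewrite lerD2l rnormZ ler_wpM2r ?rnorm_ge0.
Qed.

(** This factor brings the whole disc [nc z <= r] of the line into the unit ball, so that one
    formula for [q] is valid on it. *)
Let scale r := (1 + rnorm x + r * rnorm y)^-1.

Let scale_gt0 r : 0 <= r -> 0 < scale r.
Proof.
move=> r0; rewrite invr_gt0; have := rnorm_ge0 x.
by have := mulr_ge0 r0 (rnorm_ge0 y); lra.
Qed.

Let scale_line r z : 0 <= r -> nc z <= r ->
  rnorm ((scale r)%:C%C *: (x + z *: y)) <= 1.
Proof.
move=> r0 /rnorm_line hz; have s0 := scale_gt0 r0.
rewrite rnorm_rscale ?(ltW s0)// mulrC ler_pdivrMr; last by rewrite -invr_gt0.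
lra.
Qed.

Let qE r z : 0 <= r -> nc z <= r ->
  q z = (scale r)%:C%C ^- k * coef k ((scale r)%:C%C *: (x + z *: y)).
Proof.
move=> r0 zr; have s0 := scale_gt0 r0; apply: homogE => //.
by rewrite -rnorm_rscale ?(ltW s0)// scale_line.
Qed.

Let q_le r z : 0 <= r -> nc z <= r -> nc (q z) <= (1 + rnorm x + r * rnorm y) ^+ k * H.
Proof. by move=> r0 zr; apply: homog_le; have := rnorm_line zr; lra. Qed.

Let q_cont r e : 0 <= r -> 0 < e -> exists2 d : R, 0 < d & forall z w,
  nc z <= r -> nc w <= r -> nc (z - w) < d -> nc (q z - q w) <= e.
Proof.
move=> r0 e0; have s0 := scale_gt0 r0.
have sk0 : 0 < scale r ^+ k by rewrite exprn_gt0.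
have [d d0 hd] := coef_unif k (mulr_gt0 e0 sk0).
have b0 : 0 < rnorm y + 1 by have := rnorm_ge0 y; lra.
exists (d / (scale r * (rnorm y + 1))); first by rewrite divr_gt0// mulr_gt0.
move=> z w zr wr; rewrite ltr_pdivlMr ?mulr_gt0// => zw.
rewrite (qE r0 zr) (qE r0 wr) -mulrBr ncM ncV ncX nc_real ger0_norm ?(ltW s0)//.
rewrite ler_pdivrMl// mulrC; apply: hd; rewrite ?scale_line//.
rewrite -scalerBr rnorm_rscale ?(ltW s0)// opprD addrACA subrr add0r -scalerBl rnormZ.
apply: le_lt_trans zw.
rewrite mulrCA ler_wpM2l ?nc_ge0//; rewrite ler_pM2l//; lra.
Qed.

Let q_circle r : 0 <= r -> circle_cont (fun z => q (r%:C%C * z)).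
Proof.
move=> r0 e e0; have [d d0 hd] := q_cont r0 e0.
have r1 : 0 < r + 1 by lra.
exists (d / (r + 1)); first exact: divr_gt0.
move=> z w z1 w1; rewrite ltr_pdivlMr// => zw.
apply: hd; rewrite ?ncM ?z1 ?w1 ?mulr1 ?nc_real ?ger0_norm//.
rewrite -mulrBr ncM nc_real ger0_norm//; apply: le_lt_trans zw.
by rewrite mulrC ler_wpM2l ?nc_ge0//; lra.
Qed.

Let nc_rc r z : 0 <= r -> nc z = 1 -> nc (r%:C%C * z) = r.
Proof. by move=> r0 z1; rewrite ncM z1 mulr1 nc_real ger0_norm. Qed.

Let q_circle_le r z : 0 <= r -> nc z = 1 ->
  nc (q (r%:C%C * z)) <= (1 + rnorm x + r * rnorm y) ^+ k * H.
Proof. by move=> r0 z1; apply: q_le => //; rewrite nc_rc. Qed.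

(* Riemann sums of the integral defining [q], holomorphic on a given disc. *)
Let q_approx r e : 0 <= r -> 0 < e -> exists Q : R[i] -> R[i],
  [/\ forall z, nc z <= r -> hol Q z,
      forall z, nc z <= r -> nc (Q z - q z) <= e,
      (forall e, 0 < e -> exists2 d : R, 0 < d & forall z w,
        nc z <= r -> nc w <= r -> nc (z - w) < d -> nc (Q z - Q w) <= e) &
      forall z, nc z <= r -> nc (Q z) <= (1 + rnorm x + r * rnorm y) ^+ k * H + e].
Proof.
move=> r0 e0; have s0 := scale_gt0 r0.
have sk0 : 0 < scale r ^+ k by rewrite exprn_gt0.
have [d d0 hd] := twisted_cont (- k%:Z) (mulr_gt0 e0 sk0).
have [m0 hm] := circle_mean_mesh d0.
pose G z w := w ^ (- k%:Z) * h (w *: ((scale r)%:C%C *: (x + z *: y))).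
pose Q z := (scale r)%:C%C ^- k * circle_avg m0 (G z).
have Qq z : nc z <= r -> nc (Q z - q z) <= e.
  move=> zr; rewrite (qE r0 zr) -mulrBr ncM ncV ncX nc_real ger0_norm ?(ltW s0)//.
  rewrite ler_pdivrMl// mulrC; apply: hm => //.
    by apply: coef_cont; exact: scale_line.
  by move=> w v; apply: hd; exact: scale_line.
exists Q; split => //.
- move=> z zr; apply: holZ; rewrite /circle_avg; apply: holZ; apply: hol_sum => j.
  apply: holZ; set v := cis _.
  apply: (@eq_hol _ (fun z => h ((v * (scale r)%:C%C) *: x +
     z *: ((v * (scale r)%:C%C) *: y)))).
    move=> w; congr h; rewrite !scalerDr !scalerA; congr (_ + _ *: _).
    by ring.
  apply: hD.
  have -> : (v * (scale r)%:C%C) *: x + z *: ((v * (scale r)%:C%C) *: y) =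
      v *: ((scale r)%:C%C *: (x + z *: y)).
    by rewrite !scalerDr !scalerA; congr (_ + _ *: _); ring.
  by rewrite rnormZ1 ?nc_cis// scale_line.
- move=> e' e'0; have [d' d'0 hd'] := hU (mulr_gt0 e'0 sk0).
  have b0 : 0 < rnorm y + 1 by have := rnorm_ge0 y; lra.
  exists (d' / (scale r * (rnorm y + 1))); first by rewrite divr_gt0// mulr_gt0.
  move=> z w zr wr; rewrite ltr_pdivlMr ?mulr_gt0// => zw.
  rewrite /Q -mulrBr ncM ncV ncX nc_real ger0_norm ?(ltW s0)//.
  rewrite ler_pdivrMl// mulrC circle_avgB; apply: circle_avg_le => v v1.
  rewrite /G -mulrBr ncM nc_expz// mul1r; apply: hd'; rewrite ?(rnormZ1 _ v1) ?scale_line//.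
  rewrite -scalerBr (rnormZ1 _ v1) -scalerBr rnorm_rscale ?(ltW s0)//.
  rewrite opprD addrACA subrr add0r -scalerBl rnormZ; apply: le_lt_trans zw.
  by rewrite mulrCA ler_wpM2l ?nc_ge0//; rewrite ler_pM2l//; lra.
- move=> z zr; rewrite -[Q z](subrK (q z)); apply: le_trans (ncD _ _) _.
  by rewrite addrC lerD// ?q_le// Qq.
Qed.

(** Holomorphy is available for the Riemann sums [Q] rather than for [q]; Cauchy's theorem is
    applied to [Q], which is uniformly close to [q] on the larger disc, and the error then tends to
    0. *)
Let q_radial (n : int) (r1 r2 : R) : 0 < r1 -> r1 <= r2 ->
  r1%:C%C ^ (- n) * circle_mean (fun z => z ^ (- n) * q (r1%:C%C * z)) =
  r2%:C%C ^ (- n) * circle_mean (fun z => z ^ (- n) * q (r2%:C%C * z)).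
Proof.
move=> r10 r12; have r20 : 0 < r2 by lra.
have [A1 A1E] : exists A, A = r1%:C%C ^ (- n).
  exact: ex_intro _ _ erefl.
have [A2 A2E] : exists A, A = r2%:C%C ^ (- n).
  exact: ex_intro _ _ erefl.
rewrite -A1E -A2E.
apply/eqP; rewrite -subr_eq0; apply/eqP/nc0_eq0/eqP; rewrite eq_le nc_ge0 andbT.
apply/ler_addgt0Pr => e e0; rewrite add0r.
have a0 : 0 < nc A1 + nc A2 + 1 by have := nc_ge0 A1; have := nc_ge0 A2; lra.
have e1 : 0 < e / (nc A1 + nc A2 + 1) by rewrite divr_gt0.
have [Q [Qh Qq Qc Qb]] := q_approx (ltW r20) e1.
have circ (r : R) : 0 < r -> r <= r2 -> circle_cont (fun z => Q (r%:C%C * z)) /\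
   forall z, nc z = 1 -> nc (r%:C%C * z) <= r2.
  move=> r0 rr; split; last by move=> z z1; rewrite nc_rc// ltW.
  move=> e' e'0; have [d d0 hd] := Qc e' e'0.
  exists (d / r); first exact: divr_gt0.
  move=> z w z1 w1; rewrite ltr_pdivlMr// => zw.
  apply: hd; rewrite ?(nc_rc (ltW r0))//.
  by rewrite -mulrBr ncM nc_real gtr0_norm// mulrC.
have [c1 b1] := circ _ r10 r12; have [c2 b2] := circ _ r20 (lexx _).
have := @cauchy_coef R Q r1 r2 _ n r10 r12
  (fun z hz => Qh z (proj2 (andP hz))) c1 c2
  (fun z hz => Qb _ (b1 z hz)) (fun z hz => Qb _ (b2 z hz)).
rewrite -A1E -A2E => E.
have close (r : R) : 0 < r -> r <= r2 -> nc (
    circle_mean (fun z => z ^ (- n) * q (r%:C%C * z)) -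
    circle_mean (fun z => z ^ (- n) * Q (r%:C%C * z))) <= e / (nc A1 + nc A2 + 1).
  move=> r0 rr; have [c b] := circ _ r0 rr.
  apply: circle_mean_close.
  - apply: circle_cont_expzM (q_circle (ltW r0)) _ => z z1.
    by apply: q_circle_le => //; exact: ltW.
  - by apply: circle_cont_expzM c (fun z hz => Qb _ (b z hz)).
  - move=> z z1; rewrite -mulrBr ncM nc_expz// mul1r ncBC; apply: Qq.
    exact: b.
have l1 := close _ r10 r12; have l2 := close _ r20 (lexx _).
move: E l1 l2.
move: (circle_mean (fun z => z ^ (- n) * q (r1%:C%C * z))) => M1.
move: (circle_mean (fun z => z ^ (- n) * q (r2%:C%C * z))) => M2.
move: (circle_mean (fun z => z ^ (- n) * Q (r1%:C%C * z))) => N1.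
move: (circle_mean (fun z => z ^ (- n) * Q (r2%:C%C * z))) => N2.
move=> E l1 l2.
have -> : A1 * M1 - A2 * M2 = A1 * (M1 - N1) - A2 * (M2 - N2).
  by rewrite !mulrBr E; ring.
apply: le_trans (ncD _ _) _; rewrite ncN !ncM.
have g1 := ler_wpM2l (nc_ge0 A1) l1; have g2 := ler_wpM2l (nc_ge0 A2) l2.
have : (nc A1 + nc A2) * (e / (nc A1 + nc A2 + 1)) <= e.
  rewrite mulrA mulrAC; apply: ler_piMl; first exact: ltW.
  by rewrite ler_pdivrMr//; lra.
lra.
Qed.

Let C (n : int) := circle_mean (fun z => z ^ (- n) * q z).

Let q_coef (n : int) r : 0 < r ->
  circle_mean (fun z => z ^ (- n) * q (r%:C%C * z)) = r%:C%C ^ n * C n.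
Proof.
move=> r0; have rn0 : r%:C%C != 0 :> R[i] by rewrite (inj_eq (@realc_inj R)) gt_eqF.
have E1 : (fun z => z ^ (- n) * q z) = (fun z => z ^ (- n) * q ((1 : R)%:C%C * z)).
  by apply/funext => z; rewrite mul1r.
have E : r%:C%C ^ (- n) * circle_mean (fun z => z ^ (- n) * q (r%:C%C * z)) = C n.
  have [r1|/ltW r1] := leP r 1.
    by rewrite (q_radial n r0 r1) exp1rz mul1r -E1.
  by rewrite -(q_radial n ltr01 r1) exp1rz mul1r -E1.
by rewrite -E mulrA -expfzDr// subrr expr0z mul1r.
Qed.

Let C_le (n : int) r : 0 < r ->
  nc (r%:C%C ^ n * C n) <= (1 + rnorm x + r * rnorm y) ^+ k * H.
Proof.
move=> r0; rewrite -q_coef//.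
have qb z : nc z = 1 -> nc (q (r%:C%C * z)) <= (1 + rnorm x + r * rnorm y) ^+ k * H.
  by move=> z1; apply: q_circle_le => //; exact: ltW.
apply: circle_mean_le.
  by apply: circle_cont_expzM (q_circle (ltW r0)) qb.
by move=> z z1; rewrite ncM nc_expz// mul1r qb.
Qed.

Let C_neg (n : nat) : C (Negz n) = 0.
Proof.
apply: nc0_eq0; apply/eqP; rewrite eq_le nc_ge0 andbT.
apply/ler_addgt0Pr => e e0; rewrite add0r.
pose r := Num.min 1 (e / (K + 1)).
have r0 : 0 < r by rewrite lt_min ltr01 divr_gt0//; have := K0; lra.
have r1 : r <= 1 by rewrite ge_min lexx.
have := C_le (Negz n) r0; rewrite NegzE -exprnN ncM ncV ncX nc_real gtr0_norm//.
rewrite ler_pdivrMl ?exprn_gt0// => /le_trans; apply.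
have h1 : r ^+ n.+1 <= r by rewrite exprS ler_piMr ?exprn_ile1// ltW.
have h2 : r * (K + 1) <= e.
  by rewrite -ler_pdivlMr; [rewrite ge_min lexx orbT|have := K0; lra].
have x0 := rnorm_ge0 x; have y0 := rnorm_ge0 y.
have h3 : (1 + rnorm x + r * rnorm y) ^+ k * H <= K.
  rewrite ler_wpM2r ?H0// lerXn2r ?nnegrE//; [nra|lra|nra].
have h4 := ler_wpM2l (exprn_ge0 n.+1 (ltW r0)) h3.
have h5 := ler_wpM2r K0 h1; lra.
Qed.

(** Liouville's estimate: |C n| r^n is at most r^k K for [r >= 1], and [r] may be taken as large as
    K / e. *)
Let C_large (n : nat) : (k < n)%N -> C n = 0.
Proof.
move=> kn; apply: nc0_eq0; apply/eqP; rewrite eq_le nc_ge0 andbT.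
apply/ler_addgt0Pr => e e0; rewrite add0r.
pose r := Num.max 1 (K / e).
have r1 : 1 <= r by rewrite le_max lexx.
have r0 : 0 < r by lra.
have := C_le n r0; rewrite -exprnP ncM ncX nc_real gtr0_norm//.
rewrite -ler_pdivlMl ?exprn_gt0// => /le_trans; apply.
have x0 := rnorm_ge0 x; have y0 := rnorm_ge0 y.
have h3 : (1 + rnorm x + r * rnorm y) ^+ k * H <= r ^+ k * K.
  rewrite /K mulrA -exprMn ler_wpM2r ?H0// lerXn2r ?nnegrE//; nra.
have Kr : K <= e * r by rewrite mulrC -ler_pdivrMr// le_max lexx orbT.
rewrite ler_pdivrMl ?exprn_gt0//; apply: le_trans h3 _.
have h4 : r ^+ k * r <= r ^+ n by rewrite -exprSr; apply: ler_weXn2l.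
have h5 := ler_wpM2l (exprn_ge0 k (ltW r0)) Kr.
have h6 := ler_wpM2l (ltW e0) h4; lra.
Qed.

(** The Fejer sum of [q], reduced to the frequencies between 0 and [k], the only ones with a nonzero
    coefficient. *)
Let P (N : nat) : {poly R[i]} := N%:R^-1 *: \sum_(j < N) \sum_(l < N)
  (if (j <= l <= j + k)%N then C (l - j)%N *: 'X^(l - j) else 0).

Let size_P N : (size (P N) <= k.+1)%N.
Proof.
rewrite (leq_trans (size_scale_leq _ _))//.
apply: (leq_trans (size_sum _ _ _)); apply/bigmax_leqP => j _.
apply: (leq_trans (size_sum _ _ _)); apply/bigmax_leqP => l _.
case: ifP => [/andP[jl lk]|_]; last by rewrite size_poly0.
by rewrite (leq_trans (size_scale_leq _ _))// size_polyXn ltnS leq_subLR.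
Qed.

(** Fejer's estimate on the circle through [z]. The point 0 is excluded because it lies on no such
    circle. *)
Let P_lim z : z != 0 -> clim (fun N => (P N).[z]) (q z).
Proof.
move=> z0; pose r := nc z.
have r0 : 0 < r by apply: nc_gt0; exact/eqP.
have rn0 : r%:C%C != 0 :> R[i] by rewrite (inj_eq (@realc_inj R)) gt_eqF.
pose z1 := z / r%:C%C.
have nz1 : nc z1 = 1 by rewrite ncM ncV nc_real gtr0_norm// divff// gt_eqF.
have rz : r%:C%C * z1 = z by rewrite mulrC divfK.
pose f w := q (r%:C%C * w).
have fc : circle_cont f by apply: q_circle; exact: ltW.
pose B := (1 + rnorm x + r * rnorm y) ^+ k * H.
have fB w : nc w = 1 -> nc (f w) <= B by apply: q_circle_le; exact: ltW.
have B0 : 0 <= B by apply: le_trans (fB 1 (nc1 R)); exact: nc_ge0.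
move=> e e0; have e20 : 0 < e / 4 by lra.
have [d d0 hd] := fc _ e20.
exists (Num.truncn (8 * B / d ^+ 2 / (e / 4))).+1 => N hN.
have N0 : (0 < N)%N by apply: leq_trans hN.
have := @fejer_estimate R f z1 (e / 4) B d N nz1 fc N0 d0 (ltW e20) fB.
move=> /(_ (fun w hw => hd w z1 hw nz1)).
have -> : N%:R^-1 * (\sum_(j < N) \sum_(k0 < N) z1 ^ (k0%:Z - j%:Z) *
    circle_mean (fun z => z ^ (j%:Z - k0%:Z) * f z)) = (P N).[z].
  rewrite /P hornerZ; congr (_ * _); rewrite horner_sum; apply: eq_bigr => j _.
  rewrite horner_sum; apply: eq_bigr => l _.
  rewrite -[j%:Z - l%:Z]opprB q_coef// mulrA -expfzMl [z1 * _]mulrC rz.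
  case: (leqP j l) => [jl|lj] /=.
    rewrite subzn//; case: ifP => [_|/negbT]; first by rewrite hornerZ hornerXn mulrC.
    by rewrite -ltnNge => lk; rewrite horner0 C_large ?mulr0// ltn_subRL.
  rewrite horner0 (_ : l%:Z - j%:Z = Negz (j - l).-1) ?C_neg ?mulr0//.
  by rewrite NegzE prednK ?subn_gt0// -subzn ?opprB// ltnW.
have -> : f z1 = q z by rewrite /f rz.
move=> /le_lt_trans; apply.
have Nr : (0 : R) < N%:R by rewrite ltr0n.
have : 8 * B / (N%:R * d ^+ 2) < e / 4 + e / 4.
  have -> : 8 * B / (N%:R * d ^+ 2) = 8 * B / d ^+ 2 / N%:R.
    by rewrite invfM mulrA mulrAC.
  have : 8 * B / d ^+ 2 / (e / 4) < N%:R.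
    by apply: lt_le_trans (truncnS_gt _) _; rewrite ler_nat.
  rewrite ltr_pdivrMr// => tN; rewrite ltr_pdivrMr//.
  by have := mulr_gt0 Nr e20; lra.
lra.
Qed.

(** The polynomials [P N] have degree at most [k], so they satisfy the interpolation formula with
    nodes 1, ..., k + 1, which passes to the limit. The nodes avoid 0, where [P_lim] says
    nothing. *)
Lemma homog_line_neq0 z : z != 0 -> homog k (x + z *: y) =
  \sum_(i < k.+1) homog k (x + i.+1%:R *: y) *
     (tnth (lagrange k.+1 (fun n => n.+1%:R)) i : {poly R[i]}).[z].
Proof.
move=> z0; apply: (clim_unique (P_lim z0)).
have inj : injective (fun n => n.+1%:R : R[i]).
  by move=> a b /eqP; rewrite eqr_nat eqSS => /eqP.
have E N : (P N).[z] = \sum_(i < k.+1) (P N).[i.+1%:R] *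
     (tnth (lagrange k.+1 (fun n => n.+1%:R)) i : {poly R[i]}).[z].
  rewrite {1}(lagrange_gen (ltn0Sn k) inj (size_P N)) horner_sum.
  by apply: eq_bigr => i _; rewrite hornerM hornerC.
under eq_fun do rewrite E.
apply: clim_sum => i; apply: climM; last exact: clim_cst.
by apply: P_lim; rewrite pnatr_eq0.
Qed.

Lemma homog_line z : homog k (x + z *: y) =
  \sum_(i < k.+1) homog k (x + i.+1%:R *: y) *
     (tnth (lagrange k.+1 (fun n => n.+1%:R)) i : {poly R[i]}).[z].
Proof.
have [->|] := eqVneq z 0; last exact: homog_line_neq0.
(* The point 0 is approached along 1 / (m + 1), where the formula is already known. *)
have qc : clim (fun m => q (m.+1%:R)^-1) (q 0).
  move=> e e0; have e20 : 0 < e / 2 by lra.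
  have [d d0 hd] := q_cont ler01 e20.
  have [n hn] := clim_inv_nat d0.
  exists n => m nm; apply: (@le_lt_trans _ _ (e / 2)); last lra.
  apply: hd; rewrite ?nc0//; last exact: hn.
  by rewrite ncV nc_nat invf_le1 ?ltr0n// ler1n.
apply: (clim_unique qc).
rewrite /q; under eq_fun => m do
  rewrite homog_line_neq0 ?invr_eq0 ?pnatr_eq0//.
apply: clim_sum => i; apply: climM; first exact: clim_cst.
exact: clim_horner (@clim_inv_nat R).
Qed.

End Line.

Section Coordinates.
Variables (n : nat) (b : 'I_n -> V) (xi : 'I_n -> V -> R[i]^o).
Hypothesis xi_dual : forall i, dual V (xi i).
Hypothesis xiE : forall x, x = \sum_i (xi i x : R[i]) *: b i.

(** The formula of [homog_line] is applied to one coordinate at a time: its weights are polynomials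
    in that coordinate, and its values are taken at points which no longer involve it. *)
Lemma fpoly_homog k : fpoly (homog k : V -> R[i]^o).
Proof.
have step j x0 : (j <= n)%N ->
    fpoly (fun x => homog k (x0 + \sum_(i < n | (i < j)%N) (xi i x : R[i]) *: b i) : R[i]^o).
  elim: j x0 => [|j ih] x0 jn.
    under eq_fun => x do rewrite big_pred0//.
    exact: fpoly_cst.
  pose i0 := Ordinal jn.
  have E x : homog k (x0 + \sum_(i < n | (i < j.+1)%N) (xi i x : R[i]) *: b i) =
      \sum_(l < k.+1) 
     (tnth (lagrange k.+1 (fun n => n.+1%:R)) l : {poly R[i]}).[xi i0 x] *
     homog k ((x0 + l.+1%:R *: b i0) + \sum_(i < n | (i < j)%N) (xi i x : R[i]) *: b i).
    rewrite (bigD1 i0) ?ltnS//= addrCA addrA [_ + x0]addrC.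
    rewrite (eq_bigl (fun i : 'I_n => (i < j)%N)); last first.
      move=> i; rewrite ltnS [RHS]ltn_neqAle andbC; congr (_ && _).
    rewrite addrAC homog_line; apply: eq_bigr => l _.
    by rewrite mulrC addrAC.
  under eq_fun do rewrite E.
  apply: fpoly_sum => l.
  by apply: (@fpoly_horner R V R[i]^o); [exact: xi_dual|apply: ih; exact: ltnW].
have E x : homog k x =
    homog k (0 + \sum_(i < n | (i < n)%N) (xi i x : R[i]) *: b i).
  rewrite add0r {1}(xiE x); congr homog.
  by apply: eq_bigl => i; rewrite ltn_ord.
rewrite (funext E); exact: step.
Qed.

(** Fejer's estimate at z = 1 for the orbit z |-> h (z x). The components of negative index vanish,
    and the error is uniform in [x] because [H] and [d] are. *)
Theorem fpoly_approx e : 0 < e -> exists Q : V -> R[i]^o, fpoly Q /\ forall x, rnorm x <= 1 -> nc (h x - Q x) <= e.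
Proof.
move=> e0; have e20 : 0 < e / 2 by lra.
have [d d0 hd] := hU e20.
pose N := (Num.truncn (8 * H / d ^+ 2 / (e / 2))).+1.
exists (fun x => (N%:R^-1 : R[i]) *: \sum_(j < N) \sum_(l < N)
  ((if (j <= l)%N then homog (l - j) x else 0) : R[i]^o)); split.
  apply: fpoly_cscale; apply: fpoly_sum => j; apply: fpoly_sum => l.
  by case: (j <= l)%N; [exact: fpoly_homog|exact: fpoly_cst].
move=> x x1; rewrite (ncBC (h x)).
pose f z := h (z *: x).
have fd z : nc z = 1 -> nc (z - 1) < d -> nc (f z - f 1) <= e / 2.
  move=> z1 zd; apply: hd; rewrite ?rnormZ1 ?nc1//.
  rewrite -scalerBl rnormZ; apply: le_lt_trans zd.
  by rewrite ler_piMr ?nc_ge0.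
have := @fejer_estimate R f 1 (e / 2) H d N (nc1 R) (orbit_cont x1) isT d0
   (ltW e20) (fun z => orbit_le x1) fd.
rewrite {2}/f scale1r => hh; apply: le_trans (_ : _ <= e / 2 + 8 * H / (N%:R * d ^+ 2)) _.
  apply: le_trans hh; rewrite le_eqVlt; apply/orP; left; apply/eqP; congr (nc (_ - _)).
  congr (_ * _); apply: eq_bigr => j _; apply: eq_bigr => l _.
  rewrite exp1rz mul1r -[j%:Z - l%:Z]opprB -/(coef _ _).
  case: (leqP j l) => jl; first by rewrite subzn// homog_ball.
  by rewrite coef_neg//; lia.
have Nr : (0 : R) < N%:R by rewrite ltr0n.
have : 8 * H / (N%:R * d ^+ 2) < e / 2.
  have -> : 8 * H / (N%:R * d ^+ 2) = 8 * H / d ^+ 2 / N%:R.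
    by rewrite invfM mulrA mulrAC.
  have := truncnS_gt (8 * H / d ^+ 2 / (e / 2)); rewrite -/N ltr_pdivrMr// => tN.
  rewrite ltr_pdivrMr//; move: tN.
  lra.
lra.
Qed.

End Coordinates.
End Approximation.

(** * Bounded linear maps and polynomials *)

Section LinearMaps.
Variables (R : realType) (V W : normedModType R[i]).
Implicit Types (f : V -> W) (x y : V) (e d M : R).

Lemma continuous_atP f x : {for x, continuous f} <->
  (forall e, 0 < e -> exists2 d : R, 0 < d & forall y, rnorm (y - x) < d ->
    rnorm (f y - f x) <= e).
Proof.
split=> [/cvgrPdist_le hf e e0|hf].
  have e0' : 0 < e%:C%C by rewrite ltcr.
  have /nbhs_ballP[d /= d0 hd] := hf _ e0'.
  have dE : d = (complex.Re d)%:C%C by rewrite RRe_real// ger0_real// ltW.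
  exists (complex.Re d); first by rewrite -ltcr -dE.
  move=> y yx; have := hd y; rewrite -ball_normE /= rnormE dE ltcr (rnormBC x).
  by move=> /(_ yx); rewrite rnormE lecr rnormBC.
apply/cvgrPdist_le => e e0.
have eE : e = (complex.Re e)%:C%C by rewrite RRe_real// ger0_real// ltW.
have er0 : 0 < complex.Re e by rewrite -ltcr -eE.
have [d d0 hd] := hf _ er0; apply/nbhs_ballP; exists d%:C%C; first by rewrite /= ltcr.
move=> y; rewrite -ball_normE /= rnormE ltcr rnormBC => /hd.
by rewrite eE rnormE lecr rnormBC.
Qed.

Section Linear.
Variable f : V -> W.
Hypothesis lf : linear f.

Lemma lin0 : f 0 = 0.
Proof. by have := lf (-1) 0 0; rewrite scaler0 addr0 scaleN1r addNr. Qed.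

Lemma linD x y : f (x + y) = f x + f y.
Proof. by have := lf 1 x y; rewrite !scale1r. Qed.

Lemma linZ (a : R[i]) x : f (a *: x) = a *: f x.
Proof. by have := lf a x 0; rewrite lin0 !addr0. Qed.

Lemma linN x : f (- x) = - f x.
Proof. by rewrite -scaleN1r linZ scaleN1r. Qed.

Lemma linB x y : f (x - y) = f x - f y.
Proof. by rewrite linD linN. Qed.

Lemma lin_sum (I : Type) (r : seq I) (P : pred I) (F : I -> V) :
  f (\sum_(i <- r | P i) F i) = \sum_(i <- r | P i) f (F i).
Proof. by apply: big_morph; [exact: linD|exact: lin0]. Qed.

Lemma lin_ball_bound M x : (forall y, unit_ball V y -> rnorm (f y) <= M) ->
  rnorm (f x) <= M * rnorm x.
Proof.
move=> h; have [->|/eqP/rnorm_gt0 x0] := eqVneq x 0.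
  by rewrite lin0 !rnorm0 mulr0.
have := h ((rnorm x)^-1%:C%C *: x).
rewrite /unit_ball /= linZ !rnormZ nc_real ger0_norm ?invr_ge0 ?rnorm_ge0//.
by rewrite mulVf ?gt_eqF// => /(_ (lexx _)); rewrite mulrC ler_pdivrMr.
Qed.

Lemma bounded_lin_continuous M : (forall x, rnorm (f x) <= M * rnorm x) ->
  continuous f.
Proof.
move=> h x; apply/continuous_atP => e e0.
have M0 : 0 < `|M| + 1 by have := normr_ge0 M; lra.
exists (e / (`|M| + 1)); first exact: divr_gt0.
move=> y; rewrite ltr_pdivlMr// => yx; rewrite -linB; apply: le_trans (h _) _.
have := rnorm_ge0 (y - x); have := ler_norm M; nra.
Qed.

Lemma continuous_lin_bounded : continuous f ->
  exists2 M, 0 < M & forall x, rnorm (f x) <= M * rnorm x.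
Proof.
move=> /(_ 0)/continuous_atP/(_ _ ltr01)[d d0 hd]; exists (2 / d).
  exact: divr_gt0.
move=> x; apply: lin_ball_bound => y y1.
have := hd ((d / 2)%:C%C *: y); rewrite !subr0 lin0 subr0 linZ !rnormZ nc_real.
have d2 : 0 <= d / 2 by lra.
rewrite ger0_norm// => h.
have {}h : d / 2 * rnorm (f y) <= 1.
  by apply: h; have := rnorm_ge0 y; move: y1; rewrite /unit_ball /=; nra.
rewrite -(ler_pM2l (_ : 0 < d / 2)); last lra.
by have -> : d / 2 * (2 / d) = 1 by field; lra.
Qed.

End Linear.

Lemma le_ball_norm f M : (forall x, unit_ball V x -> rnorm (f x) <= M) ->
  forall x, unit_ball V x -> rnorm (f x) <= ball_norm f.
Proof.
move=> h x x1; apply: ub_le_sup; last by exists x.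
by exists M => _ [y y1 <-]; exact: h.
Qed.

Lemma unit_ball0 : unit_ball V 0.
Proof. by rewrite /unit_ball /= rnorm0. Qed.

Lemma ball_norm_le f M : (forall x, unit_ball V x -> rnorm (f x) <= M) ->
  ball_norm f <= M.
Proof.
move=> h; apply: ge_sup; first by exists (rnorm (f 0)), 0 => //; exact: unit_ball0.
by move=> _ [x x1 <-]; exact: h.
Qed.

(** The value 1 rules out the default value 0 that [sup] takes on unbounded sets, so the supremum is
    a true bound. *)
Lemma ball_norm1_le f : ball_norm f = 1 -> forall x, unit_ball V x -> rnorm (f x) <= 1.
Proof.
move=> f1 x x1; rewrite -f1; apply: ub_le_sup; last by exists x.
have [[]//|/sup_out] := pselect (has_sup [set rnorm (f x) | x in unit_ball V]).
by rewrite -/(ball_norm f) f1; lra.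
Qed.

Lemma ball_norm1_lin f : linear f -> ball_norm f = 1 ->
  forall x, rnorm (f x) <= rnorm x.
Proof.
move=> lf f1 x; rewrite -[leRHS]mul1r; apply: lin_ball_bound => //.
exact: ball_norm1_le.
Qed.

End LinearMaps.

Section Dual.
Variables (R : realType) (V : normedModType R[i]).
Implicit Types (phi psi : V -> R[i]^o).

Lemma dual_lin phi : dual V phi -> linear phi.
Proof. by case. Qed.

Lemma dual_bound phi : dual V phi ->
  exists2 M : R, 0 < M & forall x, nc (phi x) <= M * rnorm x.
Proof. by case=> l c; have [M M0 h] := continuous_lin_bounded l c; exists M. Qed.

Lemma dualI phi (M : R) : linear phi -> (forall x, nc (phi x) <= M * rnorm x) ->
  dual V phi.
Proof. by move=> l h; split=> //; exact: (bounded_lin_continuous l h). Qed.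

Lemma dual_comp (U : normedModType R[i]) (L : U -> V) phi :
  linear L -> continuous L -> dual V phi -> dual U (phi \o L).
Proof.
move=> lL cL [lp cp]; split.
  by move=> a x y /=; rewrite lL lp.
by move=> x; apply: continuous_comp; [exact: cL|exact: cp].
Qed.

End Dual.

Section FpolyAnalysis.
Variables (R : realType) (V : normedModType R[i]).

Lemma fpoly_comp_lin (U : normedModType R[i]) (W : lmodType R[i]) (L : U -> V)
    (P : V -> W) : linear L -> continuous L -> fpoly P -> fpoly (fun x => P (L x)).
Proof.
move=> lL cL; elim=> [w|P1 Q1 _ h1 _ h2|phi P1 hphi _ h].
- exact: fpoly_cst.
- exact: fpoly_add.
- by apply: (@fpoly_scale _ _ _ (phi \o L)) => //; exact: dual_comp.
Qed.

Lemma lin_comp_fpoly (W W' : normedModType R[i]) (T : W -> W') (P : V -> W) :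
  linear T -> fpoly P -> fpoly (fun x => T (P x)).
Proof.
move=> lT; elim=> [w|P1 Q1 _ h1 _ h2|phi P1 hphi _ h].
- exact: fpoly_cst.
- by under eq_fun do rewrite (linD lT); exact: fpoly_add.
- by under eq_fun do rewrite (linZ lT); exact: fpoly_scale.
Qed.

Lemma fpoly_vector (W : lmodType R[i]) (p : V -> R[i]^o) (w : W) :
  fpoly p -> fpoly (fun x => (p x : R[i]) *: w).
Proof.
elim=> [c|P1 Q1 _ h1 _ h2|phi P1 hphi _ h].
- exact: fpoly_cst.
- by under eq_fun do rewrite scalerDl; exact: fpoly_add.
- by under eq_fun do rewrite -scalerA; exact: fpoly_scale.
Qed.

Variable W : normedModType R[i].
Implicit Types (P Q : V -> W).

Lemma fpoly_bounded P : fpoly P ->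
  exists2 M : R, 0 < M & forall x, unit_ball V x -> rnorm (P x) <= M.
Proof.
elim=> [w|P1 Q1 _ [M M0 h1] _ [N N0 h2]|phi P1 hphi _ [M M0 h]].
- by exists (rnorm w + 1) => [|x _]; have := rnorm_ge0 w; lra.
- exists (M + N); first exact: addr_gt0.
  by move=> x x1; apply: le_trans (rnormD _ _) (lerD (h1 x x1) (h2 x x1)).
- have [K K0 hK] := dual_bound hphi; exists (K * M); first exact: mulr_gt0.
  move=> x x1; rewrite rnormZ; apply: ler_pM; rewrite ?nc_ge0 ?rnorm_ge0 ?h//.
  by apply: le_trans (hK x) _; rewrite ler_piMr// ltW.
Qed.

(** The functionals are those from which [P] is built, whatever the tolerance; products are handled
    by boundedness on the ball. *)
Lemma fpoly_weakly_uniform P : fpoly P ->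
  exists n (psi : 'I_n -> V -> R[i]^o), (forall i, dual V (psi i)) /\
    forall e : R, 0 < e -> exists2 d : R, 0 < d & forall x y,
      unit_ball V x -> unit_ball V y -> (forall i, nc (psi i (x - y)) < d) ->
      rnorm (P x - P y) <= e.
Proof.
elim=> [w|P1 Q1 _ [n [f [hf h1]]] _ [m [g [hg h2]]]|phi P1 hphi P1f [n [f [hf h]]]].
- exists 0%N, (fun=> 0); split=> [[]//|e e0]; exists 1 => // x y _ _ _.
  by rewrite subrr rnorm0 ltW.
- exists (n + m)%N, (fun i : 'I_(n + m) => match fintype.split i with inl j => f j | inr j => g j end).
  split=> [i|e e0]; first by case: (fintype.split i).
  have e20 : 0 < e / 2 by lra.
  have [d1 d10 k1] := h1 _ e20; have [d2 d20 k2] := h2 _ e20.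
  exists (Num.min d1 d2); first by rewrite lt_min d10.
  move=> x y x1 y1 hxy; rewrite opprD addrACA; apply: le_trans (rnormD _ _) _.
  have g1 : rnorm (P1 x - P1 y) <= e / 2.
    apply: k1 => // i; have := hxy (lshift m i); rewrite lt_min => /andP[+ _].
    by rewrite (unsplitK (inl i : 'I_n + 'I_m)).
  have g2 : rnorm (Q1 x - Q1 y) <= e / 2.
    apply: k2 => // i; have := hxy (rshift n i); rewrite lt_min => /andP[_ +].
    by rewrite (unsplitK (inr i : 'I_n + 'I_m)).
  lra.
- have [M M0 hM] := fpoly_bounded P1f; have [K K0 hK] := dual_bound hphi.
  exists n.+1, (fun i => match unlift ord0 i with None => phi | Some j => f j end).
  split=> [i|e e0]; first by case: (unlift ord0 i).
  have e1 : 0 < e / (2 * K) by rewrite divr_gt0// mulr_gt0.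
  have e2 : 0 < e / (2 * M) by rewrite divr_gt0// mulr_gt0.
  have [d d0 hd] := h _ e1.
  exists (Num.min d (e / (2 * M))); first by rewrite lt_min d0.
  move=> x y x1 y1 hxy.
  have -> : phi x *: P1 x - phi y *: P1 y =
      phi x *: (P1 x - P1 y) + (phi (x - y) : R[i]) *: P1 y.
    by rewrite (linB (dual_lin hphi)) scalerBr scalerBl subrKA.
  apply: le_trans (rnormD _ _) _; rewrite !rnormZ.
  have g1 : rnorm (P1 x - P1 y) <= e / (2 * K).
    apply: hd => // i; have := hxy (lift ord0 i); rewrite liftK lt_min => /andP[].
    by [].
  have g2 : nc (phi (x - y)) <= e / (2 * M).
    by have := hxy ord0; rewrite unlift_none lt_min => /andP[_ /ltW].
  have g3 : nc (phi x) <= K.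
    by apply: le_trans (hK x) _; rewrite ler_piMr// ltW.
  have k1 := ler_pM (nc_ge0 _) (rnorm_ge0 _) g3 g1.
  have k2 := ler_pM (nc_ge0 _) (rnorm_ge0 _) g2 (hM y y1).
  apply: le_trans (lerD k1 k2) _.
  have -> : K * (e / (2 * K)) + e / (2 * M) * M = e by field; lra.
  by [].
Qed.

Lemma fpoly_uniform P : fpoly P -> forall e : R, 0 < e -> exists2 d : R, 0 < d &
  forall x y, unit_ball V x -> unit_ball V y -> rnorm (x - y) < d ->
    rnorm (P x - P y) <= e.
Proof.
move=> /fpoly_weakly_uniform[n [psi [hpsi h]]] e /h[d d0 hd].
have [M M0 hM] : exists2 M : R, 0 < M & forall i x, nc (psi i x) <= M * rnorm x.
  have /choice[K hK] : forall i, exists M : R, forall x, nc (psi i x) <= M * rnorm x.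
    by move=> i; have [M _ hM] := dual_bound (hpsi i); exists M.
  exists (\sum_i `|K i| + 1).
    by have : 0 <= \sum_i `|K i|; [exact: sumr_ge0|lra].
  move=> i x; apply: le_trans (_ : _ <= K i * rnorm x) _; first exact: hK.
  rewrite ler_wpM2r ?rnorm_ge0// (bigD1 i)//=.
  have : 0 <= \sum_(j < n | j != i) `|K j| by exact: sumr_ge0.
  have := ler_norm (K i); lra.
exists (d / M); first exact: divr_gt0.
move=> x y x1 y1; rewrite ltr_pdivlMr// => xy; apply: hd => // i.
by apply: le_lt_trans (hM _ _) _; rewrite mulrC.
Qed.

Lemma scale_is_bilinear : bilinear_for
    (GRing.Scale.Law.clone _ _ *:%R _) (GRing.Scale.Law.clone _ _ *:%R _)
    (fun (a : R[i]^o) (w : W) => (a : R[i]) *: w).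
Proof.
split=> [u'|u] a x y /=; first by rewrite scalerDl scalerA.
by rewrite scalerDr !scalerA mulrC.
Qed.

Lemma fpoly_differentiable P x : fpoly P -> differentiable P x.
Proof.
elim=> [w|P1 Q1 _ h1 _ h2|phi P1 [lp cp] _ h].
- exact: differentiable_cst.
- exact: differentiableD.
- pose B : {bilinear R[i]^o -> W -> W} :=
    HB.pack (fun (a : R[i]^o) (w : W) => (a : R[i]) *: w)
      (bilinear_isBilinear.Build _ _ _ _ _ _ _ scale_is_bilinear).
  pose L : {linear V -> R[i]^o} := HB.pack phi
    (GRing.isLinear.Build _ _ _ _ phi lp).
  have dL : differentiable phi x by exact: (@linear_differentiable _ _ _ L).
  have := differentiable_comp (differentiable_pair dL h) (@differentiable_bilin _ _ _ _ B _ _).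
  apply; move=> p; exact: scale_continuous.
Qed.

End FpolyAnalysis.

(** * Finite-dimensional spaces *)

Section Compactness.
Variables (R : realType) (N : nat).
Implicit Types (a b : 'I_N -> R[i]) (e d M : R).

Let cpx (v : 'rV[R]_(N + N)) (i : 'I_N) : R[i] :=
  (v 0%R (lshift N i) +i* v 0%R (rshift N i))%C.

Let mx_entry_le n (v : 'rV[R]_n) i : `|v 0%R i| <= `|v|.
Proof.
by rewrite /Num.norm /= mx_normrE; apply: (le_bigmax _ (fun ij => `|v ij.1 ij.2|) (0, i)).
Qed.

Let mx_norm_le n (v : 'rV[R]_n) M : 0 <= M -> (forall i, `|v 0%R i| <= M) -> `|v| <= M.
Proof.
move=> M0 h; have [v0|/mx_norm_neq0[[i j]]] := eqVneq (mx_norm v) 0.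
  by rewrite [`|v|]v0.
by rewrite -[mx_norm v]/`|v| => -> /=; rewrite (ord1 i).
Qed.

Let cpx_lip v w i : nc (cpx v i - cpx w i) <= 2 * `|v - w|.
Proof.
apply: le_trans (nc_le_ReIm _) _; rewrite /cpx /=.
have := mx_entry_le (v - w) (lshift N i); have := mx_entry_le (v - w) (rshift N i).
rewrite !mxE; lra.
Qed.

Let cpx_surj a : exists v, cpx v = a.
Proof.
exists (row_mx (\row_i complex.Re (a i)) (\row_i complex.Im (a i))).
by apply/funext => i; rewrite /cpx row_mxEl row_mxEr !mxE; case: (a i).
Qed.

(** All compactness comes from here: C^N is read as R^(2N), where closed bounded sets are compact.
    The coordinates will be those of vectors, of pairs in [Pi_set] and of affine maps. *)
Lemma compact_max (K : set ('I_N -> R[i])) (f : ('I_N -> R[i]) -> R) :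
  (exists a, K a) -> (exists M, forall a, K a -> forall i, nc (a i) <= M) ->
  (forall a, (forall d, 0 < d -> exists b, K b /\ forall i, nc (b i - a i) < d) -> K a) ->
  (forall a, K a -> forall e, 0 < e -> exists2 d : R, 0 < d & forall b, K b ->
     (forall i, nc (b i - a i) < d) -> `|f b - f a| <= e) ->
  exists a, K a /\ forall b, K b -> f b <= f a.
Proof.
move=> [a0 Ka0] [M hM] hcl hcont.
pose A := [set v | K (cpx v)].
have [v0 v0E] := cpx_surj a0.
have A0 : A !=set0 by exists v0; rewrite /A /= v0E.
have clA : closed A.
  move=> v hv; apply: hcl => d d0.
  have d20 : 0 < d / 2 by lra.
  have [w [Aw vw]] := hv _ (nbhsx_ballx v _ d20).
  exists (cpx w); split=> // i; move: vw; rewrite -ball_normE /= => vw.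
  by apply: le_lt_trans (cpx_lip w v i) _; rewrite distrC; lra.
have bA : bounded_set A.
  exists `|M|; split; first exact: num_real.
  move=> M' MM' v Av; apply: le_trans _ (ltW MM'); apply: mx_norm_le => // j.
  have KM := hM _ Av.
  have [i ->|i ->] := split_ordP j.
    have := KM i; have := normRe_le (cpx v i); rewrite /cpx /=.
    by have := ler_norm M; lra.
  have := KM i; have := normIm_le (cpx v i); rewrite /cpx /=.
  by have := ler_norm M; lra.
have cA := bounded_closed_compact bA clA.
have fc : {within A, continuous (f \o cpx)}.
  apply/subspace_continuousP => v Av; apply/cvgrPdist_le => e e0.
  have [d d0 hd] := hcont _ Av _ e0.
  apply/nbhs_ballP; exists (d / 2) => /=; first lra.
  move=> w; rewrite -ball_normE /= => vw Aw; rewrite distrC; apply: hd => // i.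
  by apply: le_lt_trans (cpx_lip w v i) _; rewrite distrC; lra.
have [v /set_mem Av hv] := EVT_max_rV A0 cA fc.
exists (cpx v); split=> // b Kb; have [w wE] := cpx_surj b.
by rewrite -wE; apply: hv; rewrite inE /A /= wE.
Qed.

End Compactness.

Section Coordinates.
Variables (R : realType) (V : normedModType R[i]).

Definition spanned_by n (b : 'I_n -> V) :=
  forall x, exists a : 'I_n -> R[i], x = \sum_i a i *: b i.

Lemma basis_ex n (b : 'I_n -> V) : spanned_by b ->
  exists m (c : 'I_m -> V), spanned_by c /\
    forall a : 'I_m -> R[i], \sum_i a i *: c i = 0 -> forall i, a i = 0.
Proof.
elim: n b => [|n ih] b hb; first by exists 0%N, b; split=> // a _ [].
have [free|] := pselect (forall a : 'I_n.+1 -> R[i], \sum_i a i *: b i = 0 ->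
  forall i, a i = 0); first by exists n.+1, b.
move=> /existsNP[a /not_implyP[a0 /existsNP[j /eqP aj]]].
apply: (ih (fun i => b (lift j i))) => x.
have [c xE] := hb x.
exists (fun i => c (lift j i) - c j / a j * a (lift j i)).
have aE : a j *: b j = - \sum_(i < n) a (lift j i) *: b (lift j i).
  apply/eqP; rewrite -addr_eq0; apply/eqP; rewrite -[RHS]a0.
  by rewrite (bigD1_ord j).
have bE : c j *: b j = - \sum_(i < n) (c j / a j * a (lift j i)) *: b (lift j i).
  rewrite -{1}[c j](divfK aj) -scalerA aE scalerN scaler_sumr; congr (- _).
  by apply: eq_bigr => i _; rewrite scalerA.
rewrite {1}xE (bigD1_ord j)//= bE addrC -sumrB.
by apply: eq_bigr => i _; rewrite scalerBl.
Qed.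

(** Equivalence of norms: by independence the norm has a positive minimum on the compact set where
    the largest coefficient has modulus 1, and scaling reaches all other vectors. *)
Lemma lincomb_lower n (b : 'I_n -> V) :
  (forall a : 'I_n -> R[i], \sum_i a i *: b i = 0 -> forall i, a i = 0) ->
  exists2 c : R, 0 < c & forall (a : 'I_n -> R[i]) i,
    nc (a i) <= c * rnorm (\sum_i a i *: b i).
Proof.
case: n b => [|n] b free; first by exists 1 => // a [].
pose B := \sum_i rnorm (b i) + 1.
have B0 : 0 < B.
  have : 0 <= \sum_i rnorm (b i) by apply: sumr_ge0 => i _; exact: rnorm_ge0.
  by rewrite /B; lra.
have Blip (a a' : 'I_n.+1 -> R[i]) (d : R) : (forall i, nc (a i - a' i) <= d) ->
    rnorm (\sum_i a i *: b i - \sum_i a' i *: b i) <= d * B.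
  move=> h; rewrite -sumrB; apply: le_trans (rnorm_sum _ _ _) _.
  have d0 : 0 <= d by apply: le_trans (nc_ge0 _) (h ord0).
  apply: le_trans (_ : _ <= d * \sum_i rnorm (b i)) _.
    rewrite mulr_sumr; apply: ler_sum => i _.
    by rewrite -scalerBl rnormZ ler_wpM2r ?rnorm_ge0.
  by rewrite ler_wpM2l// /B; lra.
pose K := [set a : 'I_n.+1 -> R[i] | (forall i, nc (a i) <= 1) /\ exists i, 1 <= nc (a i)].
have := @compact_max R n.+1 K (fun a => - rnorm (\sum_i a i *: b i)).
case=> [|||a Ka e e0|a [[a1 [j aj]] hmin]].
- exists (fun=> 1); split=> [i|]; first by rewrite nc1.
  by exists ord0; rewrite nc1.
- by exists 1 => a [].
- move=> a hlim; split=> [i|].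
    apply/ler_addgt0Pr => d d0; have [a' [[h1 _] h2]] := hlim _ d0.
    have := ncB_le (a i) (a' i) 0; rewrite !subr0 (ncBC (a i)).
    by have := h1 i; have := h2 i; lra.
  apply: contrapT => /forallNP hn.
  have hn' i : nc (a i) < 1 by rewrite ltNge; apply/negP/hn.
  pose m := \big[Num.max/0]_i nc (a i).
  have m1 : m < 1 by apply: bigmax_lt => // i _.
  have mi i : nc (a i) <= m by apply: (le_bigmax _ (fun i => nc (a i)) i).
  have d0 : 0 < 1 - m by lra.
  have [a' [[_ [i hi]] h2]] := hlim _ d0.
  have := ncB_le (a' i) (a i) 0; rewrite !subr0.
  by have := mi i; have := h2 i; lra.
- exists (e / B); first exact: divr_gt0.
  move=> a' _ h; rewrite opprK addrC; apply: le_trans (rnorm_sub_norm _ _) _.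
  rewrite rnormBC; have := @Blip a' a (e / B) (fun i => ltW (h i)).
  by rewrite divfK// gt_eqF.
- set m := rnorm (\sum_i a i *: b i) in hmin.
  have m0 : 0 < m.
    apply: rnorm_gt0 => /free/(_ j) h; by move: aj; rewrite h nc0; lra.
  exists m^-1; first by rewrite invr_gt0.
  move=> a' i.
  have [k hk] : exists k, forall l, nc (a' l) <= nc (a' k).
    case: (@Order.TotalTheory.arg_maxP _ _ _ ord0 predT (fun k => nc (a' k)) isT).
    by move=> k _ hk; exists k => l; exact: hk.
  have [t tk] : exists t, t = nc (a' k) by eexists.
  rewrite -tk in hk; have ti := hk.
  have t0 : 0 <= t by apply: le_trans (nc_ge0 _) (ti ord0).
  have [tz|tnz] := eqVneq t 0.
    apply: le_trans (ti i) _; rewrite tz mulr_ge0 ?rnorm_ge0// invr_ge0 ltW//.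
  have tp : 0 < t by rewrite lt_neqAle eq_sym tnz.
  have := hmin (fun i => (t^-1)%:C%C * a' i).
  have Kt : K (fun i => (t^-1)%:C%C * a' i).
    split=> [l|]; rewrite ?ncM ?nc_real ?ger0_norm ?invr_ge0//.
      by rewrite mulrC ler_pdivrMr// mul1r.
    by exists k; rewrite ncM nc_real ger0_norm ?invr_ge0// -tk mulVf.
  move=> /(_ Kt); rewrite lerN2.
  under eq_bigr do rewrite -scalerA.
  rewrite -scaler_sumr rnormZ nc_real ger0_norm ?invr_ge0// => h.
  apply: le_trans (ti i) _; rewrite mulrC ler_pdivlMr// mulrC.
  by move: h; rewrite ler_pdivlMl// [t * m]mulrC.
Qed.

Lemma coordinates_ex : (exists n (b : 'I_n -> V), spanned_by b) ->
  exists n (b : 'I_n -> V) (xi : 'I_n -> V -> R[i]^o),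
    (forall i, dual V (xi i)) /\ forall x, x = \sum_i (xi i x : R[i]) *: b i.
Proof.
move=> [n0 [b0 /basis_ex[n [b [span free]]]]].
have [c c0 hc] := lincomb_lower free.
have /choice[xi hxi] := span.
exists n, b, (fun i x => xi x i); split=> // i.
apply: (@dualI _ _ _ c).
  move=> k x y; apply/eqP; rewrite -subr_eq0; apply/eqP.
  apply: (free (fun i => xi (k *: x + y) i - (k *: (xi x i : R[i]^o) + xi y i))).
  under eq_bigr do rewrite scalerBl scalerDl -scalerA.
  by rewrite sumrB big_split /= -scaler_sumr -!hxi subrr.
by move=> x; rewrite {2}(hxi x); exact: hc.
Qed.

End Coordinates.

(** * Norming functionals in finite dimensions *)

Section HahnBanach.
Variables (R : realType) (V : normedModType R[i]).
Implicit Types (p q : V -> R) (x y : V).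

Definition sublinear p := (forall x y, p (x + y) <= p x + p y) /\
  forall (c : R) x, 0 < c -> p (c%:C%C *: x) <= c * p x.

Lemma sublinearZ p (c : R) x : sublinear p -> 0 < c -> p (c%:C%C *: x) = c * p x.
Proof.
move=> [_ h] c0; apply/eqP; rewrite eq_le h//=.
have := h c^-1 (c%:C%C *: x); rewrite invr_gt0 => /(_ c0).
by rewrite scalerA -rmorphM /= mulVf ?gt_eqF// scale1r ler_pdivlMl.
Qed.

Lemma sublinear0 p : sublinear p -> p 0 = 0.
Proof.
by move=> h; have := sublinearZ 0 h (ltr0Sn R 1); rewrite scaler0; lra.
Qed.

Lemma sublinear_opp p x : sublinear p -> - p (- x) <= p x.
Proof.
by move=> h; have := h.1 x (- x); rewrite subrr (sublinear0 h); lra.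
Qed.

(* The largest sublinear minorant of [p] that is linear along [e]. *)
Lemma sublinear_step p (e : V) : sublinear p -> exists q, [/\ sublinear q,
  forall x, q x <= p x & q (- e) <= - p e].
Proof.
move=> hp.
pose S x := [set p (x + t%:C%C *: e) - t * p e | t in [set t : R | 0 <= t]].
pose q x := inf (S x).
have te t : 0 <= t -> p (t%:C%C *: e) = t * p e.
  rewrite le_eqVlt => /predU1P[<-|t0]; last exact: sublinearZ.
  by rewrite scale0r mul0r sublinear0.
have lb x : lbound (S x) (- p (- x)).
  move=> _ [t /= t0 <-]; have := hp.1 (x + t%:C%C *: e) (- x).
  by rewrite addrAC subrr add0r te//; lra.
have hlb x : has_lbound (S x) by exists (- p (- x)).
have ne x : S x !=set0 by exists (p (x + 0%:C%C *: e) - 0 * p e), 0 => //=.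
have qle x t : 0 <= t -> q x <= p (x + t%:C%C *: e) - t * p e.
  by move=> t0; apply: ge_inf; [exact: hlb|exists t].
have qge x m : (forall t, 0 <= t -> m <= p (x + t%:C%C *: e) - t * p e) -> m <= q x.
  by move=> h; apply: lb_le_inf; [exact: ne|move=> _ [t t0 <-]; exact: h].
exists q; split.
- split=> [x y|c x c0].
    have : q (x + y) - q y <= q x.
      apply: (qge) => t t0; rewrite lerBlDr -lerBlDl; apply: (qge) => s s0.
      have := qle (x + y) (t + s); rewrite addr_ge0// => /(_ isT).
      have := hp.1 (x + t%:C%C *: e) (y + s%:C%C *: e).
      by rewrite rmorphD /= scalerDl addrACA; lra.
    by lra.
  rewrite -ler_pdivrMl//; apply: (qge) => t t0.
  have := qle (c%:C%C *: x) (c * t); rewrite mulr_ge0 ?(ltW c0)// => /(_ isT).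
  rewrite rmorphM /= -scalerA -scalerDr (sublinearZ _ hp c0) => h.
  by rewrite ler_pdivrMl//; lra.
- by move=> x; have := qle x 0 (lexx _); rewrite scale0r addr0; lra.
- have := qle (- e) 1 ler01; rewrite scale1r addNr (sublinear0 hp); lra.
Qed.

Lemma sublinear_steps p (l : seq V) : sublinear p -> exists q, [/\ sublinear q,
  forall x, q x <= p x & forall e, e \in l -> q (- e) <= - q e].
Proof.
move=> hp; elim: l => [|e l [q [hq qp ql]]]; first by exists p; split.
have [r [hr rq re]] := sublinear_step e hq; exists r; split=> //.
  by move=> x; apply: le_trans (qp x).
move=> e'; rewrite inE => /predU1P[->|/ql h]; first by have := rq e; lra.
by have := rq (- e'); have := rq e'; lra.
Qed.

(** The norm is lowered to a sublinear function that is linear along [u], then along each [b i] and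
    each [i * b i], which span the real space. Starting with [u] keeps the value at [u] equal to its
    norm. *)
Lemma norming_functional n (b : 'I_n -> V) (u : V) : spanned_by b -> u <> 0 ->
  exists phi : V -> R[i]^o, [/\ dual V phi, ball_norm phi = 1 &
    phi u = (rnorm u)%:C%C].
Proof.
move=> span u0.
have hN : sublinear (@rnorm R V).
  split=> [x y|c x c0]; first exact: rnormD.
  by rewrite rnormZ nc_real gtr0_norm.
have [p [hp pN pu]] := sublinear_step u hN.
have [q [hq qp ql]] := sublinear_steps
  ([seq b i | i : 'I_n] ++ [seq 'i%C *: b i | i : 'I_n]) hp.
pose L x := q (- x) <= - q x.
have LD x y : L x -> L y -> L (x + y).
  rewrite /L => hx hy; have := hq.1 x y; have := hq.1 (- x) (- y).
  by rewrite -opprD; lra.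
have LZ (c : R) x : L x -> L (c%:C%C *: x).
  rewrite /L => hx; have [c0|c0|<-] := ltgtP 0 c.
  - rewrite -scalerN !(sublinearZ _ hq c0) -mulrN.
    by rewrite ler_pM2l.
  - have c0' : 0 < - c by lra.
    have -> : c%:C%C *: x = (- c)%:C%C *: (- x) by rewrite scalerN rmorphN scaleNr opprK.
    rewrite -scalerN opprK !(sublinearZ _ hq c0').
    by have := ler_wpM2l (ltW c0') hx; lra.
  - by rewrite scale0r oppr0 (sublinear0 hq) oppr0.
have Lb i : L (b i).
  by apply: ql; rewrite mem_cat; apply/orP; left; apply/mapP; exists i; rewrite ?mem_enum.
have Lib i : L ('i%C *: b i).
  by apply: ql; rewrite mem_cat; apply/orP; right; apply/mapP; exists i; rewrite ?mem_enum.
have Lall x : L x.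
  have [a ->] := span x; elim/big_ind: _ => //.
    by rewrite /L oppr0 (sublinear0 hq) oppr0.
  move=> i _; rewrite (complexE (a i)) scalerDl mulrC -scalerA.
  by apply: LD; apply: LZ.
have qN x : q (- x) = - q x.
  apply/eqP; rewrite eq_le; apply/andP; split; first exact: Lall.
  by have := sublinear_opp (- x) hq; rewrite opprK; lra.
have qD x y : q (x + y) = q x + q y.
  apply/eqP; rewrite eq_le hq.1 /=.
  by have := hq.1 (- x) (- y); rewrite -opprD !qN; lra.
have qZ (c : R) x : q (c%:C%C *: x) = c * q x.
  have [c0|c0|<-] := ltgtP 0 c.
  - exact: sublinearZ.
  - have c0' : 0 < - c by lra.
    have -> : c%:C%C *: x = (- c)%:C%C *: (- x) by rewrite scalerN rmorphN scaleNr opprK.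
    by rewrite (sublinearZ _ hq c0') qN; lra.
  - by rewrite scale0r (sublinear0 hq) mul0r.
(* The complex linear functional with real part [q]. *)
pose phi x : R[i]^o := (q x +i* - q ('i%C *: x))%C.
have lphi : linear phi.
  move=> a x y; rewrite /phi; case: a => s t.
  have E z : (s +i* t)%C *: z = s%:C%C *: z + t%:C%C *: ('i%C *: z).
    by rewrite [(s +i* t)%C]complexE /= scalerDl mulrC scalerA.
  apply/eqP; rewrite eq_complex; apply/andP; split; apply/eqP.
    by rewrite /= qD E qD !qZ; ring.
  rewrite /= scalerDr qD scalerA mulrC -scalerA E qD !qZ.
  have -> : 'i%C *: ('i%C *: x) = - x.
    rewrite scalerA; have -> : 'i%C * 'i%C = -1 :> R[i].
      by apply/eqP; rewrite eq_complex /= !(mul0r, mulr0, mul1r, mulr1) sub0r addr0 oppr0 !eqxx.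
    by rewrite scaleN1r.
  by rewrite qN; ring.
have qr x : q x <= rnorm x by apply: le_trans (pN x); exact: qp.
have phib x : nc (phi x) <= rnorm x.
  have [c [c1 hc]] := phase_ex (phi x).
  have E : phi (c *: x) = (nc (phi x))%:C%C by rewrite (linZ lphi).
  have := congr1 (@complex.Re R) E; rewrite /= => <-.
  by apply: le_trans (qr _) _; rewrite rnormZ c1 mul1r.
have phiu : phi u = (rnorm u)%:C%C.
  have qu : q u = rnorm u.
    apply/eqP; rewrite eq_le qr /=; have := qp (- u); rewrite qN; lra.
  have := phib u; set r := rnorm u in qu *; rewrite /phi qu.
  (* The real part of [phi u] already equals the norm of [u], so the norm bound leaves no room for
     an imaginary part. *)
  set m := - q _ => hm; congr (_ +i* _)%C.
  have m2 : r ^+ 2 + m ^+ 2 = nc (r +i* m)%C ^+ 2.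
    by apply: (@realc_inj R); rewrite [RHS]rmorphXn /= -ncE -add_Re2_Im2.
  have r0 : 0 <= r by exact: rnorm_ge0.
  have : nc (r +i* m)%C ^+ 2 <= r ^+ 2 by rewrite lerXn2r ?nnegrE ?nc_ge0.
  rewrite -m2 => h; apply/eqP; rewrite -sqrf_eq0 eq_le sqr_ge0 andbT; lra.
exists phi; split=> //.
  by apply: (@dualI _ _ _ 1) => // x; rewrite mul1r.
have ph1 x : unit_ball V x -> rnorm (phi x) <= 1 by move=> x1; apply: le_trans x1; exact: phib.
apply/eqP; rewrite eq_le ball_norm_le//=.
have ur : 0 < rnorm u by exact: rnorm_gt0.
have := @le_ball_norm R V R[i]^o phi 1 ph1 ((rnorm u)^-1%:C%C *: u).
rewrite (linZ lphi) phiu rnormC ncM !nc_real /unit_ball /= rnormZ nc_real.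
rewrite !gtr0_norm ?invr_gt0// mulVf ?gt_eqF//; exact.
Qed.

End HahnBanach.

(** * Attainment of suprema *)

Section Attainment.
Variables (R : realType) (V : normedModType R[i]) (n : nat).
Variables (b : 'I_n -> V) (xi : 'I_n -> V -> R[i]^o).
Hypothesis xi_dual : forall i, dual V (xi i).
Hypothesis xiE : forall x, x = \sum_i (xi i x : R[i]) *: b i.
Implicit Types (x y : V) (phi : V -> R[i]^o).

Lemma coord_bound : exists2 M : R, 0 < M & forall i x, nc (xi i x) <= M * rnorm x.
Proof.
have /choice[K hK] : forall i, exists M : R, forall x, nc (xi i x) <= M * rnorm x.
  by move=> i; have [M _ hM] := dual_bound (xi_dual i); exists M.
exists (\sum_i `|K i| + 1).
  by have : 0 <= \sum_i `|K i|; [exact: sumr_ge0|lra].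
move=> i x; apply: le_trans (_ : _ <= K i * rnorm x) _; first exact: hK.
rewrite ler_wpM2r ?rnorm_ge0// (bigD1 i)//=.
have : 0 <= \sum_(j < n | j != i) `|K j| by exact: sumr_ge0.
by have := ler_norm (K i); lra.
Qed.

Lemma dual_coordE phi x : linear phi -> phi x = \sum_i xi i x * phi (b i).
Proof.
move=> lp; rewrite {1}(xiE x) (lin_sum lp); apply: eq_bigr => i _.
by rewrite (linZ lp).
Qed.

Let B := \sum_i rnorm (b i).

Let B0 : 0 <= B.
Proof. by apply: sumr_ge0 => i _; exact: rnorm_ge0. Qed.

Let comb (a : 'I_n -> R[i]) := \sum_i a i *: b i.

Let comb_lip (a a' : 'I_n -> R[i]) (d : R) : (forall i, nc (a i - a' i) <= d) ->
  rnorm (comb a - comb a') <= d * B.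
Proof.
move=> h; rewrite -sumrB; apply: le_trans (rnorm_sum _ _ _) _.
rewrite mulr_sumr; apply: ler_sum => i _.
by rewrite -scalerBl rnormZ ler_wpM2r ?rnorm_ge0.
Qed.

Lemma ball_max (f : V -> R) :
  (forall x, unit_ball V x -> forall e : R, 0 < e -> exists2 d : R, 0 < d &
     forall y, unit_ball V y -> rnorm (y - x) < d -> `|f y - f x| <= e) ->
  exists x, unit_ball V x /\ forall y, unit_ball V y -> f y <= f x.
Proof.
move=> hf; have [M M0 hM] := coord_bound.
have xiM x i : unit_ball V x -> nc (xi i x) <= M.
  by move=> x1; apply: le_trans (hM i x) _; rewrite ler_piMr// ltW.
pose K := [set a | unit_ball V (comb a) /\ forall i, nc (a i) <= M].
have Kxi x : unit_ball V x -> K (fun i => xi i x).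
  by move=> x1; split=> [|i]; [rewrite /comb -xiE|exact: xiM].
have B1 : 0 < B + 1 by have := B0; lra.
have [|||a [a1 aM] e e0|a [[a1 aM] ha]] := @compact_max R n K (fun a => f (comb a)).
- by exists (fun i => xi i 0); apply: Kxi; exact: unit_ball0.
- by exists M => a [].
- move=> a hlim; split.
    apply/ler_addgt0Pr => d d0.
    have [a' [[h1 _] h2]] := hlim _ (divr_gt0 d0 B1).
    have := rnormD (comb a') (comb a - comb a'); rewrite addrC subrK.
    have := @comb_lip a a' (d / (B + 1)) (fun i => _); move=> /(_ _)/=.
    move=> h; have {}h : rnorm (comb a - comb a') <= d / (B + 1) * B.
      by apply: h => i; rewrite ncBC; exact: ltW.
    have : d / (B + 1) * B <= d.
      by rewrite mulrAC ler_pdivrMr// ler_pM2l//; lra.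
    by move: h1; rewrite /unit_ball /=; lra.
  move=> i; apply/ler_addgt0Pr => d d0.
  have [a' [[_ h1] h2]] := hlim _ d0.
  have := ncB_le (a i) (a' i) 0; rewrite !subr0 (ncBC (a i)).
  by have := h1 i; have := h2 i; lra.
- have [d d0 hd] := hf _ a1 _ e0; exists (d / (B + 1)); first exact: divr_gt0.
  move=> a' [a'1 _] h; apply: hd => //.
  apply: le_lt_trans (comb_lip (fun i => ltW (h i))) _.
  by rewrite mulrAC ltr_pdivrMr// ltr_pM2l//; lra.
- exists (comb a); split=> // y y1; have := ha _ (Kxi y y1).
  by rewrite /comb -xiE.
Qed.

(** A pair in [Pi_set] is encoded by [n + n] complex numbers, the coordinates of the point and the
    values of the functional on the [b i]; the codes form a closed bounded set. *)
Lemma Pi_set_max (Q : V -> V) : (exists x : V, x <> 0) ->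
  (forall x, unit_ball V x -> forall e : R, 0 < e -> exists2 d : R, 0 < d &
     forall y, unit_ball V y -> rnorm (y - x) < d -> rnorm (Q y - Q x) <= e) ->
  exists p, Pi_set p /\ forall p', Pi_set (Y := V) p' ->
    nc (p'.2 (Q p'.1)) <= nc (p.2 (Q p.1)).
Proof.
move=> [u u0] hQ; have [M M0 hM] := coord_bound.
have span : spanned_by b by move=> x; exists (fun i => xi i x); exact: xiE.
(* The coordinates of a unit vector are at most [M], the values of a norm-one functional on the
   [b i] at most [B]. *)
pose M' := M + B + 1.
have M'0 : 0 < M' by rewrite /M'; have := B0; lra.
pose T (be : 'I_n -> R[i]) x : R[i]^o := \sum_i xi i x * be i.
have TB be be' z z' (d : R) : 0 <= d -> (forall i, nc (be' i) <= M') ->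
    (forall i, nc (be' i - be i) <= d) ->
    nc (T be' z' - T be z) <= n%:R * (M * M' * rnorm (z' - z) + M * rnorm z * d).
  move=> d0 h1 h2; rewrite /T -sumrB; apply: le_trans (nc_sum _ _ _) _.
  rewrite mulr_natl -[X in _ *+ X]card_ord -sumr_const; apply: ler_sum => i _.
  have -> : xi i z' * be' i - xi i z * be i =
      xi i (z' - z) * be' i + xi i z * (be' i - be i).
    by rewrite (linB (dual_lin (xi_dual i))); ring.
  apply: le_trans (ncD _ _) _; rewrite !ncM lerD//.
    rewrite mulrAC; apply: ler_pM; rewrite ?nc_ge0//.
  by apply: ler_pM; rewrite ?nc_ge0.
pose lo (a : 'I_(n + n) -> R[i]) i := a (lshift n i).
pose hi (a : 'I_(n + n) -> R[i]) i := a (rshift n i).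
(* Norm one is expressed by the inequality |T x| <= |x| together with the value 1 at a unit vector;
   both survive limits. *)
pose K := [set a : 'I_(n + n) -> R[i] | [/\ forall i, nc (a i) <= M',
   rnorm (comb (lo a)) = 1, forall x, nc (T (hi a) x) <= rnorm x &
   T (hi a) (comb (lo a)) = 1]].
pose enc (p : V * (V -> R[i]^o)) : 'I_(n + n) -> R[i] := fun i =>
  match fintype.split i with inl j => xi j p.1 | inr j => p.2 (b j) end.
have loE p : lo (enc p) = (fun i => xi i p.1).
  by apply/funext => i; rewrite /lo /enc (unsplitK (inl i : 'I_n + 'I_n)).
have hiE p : hi (enc p) = (fun i => p.2 (b i)).
  by apply/funext => i; rewrite /hi /enc (unsplitK (inr i : 'I_n + 'I_n)).
have combE x : comb (fun i => xi i x) = x by rewrite /comb -xiE.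
have TE phi : linear phi -> T (fun i => phi (b i)) = phi.
  by move=> lp; apply/funext => x; rewrite /T -dual_coordE.
have Kenc p : Pi_set p -> K (enc p).
  move=> [p1 dp np pp]; have lp := dual_lin dp.
  have bp x : nc (p.2 x) <= rnorm x by exact: (ball_norm1_lin lp np).
  split.
  - move=> i; rewrite /enc; case: (fintype.split i) => j.
      by apply: le_trans (hM j _) _; rewrite p1 mulr1 /M'; have := B0; lra.
    apply: le_trans (bp _) _; rewrite /M' /B (bigD1 j)//=.
    have : 0 <= \sum_(k < n | k != j) rnorm (b k).
      by apply: sumr_ge0 => k _; exact: rnorm_ge0.
    by lra.
  - by rewrite loE combE.
  - by move=> x; rewrite hiE TE.
  - by rewrite hiE loE TE// combE.
have dec a : K a -> Pi_set (comb (lo a), T (hi a)).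
  move=> [aM a1 ab aT]; have lT : linear (T (hi a)).
    move=> k x y; rewrite /T -[X in _ = X + _]/(k * \sum_i xi i x * hi a i) mulr_sumr.
    rewrite -big_split /=.
    apply: eq_bigr => i _; rewrite (linD (dual_lin (xi_dual i))).
    by rewrite (linZ (dual_lin (xi_dual i))) -[k *: xi i x]/(k * xi i x); ring.
  have bT x : unit_ball V x -> rnorm (T (hi a) x) <= 1.
    by move=> x1; apply: le_trans x1; exact: ab.
  split=> //=.
    by apply: (@dualI _ _ _ 1) => // x; rewrite mul1r.
  apply/eqP; rewrite eq_le ball_norm_le//=.
  have := @le_ball_norm _ _ _ _ _ bT (comb (lo a)).
  by rewrite aT rnormC nc1 /unit_ball /= a1; apply.
have clo a a' d : (forall i, nc (a' i - a i) < d) ->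
    rnorm (comb (lo a') - comb (lo a)) <= d * B.
  by move=> h; apply: comb_lip => i; exact/ltW/h.
have [|||a Ka e e0|a [Ka ha]] := @compact_max R (n + n) K
   (fun a => nc (T (hi a) (Q (comb (lo a))))).
- have [phi [dphi nphi phiu]] := norming_functional span u0.
  have ur := rnorm_gt0 u0; have lphi := dual_lin dphi.
  exists (enc ((rnorm u)^-1%:C%C *: u, phi)); apply: Kenc; split=> //=.
    by rewrite rnormZ nc_real gtr0_norm ?invr_gt0// mulVf// gt_eqF.
  rewrite (linZ lphi) phiu -[_ *: _]/(_ * _) -rmorphM /= mulVf// gt_eqF//.
- by exists M' => a [].
- move=> a hlim.
  have aM i : nc (a i) <= M'.
    apply/ler_addgt0Pr => d d0; have [a' [[h1 _ _ _] h2]] := hlim _ d0.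
    have := ncB_le (a i) (a' i) 0; rewrite !subr0 (ncBC (a i)).
    by have := h1 i; have := h2 i; lra.
  have small (c k : R) : 0 <= k -> (forall d : R, 0 < d -> c <= k * d) -> c <= 0.
    move=> k0 h; apply/ler_addgt0Pr => d d0; rewrite add0r.
    have k1 : 0 < k + 1 by lra.
    apply: le_trans (h _ (divr_gt0 d0 k1)) _.
    by rewrite mulrCA ler_piMr ?(ltW d0)// ler_pdivrMr//; lra.
  have Bx := B0.
  have a1 : rnorm (comb (lo a)) = 1.
    apply/eqP; rewrite -subr_eq0 -normr_le0; apply: (small _ B) => // d d0.
    have [a' [[_ h1 _ _] h2]] := hlim _ d0.
    rewrite -h1 distrC mulrC; apply: le_trans (rnorm_sub_norm _ _) _.
    exact: clo.
  split=> //.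
  + move=> x; rewrite -subr_le0.
    apply: (small _ (n%:R * (M * rnorm x))).
      by rewrite !mulr_ge0 ?rnorm_ge0// ltW.
    move=> d d0; have [a' [[h0 _ h1 _] h2]] := hlim _ d0.
    have := TB (hi a) (hi a') x x d (ltW d0) (fun i => h0 _) (fun i => ltW (h2 _)).
    rewrite subrr rnorm0 mulr0 add0r mulrA => h3.
    have := ncB_le (T (hi a) x) (T (hi a') x) 0; rewrite !subr0 (ncBC (T (hi a) x)).
    by have := h1 x; lra.
  + apply/eqP; rewrite -subr_eq0; apply/eqP/nc0_eq0/eqP; rewrite eq_le nc_ge0 andbT.
    apply: (small _ (n%:R * (M * M' * B + M))).
      by rewrite mulr_ge0// addr_ge0 ?mulr_ge0// ltW.
    move=> d d0; have [a' [[h0 _ _ h1] h2]] := hlim _ d0.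
    rewrite ncBC -h1.
    apply: le_trans (TB (hi a) (hi a') _ _ d (ltW d0) (fun i => h0 _) (fun i => ltW (h2 _))) _.
    rewrite -[leRHS]mulrA; apply: ler_wpM2l => //.
    have := ler_wpM2l (mulr_ge0 (ltW M0) (ltW M'0)) (clo a a' d h2).
    by rewrite a1; lra.
- have [a1 an ab aT] := Ka.
  have cb : unit_ball V (comb (lo a)) by rewrite /unit_ball /= an.
  have n1 : (0 : R) < n%:R + 1 by rewrite ltr_wpDl.
  have k1 : 0 < 2 * ((n%:R + 1) * (M * M')) by rewrite !mulr_gt0.
  have [d d0 hd] := hQ _ cb _ (divr_gt0 e0 k1).
  pose z := rnorm (Q (comb (lo a))).
  have z0 : 0 <= z by exact: rnorm_ge0.
  have z1 : 0 < z + 1 by lra.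
  have k2 : 0 < 2 * ((n%:R + 1) * (M * (z + 1))) by rewrite !mulr_gt0//; lra.
  have B1 : 0 < B + 1 by have := B0; lra.
  exists (Num.min (d / (B + 1)) (e / (2 * ((n%:R + 1) * (M * (z + 1)))))).
    by rewrite lt_min !divr_gt0.
  move=> a' [a'1 a'n _ _] h; apply: le_trans (nc_sub_norm _ _) _.
  set d' := Num.min _ _ in h.
  have d'0 : 0 <= d' by rewrite /d' le_min !divr_ge0 ?(ltW d0) ?(ltW B1) ?(ltW e0) ?(ltW k2).
  have hQ' : rnorm (Q (comb (lo a')) - Q (comb (lo a))) <=
      e / (2 * ((n%:R + 1) * (M * M'))).
    apply: hd; first by rewrite /unit_ball /= a'n.
    apply: le_lt_trans (clo a a' d' h) _.
    apply: le_lt_trans (_ : _ <= d / (B + 1) * B) _.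
      by rewrite ler_wpM2r ?B0// /d' ge_min lexx.
    by rewrite mulrAC ltr_pdivrMr// ltr_pM2l//; lra.
  apply: le_trans (TB _ _ _ _ d' d'0 (fun i => a'1 _) (fun i => ltW (h _))) _.
  have g1 : M * M' * rnorm (Q (comb (lo a')) - Q (comb (lo a))) <=
      e / 2 / (n%:R + 1).
    apply: le_trans (ler_wpM2l _ hQ') _; first by rewrite mulr_ge0 ?(ltW M0) ?(ltW M'0).
    have -> // : M * M' * (e / (2 * ((n%:R + 1) * (M * M')))) = e / 2 / (n%:R + 1).
    by field; rewrite !(gt_eqF n1, gt_eqF M0, gt_eqF M'0).
  have g2 : M * z * d' <= e / 2 / (n%:R + 1).
    apply: le_trans (_ : _ <= M * (z + 1) * (e / (2 * ((n%:R + 1) * (M * (z + 1)))))) _.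
      apply: ler_pM => //; first by rewrite mulr_ge0// ltW.
        by rewrite ler_pM2l//; lra.
      by rewrite /d' ge_min lexx orbT.
    have -> // : M * (z + 1) * (e / (2 * ((n%:R + 1) * (M * (z + 1))))) =
        e / 2 / (n%:R + 1).
    by field; rewrite !(gt_eqF n1, gt_eqF M0, gt_eqF z1).
  apply: le_trans (ler_wpM2l _ (lerD g1 g2)) _; first by [].
  have -> : n%:R * (e / 2 / (n%:R + 1) + e / 2 / (n%:R + 1)) = e * (n%:R / (n%:R + 1)).
    by field; rewrite (gt_eqF n1).
  by apply: ler_piMr; [exact: ltW|rewrite ler_pdivrMr//; lra].
- exists (comb (lo a), T (hi a)); split; first exact: dec.
  move=> p /[dup] hp /Kenc/ha /=; rewrite loE combE hiE TE//.
  by case: hp => _ /dual_lin.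
Qed.

End Attainment.

(** * Peak perturbations *)

Section Perturbation.
Variables (R : realType) (N : nat).
Implicit Types (a d : 'I_N -> R[i]) (g : ('I_N -> R[i]) -> R).

Let sq a : R := \sum_j nc (a j) ^+ 2.

(* A concave paraboloid touches the graph of [g] from above at its maximum
   [g - C |.|^2], so that a convex [g] is differentiable there. *)
Lemma touching_paraboloid g (L eps : R) : 0 < L -> 0 < eps ->
  (forall a d, g a <= g d + L * \sum_j nc (a j - d j)) ->
  exists a C, (forall j, nc (a j) <= eps) /\
    forall d, g d - C * sq d <= g a - C * sq a.
Proof.
(* For [t > eps] the penalty [C * t ^ 2] exceeds [(N + 1) * L * t]; this forces the maximum into the
   polydisc of radius [eps]. *)
move=> L0 e0 hg; pose C := (N%:R + 1) * L / eps.
have n1 : (0 : R) < N%:R + 1 by rewrite ltr_wpDl.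
have C0 : 0 < C by rewrite divr_gt0// mulr_gt0.
pose K := [set a : 'I_N -> R[i] | forall j, nc (a j) <= eps].
have hsq a d (e : R) : 0 <= e -> (forall j, nc (a j) <= eps) ->
    (forall j, nc (d j) <= eps) -> (forall j, nc (d j - a j) <= e) ->
    `|sq d - sq a| <= N%:R * (2 * eps * e).
  move=> e00 ha hd had; rewrite /sq -sumrB; apply: le_trans (ler_norm_sum _ _ _) _.
  have -> : N%:R * (2 * eps * e) = \sum_(j < N) (2 * eps * e).
    by rewrite sumr_const card_ord mulr_natl.
  apply: ler_sum => j _; rewrite subr_sqr normrM mulrC; apply: ler_pM => //.
    by rewrite ger0_norm ?addr_ge0 ?nc_ge0//; have := ha j; have := hd j; lra.
  by apply: le_trans (nc_sub_norm _ _) _.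
have [|||a Ka e e00|a [Ka ha]] := @compact_max R N K (fun a => g a - C * sq a).
- by exists (fun=> 0) => j; rewrite nc0 ltW.
- by exists eps => a Ka j; exact: Ka.
- move=> a hlim j; apply/ler_addgt0Pr => d d0; have [a' [h1 h2]] := hlim _ d0.
  have := ncB_le (a j) (a' j) 0; rewrite !subr0 (ncBC (a j)).
  by have := h1 j; have := h2 j; lra.
- pose B := N%:R * (L + C * (2 * eps)) + 1.
  have k0 : 0 <= C * (2 * eps) by apply: mulr_ge0; [exact: ltW|lra].
  have B0 : 0 < B.
    by rewrite /B; have := mulr_ge0 (ler0n R N) (addr_ge0 (ltW L0) k0); lra.
  exists (e / B); first exact: divr_gt0.
  move=> d Kd had; have eB : 0 <= e / B by rewrite divr_ge0// ltW.
  have h1 := hsq a d _ eB Ka Kd (fun j => ltW (had j)).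
  have hs : \sum_j nc (d j - a j) <= N%:R * (e / B).
    have -> : N%:R * (e / B) = \sum_(j < N) (e / B).
      by rewrite sumr_const card_ord mulr_natl.
    by apply: ler_sum => j _; exact: ltW.
  have hs' : \sum_j nc (a j - d j) <= N%:R * (e / B).
    by under eq_bigr do rewrite ncBC.
  have g1 := hg a d; have g2 := hg d a.
  have L1 := ler_wpM2l (ltW L0) hs; have L2 := ler_wpM2l (ltW L0) hs'.
  have C1 := ler_wpM2l (ltW C0) h1.
  have : `|(g d - C * sq d) - (g a - C * sq a)| <=
      L * (N%:R * (e / B)) + C * (N%:R * (2 * eps * (e / B))).
    have -> : g d - C * sq d - (g a - C * sq a) = (g d - g a) - C * (sq d - sq a) by ring.
    apply: le_trans (ler_normB _ _) _; rewrite normrM (gtr0_norm C0) lerD//.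
    by rewrite ler_norml; apply/andP; split; lra.
  move=> /le_trans; apply.
  have -> : L * (N%:R * (e / B)) + C * (N%:R * (2 * eps * (e / B))) =
      (N%:R * (L + C * (2 * eps))) * (e / B) by ring.
  rewrite mulrCA; apply: ler_piMr; first exact: ltW.
  by rewrite ler_pdivrMr// mul1r /B lerDl.
exists a, C; split=> // d.
have [Kd|] := pselect (K d); first exact: ha.
move=> /existsNP[j0 /negP]; rewrite -ltNge => hj0.
have K0 : K (fun=> 0) by move=> j; rewrite nc0 ltW.
have sq0 : sq (fun=> 0) = 0 by rewrite /sq big1// => j _; rewrite nc0 expr0n.
apply: le_trans (ha _ K0); rewrite sq0 mulr0 subr0.
have := hg d (fun=> 0); under eq_bigr do rewrite subr0.
suff : L * \sum_j nc (d j) - C * sq d <= 0 by lra.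
rewrite /sq !mulr_sumr -sumrB (bigD1 j0)//=.
(* The right-hand side is L^2 / (4 C), the maximum of the parabola. *)
have single t : L * t - C * t ^+ 2 <= L * eps / (4 * (N%:R + 1)).
  rewrite -subr_ge0.
  have -> : L * eps / (4 * (N%:R + 1)) - (L * t - C * t ^+ 2) =
    L * eps / (4 * (N%:R + 1)) * (1 - 2 * (N%:R + 1) * t / eps) ^+ 2.
    by rewrite /C; field; rewrite !gt_eqF.
  by rewrite mulr_ge0 ?sqr_ge0// divr_ge0 ?mulr_ge0// ltW.
have s1 : \sum_(j < N | j != j0) (L * nc (d j) - C * nc (d j) ^+ 2) <=
    N%:R * (L * eps / (4 * (N%:R + 1))).
  have -> : N%:R * (L * eps / (4 * (N%:R + 1))) =
      \sum_(j < N) (L * eps / (4 * (N%:R + 1))).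
    by rewrite sumr_const card_ord mulr_natl.
  rewrite [leRHS](bigD1 j0)//= -[leLHS]add0r lerD//.
    by rewrite divr_ge0 ?mulr_ge0// ltW.
  by apply: ler_sum.
have s2 : N%:R * (L * eps / (4 * (N%:R + 1))) <= L * eps / 4.
  have -> : N%:R * (L * eps / (4 * (N%:R + 1))) = L * eps / 4 * (N%:R / (N%:R + 1)).
    by field; rewrite gt_eqF.
  apply: ler_piMr; first by rewrite divr_ge0 ?mulr_ge0// ltW.
  by rewrite ler_pdivrMr//; lra.
have N1 : (1 : R) <= N%:R.
  by rewrite ler1n; apply: leq_ltn_trans (ltn_ord j0).
(* One coordinate beyond [eps] loses at least [L * eps], while all the others together gain at most
   [L * eps / 4]. *)
have s3 : L * nc (d j0) - C * nc (d j0) ^+ 2 <= - (L * eps).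
  set t := nc (d j0) in hj0 *.
  have Ct : (N%:R + 1) * L <= C * t.
    by rewrite /C mulrAC ler_pdivlMr// ler_pM2l ?mulr_gt0// ltW.
  have t0 : 0 <= t by apply: le_trans (ltW hj0); exact: ltW.
  have := ler_wpM2r t0 Ct; have Lt : L * eps <= L * t by rewrite ler_pM2l// ltW.
  have : L * t <= N%:R * (L * t) by rewrite ler_peMl// mulr_ge0// ltW.
  have -> : C * t * t = C * t ^+ 2 by ring.
  lra.
have := mulr_gt0 L0 e0; lra.
Qed.

Lemma quadratic_bound_slope (s be D : R) :
  (forall t : R, t * s <= t * be + t ^+ 2 * D) -> s = be.
Proof.
move=> h; apply/eqP; rewrite -subr_eq0; apply: contraT => ne.
have k0 : 0 < `|D| + 1 by have := normr_ge0 D; lra.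
have := h ((s - be) / (2 * (`|D| + 1))).
set w := s - be in ne *; set k := `|D| + 1 in k0 *.
have DK : D <= k by rewrite /k; have := ler_norm D; lra.
have w2 : 0 < w ^+ 2 by rewrite exprn_even_gt0.
have -> : w / (2 * k) * s = w / (2 * k) * be + w ^+ 2 / (2 * k).
  by rewrite /w; field; rewrite gt_eqF.
rewrite lerD2l => {}h.
have : w ^+ 2 / (2 * k) <= w ^+ 2 / (4 * k).
  apply: le_trans h _.
  have -> : (w / (2 * k)) ^+ 2 * D = w ^+ 2 / (4 * k) * (D / k).
    by field; rewrite gt_eqF.
  apply: ler_piMr; first by rewrite divr_ge0 ?(ltW w2)// mulr_ge0// ltW.
  by rewrite ler_pdivrMr// mul1r.
rewrite ler_pM2l// lef_pV2 ?posrE ?mulr_gt0//; lra.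
Qed.

(** On the line through [a] in direction [d], an affine minorant and the paraboloid enclose [g] and
    meet at [a]; the slope is therefore the derivative [C * be] of the paraboloid. *)
Lemma subgradient_uniq g C a :
  (forall d, g d - C * sq d <= g a - C * sq a) ->
  forall d (s s' : R),
    (forall t : R, g a + t * s <= g (fun j => a j + t%:C%C * d j)) ->
    (forall t : R, g a + t * s' <= g (fun j => a j + t%:C%C * d j)) -> s = s'.
Proof.
move=> hmax d.
have ncsq (z : R[i]) : nc z ^+ 2 = complex.Re z ^+ 2 + complex.Im z ^+ 2.
  by apply: (@realc_inj R); rewrite [LHS]rmorphXn /= -ncE -add_Re2_Im2.
pose be := \sum_j 2 * (complex.Re (a j) * complex.Re (d j) +
                       complex.Im (a j) * complex.Im (d j)).
have sqE (t : R) : sq (fun j => a j + t%:C%C * d j) = sq a + t * be + t ^+ 2 * sq d.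
  rewrite /sq /be !mulr_sumr -!big_split; apply: eq_bigr => j _ /=.
  by rewrite !ncsq; case: (a j) => x y; case: (d j) => z w /=; ring.
have key s : (forall t : R, g a + t * s <= g (fun j => a j + t%:C%C * d j)) ->
    s = C * be.
  move=> hs; apply: (@quadratic_bound_slope _ _ (C * sq d)) => t.
  have := hs t; have := hmax (fun j => a j + t%:C%C * d j); rewrite sqE.
  lra.
by move=> s s' /key -> /key ->.
Qed.

End Perturbation.

(** * Perturbation to unique maximizers *)

Section Peaks.
Variables (R : realType) (V : normedModType R[i]) (n : nat).
Variables (b : 'I_n -> V) (xi : 'I_n -> V -> R[i]^o).
Hypothesis xi_dual : forall i, dual V (xi i).
Hypothesis xiE : forall x, x = \sum_i (xi i x : R[i]) *: b i.
Hypothesis V_neq0 : exists x : V, x <> 0.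
Implicit Types (x y : V) (phi : V -> R[i]^o) (f : V -> V).

Let span : spanned_by b.
Proof. by move=> x; exists (fun i => xi i x); exact: xiE. Qed.

Lemma Pi_set_ex : exists p, Pi_set (Y := V) p.
Proof.
have [p [hp _]] := @Pi_set_max _ _ _ _ _ xi_dual xiE id V_neq0
   (fun x _ e e0 => ex_intro2 _ _ e e0 (fun y _ h => ltW h)).
by exists p.
Qed.

Lemma Pi_set_le p v : Pi_set (Y := V) p -> nc (p.2 v) <= rnorm v.
Proof. by case=> _ /dual_lin lp np _; exact: (ball_norm1_lin lp np). Qed.

Lemma numerical_radius_le f (m : R) :
  (forall p, Pi_set p -> nc (p.2 (f p.1)) <= m) -> numerical_radius f <= m.
Proof.
move=> h; apply: ge_sup; last by move=> _ [p hp <-]; exact: h.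
by have [p hp] := Pi_set_ex; exists (nc (p.2 (f p.1))), p.
Qed.

Lemma le_numerical_radius f (m : R) :
  (forall p, Pi_set p -> nc (p.2 (f p.1)) <= m) ->
  forall p, Pi_set p -> nc (p.2 (f p.1)) <= numerical_radius f.
Proof.
move=> h p hp; apply: ub_le_sup; last by exists p.
by exists m => _ [q hq <-]; exact: h.
Qed.

(** Indices of generators of the affine maps, which [P] combines: [(None, i)] stands for the
    constant [b i], and [(Some k, i)] for the rank-one map given by [xi k] and [b i]. *)
Let I := (option 'I_n * 'I_n)%type.

Let w (j : 'I_#|{: I}|) x : V :=
  match enum_val j with (None, i) => b i | (Some k, i) => (xi k x : R[i]) *: b i end.

Let P (a : 'I_#|{: I}| -> R[i]) x := \sum_j a j *: w j x.

Let w_fpoly j : fpoly (w j).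
Proof.
rewrite /w; case: (enum_val j) => -[k|] i; last exact: fpoly_cst.
by apply: fpoly_scale => //; exact: fpoly_cst.
Qed.

Let P_delta (o : option 'I_n) i x : P (fun j => (j == enum_rank (o, i))%:R) x =
  match o with None => b i | Some k => (xi k x : R[i]) *: b i end.
Proof.
rewrite /P (bigD1 (enum_rank (o, i)))//= eqxx scale1r big1 ?addr0.
  by rewrite /w enum_rankK.
by move=> j /negPf ->; rewrite scale0r.
Qed.

Let PZ (c : R[i]) a x : P (fun j => c * a j) x = c *: P a x.
Proof. by rewrite /P scaler_sumr; apply: eq_bigr => j _; rewrite scalerA. Qed.

Let PD a d x : P (fun j => a j + d j) x = P a x + P d x.
Proof. by rewrite /P -big_split; apply: eq_bigr => j _; rewrite scalerDl. Qed.

(** Replacing [d] by [i * d] turns equality of real parts into equality. Constant maps then give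
    [phi1 = phi2], and rank-one maps in a direction [b i] with [phi1 (b i) != 0] give the
    coordinates of the points. *)
Let affine_separate phi1 phi2 y1 y2 : linear phi1 -> linear phi2 ->
  (exists u, phi1 u <> 0) ->
  (forall d, complex.Re (phi1 (P d y1)) = complex.Re (phi2 (P d y2))) ->
  phi1 = phi2 /\ y1 = y2.
Proof.
move=> l1 l2 [u u0] hRe.
have E d : phi1 (P d y1) = phi2 (P d y2).
  apply/eqP; rewrite eq_complex hRe eqxx /=; apply/eqP.
  have := hRe (fun j => 'i%C * d j); rewrite !PZ (linZ l1) (linZ l2).
  rewrite -[_ *: phi1 _]/('i%C * _) -[_ *: phi2 _]/('i%C * _) ![_ * phi1 _]mulrC
    ![_ * phi2 _]mulrC !ReiNIm.
  by move=> h; apply: oppr_inj.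
have Eb i : phi1 (b i) = phi2 (b i).
  by have := E (fun j => (j == enum_rank (None, i))%:R); rewrite !P_delta.
have phiE : phi1 = phi2.
  apply/funext => x; rewrite (dual_coordE xiE x l1) (dual_coordE xiE x l2).
  by apply: eq_bigr => i _; rewrite Eb.
split=> //.
have [i hi] : exists i, phi1 (b i) != 0.
  apply: contrapT => /forallNP h; apply: u0; rewrite (dual_coordE xiE u l1).
  by rewrite big1// => i _; have /negP/negPn/eqP -> := h i; rewrite mulr0.
rewrite (xiE y1) (xiE y2); apply: eq_bigr => k _; congr (_ *: _).
have := E (fun j => (j == enum_rank (Some k, i))%:R); rewrite !P_delta.
rewrite (linZ l1) (linZ l2) -Eb => h.
exact: (mulIf hi).
Qed.

Let P_bound : exists2 W : R, 0 < W & forall a x, unit_ball V x ->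
  rnorm (P a x) <= W * \sum_j nc (a j).
Proof.
have /choice[K hK] : forall j, exists M : R, forall x, unit_ball V x -> rnorm (w j x) <= M.
  by move=> j; have [M _ hM] := fpoly_bounded (w_fpoly j); exists M.
exists (\sum_j `|K j| + 1).
  by have : 0 <= \sum_j `|K j|; [exact: sumr_ge0|lra].
move=> a x x1; apply: le_trans (rnorm_sum _ _ _) _; rewrite mulr_sumr.
apply: ler_sum => j _; rewrite rnormZ mulrC ler_wpM2r ?nc_ge0//.
apply: le_trans (hK j x x1) _; rewrite (bigD1 j)//=.
have : 0 <= \sum_(i | i != j) `|K i| by exact: sumr_ge0.
by have := ler_norm (K j); lra.
Qed.

Lemma norm_one_functional x : exists phi, [/\ dual V phi, ball_norm phi = 1 &
  phi x = (rnorm x)%:C%C].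
Proof.
have [->|/eqP x0] := eqVneq x 0; last exact: norming_functional span x0.
have [u u0] := V_neq0; have [phi [dp np _]] := norming_functional span u0.
by exists phi; split=> //; rewrite (lin0 (dual_lin dp)) rnorm0.
Qed.

Lemma norm_one_neq0 phi : dual V phi -> ball_norm phi = 1 -> exists u, phi u <> 0.
Proof.
move=> dp np; apply: contrapT => /forallNP h.
have : ball_norm phi <= 0.
  apply: ball_norm_le => x _; have /contrapT -> := h x.
  by rewrite rnormC nc0.
by rewrite np ler10.
Qed.

Theorem peak_perturbation (Q0 : V -> V) (eps : R) : fpoly Q0 -> 0 < eps ->
  exists Q : V -> V, [/\ fpoly Q, peak_function Q, numerical_peak_function Q &
    forall x, unit_ball V x -> rnorm (Q x - Q0 x) <= eps].
Proof.
move=> fQ0 e0; have [W W0 hW] := P_bound.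
pose Q a x := Q0 x + P a x.
have fQ a : fpoly (Q a).
  apply: fpoly_add => //; apply: fpoly_sum => j.
  by apply: fpoly_cscale; exact: w_fpoly.
have Qlip a d x : unit_ball V x ->
    rnorm (Q a x) <= rnorm (Q d x) + W * \sum_j nc (a j - d j).
  move=> x1; have := hW (fun j => a j - d j) x x1.
  have -> : P (fun j => a j - d j) x = Q a x - Q d x.
    rewrite PD (_ : P (fun j => - d j) x = - P d x); last first.
      by rewrite -scaleN1r -PZ; congr P; apply/funext => j; rewrite mulN1r.
    by rewrite /Q opprD addrACA subrr add0r.
  by have := rnormD (Q a x - Q d x) (Q d x); rewrite subrK; lra.
have /choice[M hM] : forall a, exists M : R, forall x, unit_ball V x -> rnorm (Q a x) <= M.
  by move=> a; have [M _ hM] := fpoly_bounded (fQ a); exists M.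
have Pi_ball p : Pi_set (Y := V) p -> unit_ball V p.1.
  by case=> p1 _ _ _; rewrite /unit_ball /= p1.
have hMn a p : Pi_set p -> nc (p.2 (Q a p.1)) <= M a.
  by move=> hp; apply: le_trans (Pi_set_le _ hp) (hM _ _ (Pi_ball _ hp)).
pose N1 a := ball_norm (Q a); pose N2 a := numerical_radius (Q a).
have lip1 a d : N1 a <= N1 d + W * \sum_j nc (a j - d j).
  apply: ball_norm_le => x x1; apply: le_trans (Qlip a d x x1) _.
  by rewrite lerD2r; apply: le_ball_norm (hM d) _ x1.
have lip2 a d : N2 a <= N2 d + W * \sum_j nc (a j - d j).
  apply: numerical_radius_le => p hp.
  have [_ /dual_lin lp _ _] := hp.
  have -> : p.2 (Q a p.1) = p.2 (Q d p.1) + p.2 (Q a p.1 - Q d p.1).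
    by rewrite -(linD lp) addrC subrK.
  apply: le_trans (ncD _ _) _; apply: lerD.
    exact: (le_numerical_radius (hMn d)).
  apply: le_trans (Pi_set_le _ hp) _.
  have := hW (fun j => a j - d j) p.1 (Pi_ball _ hp).
  have -> // : P (fun j => a j - d j) p.1 = Q a p.1 - Q d p.1.
  rewrite PD (_ : P (fun j => - d j) p.1 = - P d p.1); last first.
    by rewrite -scaleN1r -PZ; congr P; apply/funext => j; rewrite mulN1r.
  by rewrite /Q opprD addrACA subrr add0r.
pose g a := N1 a + N2 a.
have lip a d : g a <= g d + (2 * W) * \sum_j nc (a j - d j).
  by have := lip1 a d; have := lip2 a d; rewrite /g; lra.
(* Coefficients of this size move the map by at most [eps] on the ball, since [W] times the sum of
   their moduli bounds the change. *)
have c0 : 0 < eps / (W * (#|{: I}|%:R + 1)).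
  by rewrite divr_gt0// mulr_gt0// ltr_wpDl.
have W2 : 0 < 2 * W by lra.
have [a [C [ha hmax]]] := touching_paraboloid W2 c0 lip.
have uniq := subgradient_uniq hmax.
exists (Q a).
have ReL (m t : R) (z : R[i]) :
    complex.Re (m%:C%C + t%:C%C * z) = m + t * complex.Re z.
  by case: z => u v /=; ring.
have Qt d (t : R) x : Q (fun j => a j + t%:C%C * d j) x = Q a x + t%:C%C *: P d x.
  by rewrite /Q PD PZ addrA.
(* A functional norming [Q a y] and the rotated functional [c * p.2] at [p.1] bound the two suprema
   from below by affine functions of [t], exactly at [t = 0]. Both maximizers thus enter one
   subgradient of [g]. *)
have grad phi y p c : unit_ball V y -> dual V phi -> ball_norm phi = 1 ->
    phi (Q a y) = (N1 a)%:C%C -> Pi_set p -> nc c = 1 ->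
    c * p.2 (Q a p.1) = (N2 a)%:C%C ->
    forall d t, g a + t * (complex.Re (phi (P d y)) + complex.Re (c * p.2 (P d p.1)))
      <= g (fun j => a j + t%:C%C * d j).
  move=> y1 dp np hy hp c1 hc d t; rewrite /g mulrDr addrACA; apply: lerD.
    apply: le_trans (_ : _ <= rnorm (Q (fun j => a j + t%:C%C * d j) y)) _.
      apply: le_trans (ball_norm1_lin (dual_lin dp) np _).
      apply: le_trans (Re_le _); rewrite Qt (linD (dual_lin dp)) (linZ (dual_lin dp)) hy.
      by rewrite -[_ *: phi _]/(t%:C%C * phi (P d y)) ReL.
    by apply: le_ball_norm y1; exact: hM.
  have [_ /dual_lin lp _ _] := hp.
  apply: le_trans (le_numerical_radius (hMn _) hp).
  rewrite -[leRHS]mul1r -c1 -ncM; apply: le_trans (Re_le _).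
  rewrite Qt (linD lp) (linZ lp) mulrDr hc -[_ *: p.2 _]/(t%:C%C * _) mulrCA.
  by rewrite ReL.
have [y0 [y01 hy0]] : exists y, unit_ball V y /\ rnorm (Q a y) = N1 a.
  have [|y [y1 hy]] := @ball_max _ _ _ _ _ xi_dual xiE (fun x => rnorm (Q a x)).
    move=> x x1 e e00; have [d d0 hd] := fpoly_uniform (fQ a) e00.
    exists d => // y y1 yx; apply: le_trans (rnorm_sub_norm _ _) _.
    exact: hd.
  exists y; split=> //; apply/eqP; rewrite eq_le; apply/andP; split.
    by apply: le_ball_norm y1; exact: hM.
  exact: ball_norm_le.
have [p0 [hp0 hp0N]] : exists p, Pi_set p /\ nc (p.2 (Q a p.1)) = N2 a.
  have [|p [hp hmaxp]] := @Pi_set_max _ _ _ _ _ xi_dual xiE (Q a) V_neq0.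
    move=> x x1 e e00; have [d d0 hd] := fpoly_uniform (fQ a) e00.
    by exists d => // y y1 yx; exact: hd.
  exists p; split=> //; apply/eqP; rewrite eq_le; apply/andP; split.
    exact: (le_numerical_radius (hMn a)).
  exact: numerical_radius_le.
have [f0 [df0 nf0]] := norm_one_functional (Q a y0); rewrite hy0 => hf0.
have [k0 [k01]] := phase_ex (p0.2 (Q a p0.1)); rewrite hp0N => hk0.
split=> //.
- exists y0; split=> // y [y1 hy].
  have [f [df nf]] := norm_one_functional (Q a y); rewrite hy => hf.
  have [] // := @affine_separate f0 f y0 y (dual_lin df0) (dual_lin df)
    (norm_one_neq0 df0 nf0).
  (* The numerical maximizer [p0] is kept, and its share cancels from the two slopes. *)
  move=> d; have := uniq d _ _ (grad _ _ _ _ y01 df0 nf0 hf0 hp0 k01 hk0 d)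
     (grad _ _ _ _ y1 df nf hf hp0 k01 hk0 d).
  exact: addIr.
- exists p0; split=> // p [hp hpN].
  have [k [k1]] := phase_ex (p.2 (Q a p.1)).
  have -> : nc (p.2 (Q a p.1)) = N2 a by [].
  move=> hk.
  have [_ dp0 np0 pp0] := hp0; have [_ dp np pp] := hp.
  have lk (c : R[i]) (q : V -> R[i]^o) : linear q -> linear (fun x => c * q x : R[i]^o).
    by move=> lq s x y; rewrite lq mulrDr -[s *: q x]/(s * q x) mulrCA.
  have [] := @affine_separate (fun x => k0 * p0.2 x) (fun x => k * p.2 x) p0.1 p.1
     (lk _ _ (dual_lin dp0)) (lk _ _ (dual_lin dp)).
  + exists p0.1; rewrite pp0 mulr1 => h; move: k01; rewrite h nc0; lra.
  + move=> d; have := uniq d _ _ (grad _ _ _ _ y01 df0 nf0 hf0 hp0 k01 hk0 d)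
     (grad _ _ _ _ y01 df0 nf0 hf0 hp k1 hk d).
    exact: addrI.
  + move=> hphi h1.
    (* Both functionals are 1 at the common point, so the phases agree and then the functionals
       themselves. *)
    have kk : k0 = k.
      by have := congr1 (@^~ p0.1) hphi; rewrite /= pp0 h1 pp !mulr1.
    have k00 : k != 0 by apply/eqP => h; move: k1; rewrite h nc0; lra.
    rewrite [p0]surjective_pairing [p]surjective_pairing h1; congr (_, _).
    apply/funext => x; have := congr1 (@^~ x) hphi; rewrite /= kk.
    exact: (mulfI k00).
- move=> x x1; rewrite /Q addrAC subrr add0r; apply: le_trans (hW a x x1) _.
  rewrite mulrC -ler_pdivlMr//.
  apply: le_trans (_ : _ <= \sum_(j < #|{: I}|) eps / (W * (#|{: I}|%:R + 1))) _.
    by apply: ler_sum => j _; exact: ha.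
  have m1 : (0 : R) < #|{: I}|%:R + 1 by rewrite ltr_wpDl.
  have -> : \sum_(j < #|{: I}|) eps / (W * (#|{: I}|%:R + 1)) =
      eps / W * (#|{: I}|%:R / (#|{: I}|%:R + 1)).
    rewrite sumr_const card_ord -[LHS]mulr_natl.
    by field; rewrite !(gt_eqF m1, gt_eqF W0).
  apply: ler_piMr; first by rewrite divr_ge0// ltW.
  by rewrite ler_pdivrMr ?ltr_wpDl//; lra.
Qed.

End Peaks.

(** * Polynomials with finite-dimensional range *)

Section FpolyPolynomials.
Variables (R : realType) (X : normedModType R[i]).
Implicit Types (P Q : X -> X).

Lemma ptws_continuous k (T : topologicalType) (f : T -> {ptws 'I_k -> X}) :
  (forall i, continuous (fun t => f t i)) -> continuous f.
Proof.
move=> h t; apply/cvg_sup => i U.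
have -> := @nbhsE (initial_topology (fun g : 'I_k -> X => g i)) (f t).
case=> B [[C oC <-] Ct] /filterS; apply.
by apply: (h i t); apply: open_nbhs_nbhs; split.
Qed.

Lemma homogeneous0 k : homogeneous_polynomial k (fun=> 0 : X).
Proof.
exists (fun=> 0); split=> // [u i a x y|]; first by rewrite scaler0 addr0.
exact: cst_continuous.
Qed.

Lemma homogeneousD k P Q : homogeneous_polynomial k P -> homogeneous_polynomial k Q ->
  homogeneous_polynomial k (fun x => P x + Q x).
Proof.
move=> [A [mA cA hA]] [B [mB cB hB]]; exists (fun u => A u + B u); split.
- by move=> u i a x y; rewrite mA mB scalerDr addrACA.
- move=> u; have := cvgD (cA u) (cB u); exact.
- by move=> x; rewrite hA hB.
Qed.

(** The functional acts on a new first slot; [multilinear] asks for no symmetry. *)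
Lemma homogeneous_scale k phi P : dual X phi -> homogeneous_polynomial k P ->
  homogeneous_polynomial k.+1 (fun x => (phi x : R[i]) *: P x).
Proof.
move=> [lp cp] [A [mA cA hA]].
exists (fun u => (phi (u ord0) : R[i]) *: A (fun i => u (lift ord0 i))); split.
- move=> u i a x y; have [j ->|->] := unliftP ord0 i.
    have E v : (fun l => dfwith u (lift ord0 j) v (lift ord0 l)) =
        dfwith (fun l => u (lift ord0 l)) j v.
      apply/funext => l; have [->|lj] := eqVneq l j; first by rewrite !dfwithin.
      by rewrite !dfwithout 1?eq_sym// (inj_eq lift_inj).
    rewrite !E mA !dfwithout ?neq_lift// scalerDr !scalerA mulrC//.
  have E v : (fun l => dfwith u ord0 v (lift ord0 l)) = (fun l => u (lift ord0 l)).
    by apply/funext => l; rewrite dfwithout// neq_lift.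
  by rewrite !E !dfwithin lp scalerDl scalerA.
- have c1 : continuous ((fun v => phi (v ord0)) : {ptws 'I_k.+1 -> X} -> R[i]^o).
    move=> u; apply: (@continuous_comp {ptws 'I_k.+1 -> X} _ _ (fun v => v ord0) phi).
      exact: (@proj_continuous _ (fun=> X) ord0).
    exact: cp.
  have c2 : continuous ((fun v => A (fun i => v (lift ord0 i))) :
      {ptws 'I_k.+1 -> X} -> X).
    move=> u; apply: (@continuous_comp {ptws 'I_k.+1 -> X} {ptws 'I_k -> X} _
      (fun v i => v (lift ord0 i)) A); last exact: cA.
    apply: ptws_continuous => i; exact: (@proj_continuous _ (fun=> X) (lift ord0 i)).
  move=> u; have := cvgZ (c1 u) (c2 u); exact.
- by move=> x; rewrite hA.
Qed.

Lemma fpoly_polynomials P : fpoly P -> polynomials X P.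
Proof.
move=> fP; suff [n [F [hF E]]] : exists n (F : nat -> X -> X),
    (forall k, homogeneous_polynomial k (F k)) /\ forall x, P x = \sum_(k < n) F k x.
  by exists n, (fun k => F k).
elim: fP => [w|P1 Q1 _ [n [F [hF EF]]] _ [m [G [hG EG]]]|phi P1 dphi _ [n [F [hF EF]]]].
- exists 1%N, (fun k => if k is 0%N then fun=> w else fun=> 0); split=> [[|k]|x].
  + exists (fun=> w); split=> // [u []//|]; exact: cst_continuous.
  + exact: homogeneous0.
  + by rewrite big_ord1.
- exists (n + m)%N, (fun k x => (if (k < n)%N then F k else fun=> 0) x +
      (if (k < m)%N then G k else fun=> 0) x); split=> [k|x].
    by apply: homogeneousD; case: ifP => _ //; exact: homogeneous0.
  rewrite big_split /= EF EG; congr (_ + _).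
    rewrite big_split_ord /= [X in _ = _ + X]big1 ?addr0.
      by apply: eq_bigr => i _; rewrite ltn_ord.
    by move=> i _; rewrite ltnNge leq_addr.
  rewrite addnC big_split_ord /= [X in _ = _ + X]big1 ?addr0.
    by apply: eq_bigr => i _; rewrite ltn_ord.
  by move=> i _; rewrite ltnNge leq_addr.
- exists n.+1, (fun k => if k is l.+1 then fun x => (phi x : R[i]) *: F l x else fun=> 0).
  split=> [[|k]|x]; first exact: homogeneous0.
    exact: homogeneous_scale.
  by rewrite big_ord_recl add0r EF scaler_sumr.
Qed.

(* Expand a multilinear map along a finite-rank map, one slot at a time. *)
Lemma multilinear_fpoly k (A : ('I_k -> X) -> X) n (eta : 'I_n -> X -> R[i]^o)
    (c : 'I_n -> X) : multilinear A -> (forall i, dual X (eta i)) ->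
  fpoly (fun x => A (fun=> \sum_i (eta i x : R[i]) *: c i)).
Proof.
move=> mA deta; pose L x := \sum_i (eta i x : R[i]) *: c i.
have step m : (m <= k)%N -> forall u : 'I_k -> X,
    fpoly (fun x => A (fun j => if (j < m)%N then L x else u j)).
  elim: m => [_ u|m ih mk u]; first by apply: (@fpoly_cst _ _ _ (A u)).
  pose j0 := Ordinal mk.
  have E x : A (fun j => if (j < m.+1)%N then L x else u j) =
      \sum_i (eta i x : R[i]) *:
        A (fun j => if (j < m)%N then L x else dfwith u j0 (c i) j).
    pose v := fun j : 'I_k => if (j < m)%N then L x else u j.
    have -> : (fun j : 'I_k => if (j < m.+1)%N then L x else u j) = dfwith v j0 (L x).
      apply/funext => j; have [->|jj0] := eqVneq j j0.
        by rewrite dfwithin /= ltnSn.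
      rewrite dfwithout 1?eq_sym// /v ltnS leq_eqVlt.
      suff -> : (nat_of_ord j == m) = false by [].
      by apply/negP => /eqP h; move/eqP: jj0; apply; exact: val_inj.
    rewrite (lin_sum (mA v j0)); apply: eq_bigr => i _.
    rewrite (linZ (mA v j0)); congr (_ *: A _); apply/funext => j.
    have [->|jj0] := eqVneq j j0; first by rewrite !dfwithin /= ltnn.
    by rewrite !dfwithout 1?eq_sym.
  under eq_fun do rewrite E.
  by apply: fpoly_sum => i; apply: fpoly_scale => //; apply: ih; exact: ltnW.
have := step k (leqnn k) (fun=> 0).
have -> // : (fun x => A (fun j : 'I_k => if (j < k)%N then L x else 0)) =
  (fun x => A (fun=> L x)).
by apply/funext => x; congr A; apply/funext => j; rewrite ltn_ord.
Qed.

Lemma fpoly_A_wu Q : fpoly Q -> A_wu X Q.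
Proof.
move=> fQ; split.
- have [M M0 hM] := fpoly_bounded fQ; exists M%:C%C; split.
    by rewrite ger0_real// -[0]/(0%:C%C) lecr ltW.
  move=> M' hM' x x1; apply: le_trans (ltW hM').
  by rewrite rnormE lecr; exact: hM.
- move=> e e0; have e20 : 0 < e / 2 by lra.
  have [d d0 hd] := fpoly_uniform fQ e20; exists d => // x y x1 y1 xy.
  by have := hd x y x1 y1 xy; lra.
- by move=> x _; exact: fpoly_differentiable.
- have [n [psi [dpsi h]]] := fpoly_weakly_uniform fQ.
  move=> e e0; have e20 : 0 < e / 2 by lra.
  have [d d0 hd] := h _ e20; exists n, psi, d; split=> // x y x1 y1 xy.
  by have := hd x y x1 y1 xy; lra.
Qed.

End FpolyPolynomials.

(** * Polynomials factoring through a norm-one projection *)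

Section Subspace.
Variables (R : realType) (X : normedModType R[i]) (F : submodClosed X).

Lemma rnorm_val (y : subspace_of F) : rnorm (val y) = rnorm y.
Proof. by []. Qed.

Lemma val_linear : linear (val : subspace_of F -> X).
Proof. by move=> a x y; rewrite linearP. Qed.

Lemma subspace_spanned : finite_dimensional F ->
  exists n (b : 'I_n -> subspace_of F), spanned_by b.
Proof.
move=> [n [e he]].
have eF i : e i \in F.
  apply/he; exists (fun j => (j == i)%:R); rewrite (bigD1 i)//= eqxx scale1r big1 ?addr0//.
  by move=> j /negPf ->; rewrite scale0r.
exists n, (fun i => Sub (e i) (eF i)) => x.
have [a ha] := (he (val x)).1 (valP x); exists a.
apply: val_inj; rewrite ha (lin_sum val_linear); apply: eq_bigr => i _.
by rewrite (linZ val_linear) SubK.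
Qed.

Variable pi : X -> subspace_of F.
Hypothesis hpi : norm_one_projection pi.

Lemma proj_linear : linear pi. Proof. by case: hpi. Qed.

Lemma proj_le x : rnorm (pi x) <= rnorm x.
Proof. by case: hpi => l _ n; exact: ball_norm1_lin. Qed.

Lemma proj_continuous1 : continuous pi.
Proof.
by apply: (bounded_lin_continuous proj_linear (M := 1)) => y; rewrite mul1r proj_le.
Qed.

Lemma projK y : pi (val y) = y. Proof. by case: hpi. Qed.

Lemma proj_neq0 : exists y : subspace_of F, y <> 0.
Proof.
apply: contrapT => /forallNP h; case: hpi => _ _ n1.
have : ball_norm pi <= 0.
  by apply: ball_norm_le => x _; have /contrapT -> := h (pi x); rewrite rnorm0.
by rewrite n1 ler10.
Qed.

(** A continuous polynomial need not be weakly uniformly continuous on the ball. The identity with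
    [pi] makes [Q] depend only on finitely many functionals, and then it is of finite type. *)
Lemma polynomial_fpoly Q : finite_dimensional F -> polynomials X Q ->
  (forall x, val (pi (Q (val (pi x)))) = Q x) -> fpoly Q.
Proof.
move=> /subspace_spanned/coordinates_ex[n [b [xi [dxi xiE]]]] [m [P [hP QE]]] hQ.
have QpE x : Q x = Q (val (pi x)) by rewrite -hQ -[in RHS]hQ projK.
have -> : Q = (fun x => \sum_(k < m) P k (val (pi x))).
  by apply/funext => x; rewrite QpE QE.
apply: fpoly_sum => k; have [A [mA _ PA]] := hP k.
have -> : (fun x => P k (val (pi x))) = (fun x =>
    A (fun=> \sum_i ((xi i \o pi) x : R[i]) *: val (b i))).
  apply/funext => x; rewrite PA; congr A; apply/funext => _.
  rewrite {1}(xiE (pi x)) (lin_sum val_linear); apply: eq_bigr => i _.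
  by rewrite (linZ val_linear).
apply: multilinear_fpoly => // i.
exact: (dual_comp proj_linear proj_continuous1 (dxi i)).
Qed.

End Subspace.

(** * Density *)

Section Density.
Variables (R : realType) (X : normedModType R[i]).
Implicit Types (f : X -> X) (e d : R).

Definition approximating_projections :=
  forall n (phi : 'I_n -> X -> R[i]^o) m (y : 'I_m -> X) (d : R),
    (forall i, dual X (phi i)) -> 0 < d ->
    exists (F : submodClosed X) (pi : X -> subspace_of F),
      [/\ finite_dimensional F, norm_one_projection pi,
        forall i x, unit_ball X x -> nc (phi i (x - val (pi x))) <= d &
        forall j, rnorm (y j - val (pi (y j))) <= d].

(** The functionals send the ball into a bounded part of C^n, which finitely many boxes cover; a
    point of the ball is chosen over each box that is met. *)
Lemma weak_net n (phi : 'I_n -> X -> R[i]^o) d : (forall i, dual X (phi i)) ->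
  0 < d -> exists m (x : 'I_m -> X), (forall j, unit_ball X (x j)) /\
    forall z, unit_ball X z -> exists j, forall i, nc (phi i (z - x j)) < d.
Proof.
move=> dphi d0.
have [M M0 hM] : exists2 M : R, 0 < M & forall i x, unit_ball X x -> nc (phi i x) <= M.
  have /choice[K hK] : forall i, exists M : R, forall x, nc (phi i x) <= M * rnorm x.
    by move=> i; have [M _ hM] := dual_bound (dphi i); exists M.
  exists (\sum_i `|K i| + 1).
    by have : 0 <= \sum_i `|K i|; [exact: sumr_ge0|lra].
  move=> i x x1; apply: le_trans (hK i x) _.
  have h0 : 0 <= \sum_(j < n | j != i) `|K j| by exact: sumr_ge0.
  have hr : K i * rnorm x <= `|K i|.
    apply: le_trans (_ : _ <= `|K i| * rnorm x) _; last by rewrite ler_piMr.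
    by rewrite ler_wpM2r ?rnorm_ge0 ?ler_norm.
  by rewrite (bigD1 i)//=; lra.
(* Real and imaginary parts are cut into intervals of this length, so that two values in one box
   differ by less than [d]. *)
pose s := d / 2; have s0 : 0 < s by rewrite /s; lra.
pose N := (Num.truncn (2 * M / s)).+1.
pose cell (t : R) : 'I_N := inord (Num.truncn ((t + M) / s)).
have cellP t t' : `|t| <= M -> `|t'| <= M -> cell t = cell t' -> `|t - t'| < s.
  have aux r : `|r| <= M -> let k := Num.truncn ((r + M) / s) in
      cell r = k :> nat /\ k%:R * s <= r + M < k.+1%:R * s.
    rewrite ler_norml => /andP[r1 r2] k.
    have r0 : 0 <= (r + M) / s by rewrite divr_ge0 ?(ltW s0)//; lra.
    have /andP[k1 k2] := truncn_itv r0.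
    split; last by rewrite -ler_pdivlMr// k1 -ltr_pdivrMr.
    rewrite /cell inordK// ltnS; apply: le_truncn.
    by rewrite ler_pM2r ?invr_gt0//; lra.
  move=> /aux[E /andP[a1 a2]] /aux[E' /andP[b1 b2]] /(congr1 (@nat_of_ord N)).
  rewrite E E' => kk; rewrite -kk in b1 b2.
  move: (Num.truncn _) a1 a2 b1 b2 => k; rewrite -natr1 => a1 a2 b1 b2.
  by rewrite ltr_norml; lra.
pose code x : {ffun 'I_n -> 'I_N * 'I_N} :=
  [ffun i => (cell (complex.Re (phi i x)), cell (complex.Im (phi i x)))].
have /choice[p hp] : forall c : {ffun 'I_n -> 'I_N * 'I_N}, exists x,
    unit_ball X x /\ ((exists z, unit_ball X z /\ code z = c) -> code x = c).
  move=> c; have [[z [z1 zc]]|nz] := pselect (exists z, unit_ball X z /\ code z = c).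
    by exists z.
  by exists 0; split=> //; exact: unit_ball0.
exists #|{: {ffun 'I_n -> 'I_N * 'I_N}}|, (fun j => p (enum_val j)); split.
  by move=> j; have [] := hp (enum_val j).
move=> z z1; exists (enum_rank (code z)) => i; rewrite enum_rankK.
have [x1 xc] := hp (code z); set x := p _ in x1 xc *.
have /ffunP/(_ i) : code x = code z by apply: xc; exists z.
rewrite !ffunE => -[/esym cR /esym cI].
rewrite (linB (dual_lin (dphi i))).
have bz := hM i z z1; have bx := hM i x x1.
have hR := cellP _ _ (le_trans (normRe_le _) bz) (le_trans (normRe_le _) bx) cR.
have hI := cellP _ _ (le_trans (normIm_le _) bz) (le_trans (normIm_le _) bx) cI.
apply: le_lt_trans (nc_le_ReIm _) _; rewrite !raddfB /=.
by rewrite /s in hR hI; lra.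
Qed.

Lemma affine_line_differentiable (u v : X) (z : R[i]) :
  differentiable (fun w : R[i]^o => u + (w : R[i]) *: v) (z : R[i]^o).
Proof.
apply: differentiableD; first exact: differentiable_cst.
exact: (@differentiableZl _ R[i]^o X (fun w => w)).
Qed.

Lemma dual_differentiable (phi : X -> R[i]^o) x : dual X phi -> differentiable phi x.
Proof.
case=> lp cp; pose L : {linear X -> R[i]^o} := HB.pack phi
    (GRing.isLinear.Build _ _ _ _ phi lp).
exact: (@linear_differentiable _ _ _ L).
Qed.

Theorem density_of_peak_polynomials : approximating_projections ->
  dense_in (peak_numerical_peak_polynomials X) (A_wu X).
Proof.
move=> hproj; split.
  move=> Q [pQ [F [pi [fF npi hQ _ _]]]].
  apply: fpoly_A_wu; exact: (polynomial_fpoly npi).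
move=> f [bf ucf df wf] eps eps0.
(* The total error will be [7 * e]: one for [f \o pi], three for projecting the values of [f], and
   one each for the dilation, the polynomial and the peak perturbation. *)
pose e := eps / 10; have e0 : 0 < e by rewrite /e; lra.
have [n [phi [delta [dphi delta0 hw]]]] := wf e e0.
have [m [x [x1 hx]]] := weak_net dphi delta0.
pose d := Num.min (delta / 2) e.
have d0 : 0 < d by rewrite lt_min e0 andbT; lra.
have dd : d <= delta / 2 by rewrite ge_min lexx.
have de : d <= e by rewrite ge_min lexx orbT.
(* Every value of [f] on the ball is within [e] of some [f (x j)]; it is enough that [pi] nearly
   fixes these finitely many values. *)
have [F [pi [fF npi hphi hy]]] := hproj _ phi _ (fun j => f (x j)) d dphi d0.
have lpi := proj_linear npi.
have ple := proj_le npi; have pK := projK npi.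
have pball z : unit_ball X z -> unit_ball X (val (pi z)).
  by move=> z1; rewrite /unit_ball /= rnorm_val; apply: le_trans (ple z) z1.
have step1 z : unit_ball X z -> rnorm (f z - f (val (pi z))) < e.
  move=> z1; apply: hw => //; first exact: pball.
  by move=> i; rewrite rnormC; apply: le_lt_trans (hphi i z z1) _; lra.
have step2 z : unit_ball X z -> rnorm (f z - val (pi (f z))) <= 3 * e.
  move=> z1; have [j hj] := hx z z1.
  have h1 : rnorm (f z - f (x j)) < e by apply: hw.
  have h2 := hy j.
  have h3 : rnorm (val (pi (f (x j))) - val (pi (f z))) < e.
    rewrite -(linB (@val_linear _ _ F)) -(linB lpi) rnorm_val.
    by apply: le_lt_trans (ple _) _; rewrite rnormBC.
  have := rnormB_le (f z) (f (x j)) (val (pi (f z))).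
  by have := rnormB_le (f (x j)) (val (pi (f (x j)))) (val (pi (f z))); lra.
have [d1 d10 hd1] := ucf e e0.
(* The dilation by [s] takes the closed ball into the open one, where [f] is differentiable, and
   moves its points by at most [d1 / 2]. *)
pose s := 1 - Num.min (1 / 2) (d1 / 2).
have sm : 0 < Num.min (1 / 2) (d1 / 2) by rewrite lt_min; lra.
have sm1 : Num.min (1 / 2) (d1 / 2) <= 1 / 2 by rewrite ge_min lexx.
have sm2 : Num.min (1 / 2) (d1 / 2) <= d1 / 2 by rewrite ge_min lexx orbT.
have s0 : 0 < s by rewrite /s; lra.
have s1 : s < 1 by rewrite /s; lra.
have sball z : unit_ball X z -> rnorm (s%:C%C *: z) <= s.
  by move=> z1; rewrite rnormZ nc_real gtr0_norm// ler_piMr// ltW.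
have sball1 z : unit_ball X z -> unit_ball X (s%:C%C *: z).
  by move=> /sball h; apply: le_trans h (ltW s1).
have [k [b [xi [dxi xiE]]]] := coordinates_ex (subspace_spanned fF).
pose G (y : subspace_of F) := pi (f (s%:C%C *: val y)).
have vball (y : subspace_of F) : unit_ball _ y -> unit_ball X (val y) by [].
have [K K0 hK] := coord_bound dxi.
have [Mf Mf0 hMf] : exists2 M : R, 0 < M & forall z, unit_ball X z -> rnorm (f z) <= M.
  have [M0 [M0r hM0]] := bf; pose M := `|complex.Re M0| + 1.
  exists M; first by rewrite /M; have := normr_ge0 (complex.Re M0); lra.
  move=> z z1; rewrite -lecr -rnormE; apply: hM0 => //.
  rewrite -(RRe_real M0r) ltcr /M; have := ler_norm (complex.Re M0); lra.
have approx i e1 : 0 < e1 -> exists p : subspace_of F -> R[i]^o, fpoly p /\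
    forall y, rnorm y <= 1 -> nc (xi i (G y) - p y) <= e1.
  apply: (@fpoly_approx R _ (fun y => xi i (G y)) (K * Mf) _ _ _ k b xi) => //.
  - move=> y y1; apply: le_trans (hK i _) _; rewrite ler_pM2l//.
    by apply: le_trans (ple _) _; apply: hMf; apply: sball1; exact: vball.
  - move=> e2 e20; have [d2 d20 hd2] := ucf (e2 / K) (divr_gt0 e20 K0).
    exists d2 => // y z y1 z1 yz; rewrite -(linB (dual_lin (dxi i))).
    apply: le_trans (hK i _) _; rewrite -ler_pdivlMl// mulrC -(linB lpi).
    apply: le_trans (ple _) _; apply: ltW; apply: hd2; try by apply: sball1; exact: vball.
    rewrite -scalerBr rnormZ nc_real gtr0_norm// -(linB (@val_linear _ _ F)) rnorm_val.
    by apply: le_lt_trans yz; rewrite ler_piMl ?rnorm_ge0// ltW.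
  - move=> y v z yz; rewrite /hol; apply: diff_derivable.
    have E : (fun w => xi i (G (y + w *: v))) = (xi i \o pi) \o (f \o
       (fun w => s%:C%C *: val y + w *: (s%:C%C *: val v))).
      apply/funext => w /=; rewrite /G (linD (@val_linear _ _ F)).
      by rewrite (linZ (@val_linear _ _ F)) scalerDr !scalerA mulrC.
    rewrite E; apply: differentiable_comp; last first.
      apply: dual_differentiable.
      exact: (dual_comp lpi (proj_continuous1 npi) (dxi i)).
    apply: differentiable_comp; first exact: affine_line_differentiable.
    apply: df; apply: le_lt_trans s1.
    have -> : s%:C%C *: val y + z *: (s%:C%C *: val v) =
        s%:C%C *: val (y + z *: v).
      rewrite (linD (@val_linear _ _ F)) (linZ (@val_linear _ _ F)) scalerDr.
      by rewrite !scalerA mulrC.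
    exact: sball.
pose B := \sum_i rnorm (b i).
have B0 : 0 <= B by apply: sumr_ge0 => i _; exact: rnorm_ge0.
have eB : 0 < e / (B + 1) by rewrite divr_gt0//; lra.
have /choice[p hp] := fun i => approx i _ eB.
pose Q0 (y : subspace_of F) := \sum_i (p i y : R[i]) *: b i.
have fQ0 : fpoly Q0.
  by apply: fpoly_sum => i; apply: fpoly_vector; have [] := hp i.
have step3 y : unit_ball _ y -> rnorm (G y - Q0 y) <= e.
  move=> y1; rewrite {1}(xiE (G y)) -sumrB; apply: le_trans (rnorm_sum _ _ _) _.
  apply: le_trans (_ : _ <= e / (B + 1) * B) _.
    rewrite mulr_sumr; apply: ler_sum => i _; rewrite -scalerBl rnormZ.
    by rewrite ler_wpM2r ?rnorm_ge0//; have [_ h] := hp i; exact: h.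
  by rewrite mulrAC -mulrA ler_piMr ?(ltW e0)// ler_pdivrMr; lra.
have [Q [fQ pQ nQ hQ]] := peak_perturbation dxi xiE (proj_neq0 npi) fQ0 e0.
pose Qf z := val (Q (pi z)).
have resQ : restrict_to (F := F) Qf = Q.
  by apply/funext => y; rewrite /restrict_to /Qf pK valKd.
exists Qf.
  split.
    apply: fpoly_polynomials.
    have fQpi := fpoly_comp_lin lpi (proj_continuous1 npi) fQ.
    exact: (lin_comp_fpoly (@val_linear _ _ F) fQpi).
  exists F, pi; split=> //; rewrite ?resQ//.
  by move=> z; rewrite /Qf !pK.
apply: (@le_lt_trans _ _ (7 * e)); last by rewrite /e; lra.
apply: ball_norm_le => z z1.
rewrite -[(f - Qf) z]/(f z - Qf z).
have z1' := pball z z1.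
have h1 := step1 z z1; have h2 := step2 _ z1'.
have h3 : rnorm (val (pi (f (val (pi z)))) - val (G (pi z))) <= e.
  rewrite -(linB (@val_linear _ _ F)) rnorm_val -(linB lpi).
  apply: le_trans (ple _) _; apply: ltW; apply: hd1 => //; first exact: sball1.
  rewrite -[X in X - _]scale1r -scalerBl rnormZ.
  have subC (r : R) : 1 - r%:C%C = (1 - r)%:C%C :> R[i] by rewrite rmorphB rmorph1.
  rewrite subC.
  rewrite nc_real ger0_norm; last lra.
  apply: (@le_lt_trans _ _ (d1 / 2)); last lra.
  by move: z1'; rewrite /unit_ball /= => z1'; have := rnorm_ge0 (val (pi z)); rewrite /s; nra.
have pz1 : unit_ball (subspace_of F) (pi z) by apply: le_trans (ple z) z1.
have h4 : rnorm (val (G (pi z)) - val (Q0 (pi z))) <= e.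
  by rewrite -(linB (@val_linear _ _ F)) rnorm_val; exact: step3.
have h5 : rnorm (val (Q0 (pi z)) - Qf z) <= e.
  by rewrite -(linB (@val_linear _ _ F)) rnorm_val rnormBC; exact: hQ.
have := rnormB_le (f z) (f (val (pi z))) (Qf z).
have := rnormB_le (f (val (pi z))) (val (pi (f (val (pi z))))) (Qf z).
have := rnormB_le (val (pi (f (val (pi z))))) (val (G (pi z))) (Qf z).
have := rnormB_le (val (G (pi z))) (val (Q0 (pi z))) (Qf z).
lra.
Qed.

End Density.

(** * Finite-dimensional decompositions *)

Section Idempotent.
Variables (R : realType) (X : normedModType R[i]).

Lemma projection_of_idempotent (P : X -> X) n (e : 'I_n -> X) :
  linear P -> (forall x, P (P x) = P x) -> ball_norm P = 1 ->
  (forall x, P x = x <-> exists a : 'I_n -> R[i], x = \sum_i a i *: e i) ->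
  exists (F : submodClosed X) (pi : X -> subspace_of F),
    [/\ finite_dimensional F, norm_one_projection pi & forall x, val (pi x) = P x].
Proof.
move=> lP PP P1 hF.
have [F FP] : exists F : submodClosed X, forall x, x \in F <-> P x = x.
  pose F0 : {pred X} := fun x => `[< P x = x >].
  have F0P x : reflect (P x = x) (x \in F0) by exact: asboolP.
  have F0sub : submod_closed F0.
    split; first by apply/F0P; exact: (lin0 lP).
    by move=> a x y /F0P hx /F0P hy; apply/F0P; rewrite lP hx hy.
  pose F : submodClosed X := HB.pack F0 (GRing.isSubmodClosed.Build _ _ F0 F0sub).
  by exists F => x; split => /F0P.
have PF x : P x \in F by apply/FP.
have [pi vpi] : exists pi : X -> subspace_of F, forall x, val (pi x) = P x.
  by exists (fun x => Sub (P x) (PF x)) => x; rewrite SubK.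
exists F, pi; split=> //; first by exists n, e => x; split=> [/FP/hF|/hF/FP].
split.
- by move=> a x y; apply: val_inj; rewrite vpi lP val_linear !vpi.
- by move=> y; apply: val_inj; rewrite vpi; apply/FP/(valP y).
- rewrite -P1; congr sup; apply/seteqP.
  by split=> _ [x x1 <-]; exists x => //; rewrite -rnorm_val vpi.
Qed.

End Idempotent.

Section Decomposition.
Variables (R : realType) (X : normedModType R[i]).
Variables (E : nat -> submodClosed X) (c : nat -> X -> X).
Hypothesis hE : fd_decomposition E c.

Lemma component_in n x : c n x \in E n.
Proof. by have [_ /(_ x)[]] := hE. Qed.

Lemma component_uniq (u : nat -> X) x : (forall n, u n \in E n) ->
  series u @ \oo --> x -> forall n, c n x = u n.
Proof. by have [_ /(_ x)[_ _ h]] := hE => hu /(h u hu) ->. Qed.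

(** The combined sequence of components represents the combined vector, and representations are
    unique. *)
Lemma component_linear n : linear (c n).
Proof.
move=> a x y; apply: (@component_uniq (fun n => a *: c n x + c n y)).
  by move=> k; rewrite rpredD ?rpredZ// component_in.
have [_ h] := hE; have [_ cx _] := h x; have [_ cy _] := h y.
rewrite (_ : series _ = fun k => a *: series (c^~ x) k + series (c^~ y) k).
  by have := cvgD (@cvgZl_tmp _ _ _ _ _ a _ _ cx) cy; exact.
apply/funext => k; rewrite /series /= big_split /= scaler_sumr.
by [].
Qed.

Lemma proj_of_sum m (z : nat -> X) : (forall i, z i \in E i) ->
  decomposition_proj c m (\sum_(i < m.+1) z i) = \sum_(i < m.+1) z i.
Proof.
move=> hz; pose u k := if (k < m.+1)%N then z k else 0.
apply: eq_bigr => i _; rewrite (@component_uniq u) /u ?ltn_ord//.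
  by move=> k; case: ifP => _ //; exact: rpred0.
apply: cvg_near_cst; exists m.+1 => // k /= mk.
rewrite /series /= (big_cat_nat (leq0n m.+1) mk)/= [X in _ + X](_ : _ = 0) ?addr0.
  by rewrite big_mkord; apply: eq_bigr => j _; rewrite ltn_ord.
by rewrite big_nat_cond big1// => j /andP[/andP[mj _] _]; rewrite ltnNge mj.
Qed.

Lemma partial_sums_spanned m : exists n (e : 'I_n -> X), forall x : X,
  (exists z : nat -> X, (forall i, z i \in E i) /\ x = \sum_(i < m) z i) <->
  exists a : 'I_n -> R[i], x = \sum_i a i *: e i.
Proof.
elim: m => [|m [n [e he]]].
  exists 0%N, (fun=> 0) => x; split=> [[z [_ ->]]|[a ->]].
    by exists (fun=> 0); rewrite !big_ord0.
  by exists (fun=> 0); split=> [i|]; rewrite ?big_ord0// rpred0.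
have [/(_ m)[k [f hf]] _] := hE.
exists (n + k)%N, (fun i => match fintype.split i with inl j => e j | inr j => f j end).
have sumE (a : 'I_(n + k) -> R[i]) : \sum_i a i *:
    (match fintype.split i with inl j => e j | inr j => f j end) =
    \sum_i a (lshift k i) *: e i + \sum_i a (rshift n i) *: f i.
  rewrite big_split_ord /=; congr (_ + _); apply: eq_bigr => i _.
    by rewrite (unsplitK (inl i : 'I_n + 'I_k)).
  by rewrite (unsplitK (inr i : 'I_n + 'I_k)).
move=> x; split=> [[z [hz ->]]|[a ->]].
  have [a ha] : exists a : 'I_n -> R[i], \sum_(i < m) z i = \sum_i a i *: e i.
    by apply/he; exists z.
  have [a' ha'] := (hf (z m)).1 (hz m).
  exists (fun i => match fintype.split i with inl j => a j | inr j => a' j end).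
  rewrite sumE big_ord_recr /= ha ha'; congr (_ + _); apply: eq_bigr => i _.
    by rewrite (unsplitK (inl i : 'I_n + 'I_k)).
  by rewrite (unsplitK (inr i : 'I_n + 'I_k)).
rewrite sumE.
have [z [hz zE]] : exists z : nat -> X, (forall i, z i \in E i) /\
    \sum_i a (lshift k i) *: e i = \sum_(i < m) z i.
  by apply/he; exists (fun i => a (lshift k i)).
exists (fun i => if i == m then \sum_i a (rshift n i) *: f i else z i); split=> [i|].
  by case: eqP => [->|_] //; apply/hf; exists (fun i => a (rshift n i)).
rewrite big_ord_recr /= eqxx zE; congr (_ + _); apply: eq_bigr => i _.
by rewrite ltn_eqF.
Qed.

Hypothesis c_monotone : Defs.monotone c.

Let P := decomposition_proj c.

Lemma decomposition_proj_linear m : linear (P m).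
Proof.
move=> a x y; rewrite /P /decomposition_proj scaler_sumr -big_split.
by apply: eq_bigr => i _; rewrite component_linear.
Qed.

Lemma decomposition_projection m : exists (F : submodClosed X) (pi : X -> subspace_of F),
  [/\ finite_dimensional F, norm_one_projection pi & forall x, val (pi x) = P m x].
Proof.
have [n [e he]] := partial_sums_spanned m.+1.
apply: (@projection_of_idempotent _ _ _ n e) => //; first exact: decomposition_proj_linear.
  by move=> x; apply: (@proj_of_sum m (c^~ x)) => i; exact: component_in.
move=> x; rewrite -he; split=> [Px|[z [hz ->]]]; last exact: proj_of_sum.
by exists (c^~ x); split=> [i|]; [exact: component_in|rewrite -[LHS]Px].
Qed.

Lemma shrinking_approximating : Defs.shrinking c -> approximating_projections X.
Proof.
move=> hs n phi m y d dphi d0.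
have hphi i : exists N, forall k, (N <= k)%N -> forall x, unit_ball X x ->
    nc (phi i (x - P k x)) <= d.
  have /cvgrPdist_le/(_ _ d0)[N _ hN] := hs _ (dphi i).
  exists N => k Nk x x1; have := hN k Nk; rewrite sub0r normrN => h.
  apply: le_trans (le_trans (ler_norm _) h).
  have [M M0 hM] := dual_bound (dphi i); have lp := dual_lin (dphi i).
  rewrite (linB lp) ncBC; have P1 := ball_norm1_le (c_monotone k).
  (* A bound on the ball has to be given first: only then does the supremum in [ball_norm] dominate
     the values. *)
  apply: (@le_ball_norm R X R[i]^o (phi i \o decomposition_proj c k - phi i) (2 * M)) => //.
  move=> z z1; rewrite rnormC.
  have -> : (phi i \o decomposition_proj c k - phi i) z =
    phi i (decomposition_proj c k z) - phi i z by [].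
  apply: le_trans (ncD _ _) _; rewrite ncN.
  have := hM z; have := hM (decomposition_proj c k z); have := P1 z z1.
  move: z1; rewrite /unit_ball /= => z1 Pz h1 h2.
  have := ler_wpM2l (ltW M0) z1; have := ler_wpM2l (ltW M0) Pz; lra.
have hy j : exists N, forall k, (N <= k)%N -> rnorm (y j - P k (y j)) <= d.
  have [_ /(_ (y j))[_ + _]] := hE => /cvgrPdist_le/(_ d%:C%C).
  rewrite -[0]/(0%:C%C) ltcr => /(_ d0)[N _ hN]; exists N => k Nk.
  (* [P k] has [k + 1] terms, so it is the partial sum of index [k.+1]. *)
  rewrite -lecr -rnormE; have := hN k.+1 (leqW Nk).
  by rewrite /series /= big_mkord.
have /choice[N1 hN1] := hphi; have /choice[N2 hN2] := hy.
pose N := (\max_i N1 i + \max_j N2 j)%N.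
have [F [pi [fF npi vpi]]] := decomposition_projection N.
exists F, pi; split=> // [i x x1|j]; rewrite vpi.
  apply: hN1 => //; apply: leq_trans (leq_addr _ _).
  exact: (leq_bigmax_cond (F := N1)).
apply: hN2; apply: leq_trans (leq_addl _ _).
exact: (leq_bigmax_cond (F := N2)).
Qed.

End Decomposition.

(** * Integrals of real and complex functions *)

Section FiniteMeasure.
Context d (T : measurableType d) (R : realType).
Variable mu : {finite_measure set T -> \bar R}.
Implicit Types (g h : T -> R) (A B : set T) (f : T -> R[i]).

Definition integr g : Prop := mu.-integrable setT (EFin \o g).

Lemma integr_measurable g : integr g -> measurable_fun setT g.
Proof. by move=> /measurable_int/measurable_EFinP. Qed.

Lemma integr_le g h : measurable_fun setT g -> (forall t, `|g t| <= h t) ->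
  integr h -> integr g.
Proof.
move=> mg gh ih; apply: (le_integrable _ _ _ ih) => //.
  exact/measurable_EFinP.
by move=> t _ /=; rewrite lee_fin (le_trans (gh t))// ler_norm.
Qed.

Lemma integr_cst (a : R) : integr (cst a).
Proof. exact: finite_measure_integrable_cst. Qed.

Lemma integrD g h : integr g -> integr h -> integr (fun t => g t + h t).
Proof. by move=> ig ih; exact: (integrableD _ ig ih). Qed.

Lemma integrZ (a : R) g : integr g -> integr (fun t => a * g t).
Proof. by move=> ig; exact: (@integrableZl _ _ _ mu _ measurableT a _ ig). Qed.

Lemma integr_sum (I : Type) (r : seq I) (g : I -> T -> R) :
  (forall i, integr (g i)) -> integr (fun t => \sum_(i <- r) g i t).
Proof.
move=> ig; elim: r => [|i r ih].
  rewrite (_ : (fun t => _) = fun=> 0); first exact: integr_cst.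
  by apply/funext => t; rewrite big_nil.
rewrite (_ : (fun t => _) = fun t => g i t + \sum_(j <- r) g j t).
  exact: integrD.
by apply/funext => t; rewrite big_cons.
Qed.

Lemma integr_indicM g A : measurable A -> integr g ->
  integr (fun t => g t * \1_A t).
Proof.
move=> mA ig; apply: (@integr_le _ (fun t => `|g t|)).
- by apply: measurable_funM; [exact: integr_measurable|exact: measurable_indic].
- by move=> t; rewrite normrM ler_piMr// normr_nat lern1 leq_b1.
- exact: (integrable_norm ig).
Qed.

Definition int g : R := \int[mu]_t g t.

Lemma intD g h : integr g -> integr h ->
  int (fun t => g t + h t) = int g + int h.
Proof. by move=> ig ih; exact: RintegralD. Qed.

Lemma intB g h : integr g -> integr h ->
  int (fun t => g t - h t) = int g - int h.
Proof. by move=> ig ih; exact: RintegralB. Qed.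

Lemma intZ (a : R) g : integr g -> int (fun t => a * g t) = a * int g.
Proof. by move=> ig; exact: RintegralZl. Qed.

Lemma int0 : int (fun=> 0) = 0.
Proof. by rewrite /int Rintegral_cst// mul0r. Qed.

Lemma int_cst (a : R) : int (fun=> a) = a * fine (mu setT).
Proof. by rewrite /int Rintegral_cst. Qed.

Lemma int_sum (I : Type) (r : seq I) (g : I -> T -> R) :
  (forall i, integr (g i)) ->
  int (fun t => \sum_(i <- r) g i t) = \sum_(i <- r) int (g i).
Proof.
move=> ig; elim: r => [|i r ih].
  by rewrite big_nil -[RHS]int0; congr int; apply/funext => t; rewrite big_nil.
rewrite big_cons -ih -intD//; last exact: integr_sum.
by congr int; apply/funext => t; rewrite big_cons.
Qed.

Lemma le_int g h : integr g -> integr h -> (forall t, g t <= h t) ->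
  int g <= int h.
Proof. by move=> ig ih gh; apply: le_Rintegral. Qed.

Lemma int_ge0 g : (forall t, 0 <= g t) -> 0 <= int g.
Proof. by move=> g0; apply: Rintegral_ge0. Qed.

Lemma int_indic A : measurable A -> int (\1_A) = fine (mu A).
Proof. by move=> mA; rewrite /int /Rintegral integral_indic// setIT. Qed.

Lemma int_indicM g A : int (fun t => g t * \1_A t) = \int[mu]_(t in A) g t.
Proof.
rewrite [RHS]Rintegral_mkcond; congr Rintegral; apply/funext => t.
by rewrite patchE indicE; case: ifP; rewrite ?mulr1 ?mulr0.
Qed.

Lemma int_null g A : measurable A -> fine (mu A) = 0 -> integr g ->
  int (fun t => g t * \1_A t) = 0.
Proof.
move=> mA m0 ig; rewrite int_indicM /Rintegral null_set_integral//.
- exact/measurable_EFinP/measurable_funTS/integr_measurable.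
- by rewrite -[LHS]fineK ?m0// fin_num_measure.
Qed.

Lemma measure_ge0R A : 0 <= fine (mu A).
Proof. exact: fine_ge0. Qed.

End FiniteMeasure.
Arguments integr {d T R} mu g.
Arguments int {d T R} mu g.

Section ComplexFunctions.
Context d (T : measurableType d) (R : realType).
Variable mu : {finite_measure set T -> \bar R}.
Implicit Types (f g : T -> R[i]) (A B : set T).

Definition cmeas f : Prop := measurable_fun setT (@complex.Re R \o f) /\
  measurable_fun setT (@complex.Im R \o f).

Lemma ReM (a b : R[i]) : complex.Re (a * b) =
  complex.Re a * complex.Re b - complex.Im a * complex.Im b.
Proof. by case: a b => [? ?] [? ?]. Qed.

Lemma ImM (a b : R[i]) : complex.Im (a * b) =
  complex.Re a * complex.Im b + complex.Im a * complex.Re b.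
Proof. by case: a b => [? ?] [? ?]. Qed.

Lemma cmeasD f g : cmeas f -> cmeas g -> cmeas (fun t => f t + g t).
Proof.
move=> [f1 f2] [g1 g2]; split.
  rewrite (_ : _ \o _ = (@complex.Re R \o f) \+ (@complex.Re R \o g)).
    exact: measurable_funD.
  by apply/funext => t; rewrite /= raddfD.
rewrite (_ : _ \o _ = (@complex.Im R \o f) \+ (@complex.Im R \o g)).
  exact: measurable_funD.
by apply/funext => t; rewrite /= raddfD.
Qed.

Lemma cmeasM f g : cmeas f -> cmeas g -> cmeas (fun t => f t * g t).
Proof.
move=> [f1 f2] [g1 g2]; split.
  rewrite (_ : _ \o _ = (fun t => (@complex.Re R \o f) t * (@complex.Re R \o g) t
    - (@complex.Im R \o f) t * (@complex.Im R \o g) t)).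
    by apply: measurable_funB; exact: measurable_funM.
  by apply/funext => t; rewrite /= ReM.
rewrite (_ : _ \o _ = (fun t => (@complex.Re R \o f) t * (@complex.Im R \o g) t
    + (@complex.Im R \o f) t * (@complex.Re R \o g) t)).
  by apply: measurable_funD; exact: measurable_funM.
by apply/funext => t; rewrite /= ImM.
Qed.

Lemma cmeas_cst (a : R[i]) : cmeas (fun=> a).
Proof. by split; exact: measurable_cst. Qed.

Lemma cmeas_indic A : measurable A -> cmeas (fun t => (\1_A t : R)%:C%C).
Proof.
move=> mA; split; first exact: measurable_indic.
exact: measurable_cst.
Qed.

Lemma ncE2 (a : R[i]) :
  nc a = (complex.Re a ^+ 2 + complex.Im a ^+ 2) `^ 2^-1.
Proof.
by rewrite /nc normc_def powR12_sqrt// addr_ge0// sqr_ge0.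
Qed.

Lemma cmeas_nc f : cmeas f -> measurable_fun setT (fun t => nc (f t)).
Proof.
move=> [f1 f2].
rewrite (_ : (fun t => nc (f t)) = (@powR R ^~ 2^-1) \o
  (fun t => (@complex.Re R \o f) t ^+ 2 + (@complex.Im R \o f) t ^+ 2)); last first.
  by apply/funext => t; rewrite /= ncE2.
apply: measurableT_comp; first exact: measurable_powR.
by apply: measurable_funD; apply: measurable_funX.
Qed.

Definition cintegr f : Prop :=
  integr mu (@complex.Re R \o f) /\ integr mu (@complex.Im R \o f).

Lemma cintegr_meas f : cintegr f -> cmeas f.
Proof. by case=> f1 f2; split; [exact: integr_measurable f1|exact: integr_measurable f2]. Qed.

Lemma cintegrP f (h : T -> R) : cmeas f -> integr mu h ->
  (forall t, nc (f t) <= h t) -> cintegr f.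
Proof.
move=> [f1 f2] ih fh; split; apply: integr_le ih => // t.
  exact: le_trans (normRe_le _) (fh t).
exact: le_trans (normIm_le _) (fh t).
Qed.

Lemma cintegr_nc f : cintegr f -> integr mu (fun t => nc (f t)).
Proof.
move=> cf; have [f1 f2] := cf.
apply: (@integr_le _ _ _ _ _ (fun t => `|complex.Re (f t)| + `|complex.Im (f t)|)).
- exact/cmeas_nc/cintegr_meas.
- by move=> t; rewrite ger0_norm ?nc_ge0// nc_le_ReIm.
- by apply: integrD; [exact: (integrable_norm f1)|exact: (integrable_norm f2)].
Qed.

Lemma cintegrMb f g (K : R) : cintegr f -> cmeas g -> (forall t, nc (g t) <= K) ->
  cintegr (fun t => f t * g t).
Proof.
move=> cf mg gK; apply: (@cintegrP _ (fun t => K * nc (f t))).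
- by apply: cmeasM => //; exact: cintegr_meas.
- exact/integrZ/cintegr_nc.
- by move=> t; rewrite ncM mulrC ler_wpM2r ?nc_ge0.
Qed.

Lemma cintegrD f g : cintegr f -> cintegr g -> cintegr (fun t => f t + g t).
Proof.
move=> cf cg; apply: (@cintegrP _ (fun t => nc (f t) + nc (g t))).
- by apply: cmeasD; exact: cintegr_meas.
- by apply: integrD; exact: cintegr_nc.
- by move=> t; exact: ncD.
Qed.

Lemma cintegrZ (a : R[i]) f : cintegr f -> cintegr (fun t => a * f t).
Proof.
move=> cf; apply: (@cintegrP _ (fun t => nc a * nc (f t))).
- by apply: cmeasM; [exact: cmeas_cst|exact: cintegr_meas].
- exact/integrZ/cintegr_nc.
- by move=> t; rewrite ncM.
Qed.

Lemma cintegr_indicM f A : measurable A -> cintegr f ->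
  cintegr (fun t => f t * (\1_A t : R)%:C%C).
Proof.
move=> mA cf; apply: (@cintegrMb _ _ 1) => //; first exact: cmeas_indic.
by move=> t; rewrite nc_real normr_nat lern1 leq_b1.
Qed.

Definition cint f : R[i] :=
  (int mu (@complex.Re R \o f) +i* int mu (@complex.Im R \o f))%C.

Lemma cintD f g : cintegr f -> cintegr g ->
  cint (fun t => f t + g t) = cint f + cint g.
Proof.
move=> [f1 f2] [g1 g2]; rewrite /cint.
have -> : @complex.Re R \o (fun t => f t + g t) =
    fun t => (@complex.Re R \o f) t + (@complex.Re R \o g) t.
  by apply/funext => t; rewrite /= raddfD.
have -> : @complex.Im R \o (fun t => f t + g t) =
    fun t => (@complex.Im R \o f) t + (@complex.Im R \o g) t.
  by apply/funext => t; rewrite /= raddfD.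
by rewrite (intD f1 g1) (intD f2 g2).
Qed.

Lemma cintZ (a : R[i]) f : cintegr f -> cint (fun t => a * f t) = a * cint f.
Proof.
move=> [f1 f2]; rewrite /cint.
have -> : @complex.Re R \o (fun t => a * f t) =
    fun t => complex.Re a * (@complex.Re R \o f) t
      - complex.Im a * (@complex.Im R \o f) t.
  by apply/funext => t; rewrite /= ReM.
have -> : @complex.Im R \o (fun t => a * f t) =
    fun t => complex.Re a * (@complex.Im R \o f) t
      + complex.Im a * (@complex.Re R \o f) t.
  by apply/funext => t; rewrite /= ImM.
rewrite (intB (integrZ (complex.Re a) f1) (integrZ (complex.Im a) f2)).
rewrite (intD (integrZ (complex.Re a) f2) (integrZ (complex.Im a) f1)).
rewrite !(intZ _ f1) !(intZ _ f2).
by case: a => a1 a2.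
Qed.

Lemma cint0 : cint (fun=> 0) = 0.
Proof.
rewrite /cint (_ : @complex.Re R \o _ = fun=> 0)//.
by rewrite (_ : @complex.Im R \o _ = fun=> 0)// int0.
Qed.

Lemma cintegr0 : cintegr (fun=> 0).
Proof. by split; exact: integr_cst. Qed.

Lemma cintegr_sum (I : Type) (r : seq I) (f : I -> T -> R[i]) :
  (forall i, cintegr (f i)) -> cintegr (fun t => \sum_(i <- r) f i t).
Proof.
move=> cf; elim: r => [|i r ih].
  rewrite (_ : (fun t => _) = fun=> 0); first exact: cintegr0.
  by apply/funext => t; rewrite big_nil.
rewrite (_ : (fun t => _) = fun t => f i t + \sum_(j <- r) f j t).
  exact: cintegrD.
by apply/funext => t; rewrite big_cons.
Qed.

Lemma cint_sum (I : Type) (r : seq I) (f : I -> T -> R[i]) :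
  (forall i, cintegr (f i)) ->
  cint (fun t => \sum_(i <- r) f i t) = \sum_(i <- r) cint (f i).
Proof.
move=> cf; elim: r => [|i r ih].
  by rewrite big_nil -[RHS]cint0; congr cint; apply/funext => t; rewrite big_nil.
rewrite big_cons -ih -cintD//; last exact: cintegr_sum.
by congr cint; apply/funext => t; rewrite big_cons.
Qed.

(** After rotation by a phase the integral equals its modulus, and the real part of the integrand is
    at most its modulus. *)
Lemma le_cint f : cintegr f -> nc (cint f) <= int mu (fun t => nc (f t)).
Proof.
move=> cf; have [a [a1 ha]] := phase_ex (cint f).
have /(congr1 (@complex.Re _)) /= <- := ha.
rewrite -cintZ// /cint /=; apply: le_int.
- by have [] := cintegrZ a cf.
- exact: cintegr_nc.
- by move=> t /=; rewrite (le_trans (Re_le _))// ncM a1 mul1r.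
Qed.

Lemma cint_null f A : measurable A -> fine (mu A) = 0 -> cintegr f ->
  cint (fun t => f t * (\1_A t : R)%:C%C) = 0.
Proof.
move=> mA m0 cf; apply: nc0_eq0; apply/eqP; rewrite eq_le nc_ge0 andbT.
apply: le_trans (le_cint (cintegr_indicM mA cf)) _.
rewrite le_eqVlt; apply/orP; left; apply/eqP.
rewrite -(int_null mA m0 (cintegr_nc cf)); congr int; apply/funext => t.
by rewrite ncM nc_real normr_nat.
Qed.

Lemma cint_indic A : measurable A ->
  cint (fun t => (\1_A t : R)%:C%C) = (fine (mu A))%:C%C.
Proof. by move=> mA; rewrite /cint [X in (X +i* _)%C]int_indic// int0. Qed.

End ComplexFunctions.
Arguments cint {d T R} mu f.
Arguments cintegr {d T R} mu f.

(** * Conditional expectations *)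

Section Powers.
Variables (R : realType) (p : R).
Hypothesis p1 : 1 <= p.

Let p0 : 0 < p. Proof. by have := p1; lra. Qed.

Lemma powR_le (x y : R) : 0 <= x -> x <= y -> x `^ p <= y `^ p.
Proof.
move=> x0 xy; apply: ge0_ler_powR => //; rewrite ?nnegrE ?(ltW p0)//.
exact: le_trans xy.
Qed.

Lemma le_powR (x y : R) : 0 <= y -> x `^ p <= y `^ p -> x <= y.
Proof.
move=> y0; apply: contraTT; rewrite -!ltNge => yx; apply: gt0_ltr_powR => //.
by rewrite nnegrE (le_trans y0)// ltW.
Qed.

Lemma powRK (x : R) : 0 <= x -> (x `^ p^-1) `^ p = x.
Proof. by move=> x0; rewrite -powRrM mulVf ?gt_eqF// powRr1. Qed.

(** For p > 1 this is Young's inequality for [a] and s^(p - 1) with exponents p and p / (p - 1); for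
    p = 1 both sides are [a]. *)
Lemma powR_tangent (a s : R) : 0 <= a -> 0 <= s ->
  s `^ p + p * s `^ (p - 1) * (a - s) <= a `^ p.
Proof.
move=> a0 s0; have sp : s * s `^ (p - 1) = s `^ p by exact: mulr_powRB1.
have [pe|/eqP pn] := eqVneq p 1.
  by rewrite pe subrr powRr0 !powRr1//; lra.
have pm : 0 < p - 1 by have := p1; move: pn; lra.
have q0 : 0 < p / (p - 1) by rewrite divr_gt0.
have pq : p^-1 + (p / (p - 1))^-1 = 1.
  by field; rewrite !gt_eqF.
have := conjugate_powR a0 (powR_ge0 s (p - 1)) p0 q0 pq.
rewrite -powRrM (_ : (p - 1) * (p / (p - 1)) = p); last by field; rewrite gt_eqF.
rewrite -(ler_pM2l p0).
rewrite (_ : p * (a `^ p / p + s `^ p / (p / (p - 1))) = a `^ p + s `^ p * (p - 1)); last first.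
  by field; rewrite !gt_eqF.
by rewrite -sp; lra.
Qed.

Lemma powRD_le (x y : R) : 0 <= x -> 0 <= y ->
  (x + y) `^ p <= 2 `^ p * (x `^ p + y `^ p).
Proof.
wlog xy : x y / x <= y.
  by case: (leP x y) => [|/ltW] h w x0 y0; [|rewrite addrC [in leRHS]addrC]; apply: w.
move=> x0 y0; apply: (@le_trans _ _ ((2 * y) `^ p)).
  by apply: powR_le; lra.
rewrite powRM// ler_wpM2l ?powR_ge0// lerDr; exact: powR_ge0.
Qed.

Lemma le_1DpowR (x : R) : 0 <= x -> x <= 1 + x `^ p.
Proof.
move=> x0; have [x1|/ltW x1] := leP x 1; first by have := powR_ge0 x p; lra.
by have := le1r_powR x1 p1; lra.
Qed.

End Powers.

Section LpFunctions.
Context d (T : measurableType d) (R : realType).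
Variables (mu : {finite_measure set T -> \bar R}) (p : R).
Hypothesis p1 : 1 <= p.
Implicit Types (f g : T -> R[i]) (A B : set T).

Let p0 : 0 < p. Proof. by have := p1; lra. Qed.

Definition pth f (t : T) : R := nc (f t) `^ p.
(** The p-th power of the L_p norm; the measure is not normalized. *)
Definition mean_pth f : R := int mu (pth f).

Lemma pth_ge0 f t : 0 <= pth f t. Proof. exact: powR_ge0. Qed.

Lemma mean_pth_ge0 f : 0 <= mean_pth f.
Proof. by apply: int_ge0 => t; exact: pth_ge0. Qed.

Lemma cmeas_pth f : cmeas f -> measurable_fun setT (pth f).
Proof.
move=> mf; apply: (@measurableT_comp _ _ _ _ _ _ (@powR R ^~ p)).
  exact: measurable_powR.
exact: cmeas_nc.
Qed.

Lemma complex_Lnorm_pow f :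
  (poweR (complex_Lnorm mu p f) p = \int[mu]_t (pth f t)%:E)%E.
Proof.
rewrite /complex_Lnorm poweR_Lnorm; last by rewrite gt_eqF.
apply: eq_integral => t _.
by rewrite /= ger0_norm ?nc_ge0.
Qed.

Lemma complex_LfunP f :
  complex_Lfun mu p f <-> cmeas f /\ integr mu (pth f).
Proof.
split=> [[f1 f2 fp]|[[f1 f2] fp]].
  have mf : cmeas f by [].
  split=> //; apply/integrableP; split; first exact/measurable_EFinP/cmeas_pth.
  rewrite (_ : (fun x => _) = fun t => (pth f t)%:E).
    by rewrite -complex_Lnorm_pow; exact: poweR_lty.
  by apply/funext => t /=; rewrite ger0_norm// pth_ge0.
split=> //; rewrite (lty_poweRy (r := p))// ?gt_eqF//.
rewrite complex_Lnorm_pow; move/integrableP: fp => [_].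
rewrite (_ : (fun x => _) = fun t => (pth f t)%:E)//.
by apply/funext => t /=; rewrite ger0_norm// pth_ge0.
Qed.

Local Notation Lp := (complex_Lfun mu p).

Lemma Lp_integr f : Lp f -> integr mu (pth f).
Proof. by move=> /complex_LfunP[]. Qed.

Lemma Lp_cmeas f : Lp f -> cmeas f.
Proof. by move=> /complex_LfunP[]. Qed.

Lemma Lp_mono f (h : T -> R) : cmeas f -> integr mu h ->
  (forall t, pth f t <= h t) -> Lp f.
Proof.
move=> mf ih fh; apply/complex_LfunP; split=> //.
apply: integr_le ih; first exact: cmeas_pth.
by move=> t; rewrite ger0_norm ?pth_ge0.
Qed.

Lemma Lp_cintegr f : Lp f -> cintegr mu f.
Proof.
move=> lf; apply: (@cintegrP _ _ _ _ _ (fun t => 1 + pth f t)).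
- exact: Lp_cmeas.
- by apply: integrD; [exact: integr_cst|exact: Lp_integr].
- by move=> t; apply: le_1DpowR => //; exact: nc_ge0.
Qed.

Lemma Lp_comb (a : R[i]) f g : Lp f -> Lp g -> Lp (fun t => a * f t + g t).
Proof.
move=> lf lg.
apply: (@Lp_mono _ (fun t => 2 `^ p * (nc a `^ p * pth f t + pth g t))).
- apply: cmeasD; last exact: Lp_cmeas.
  by apply: cmeasM; [exact: cmeas_cst|exact: Lp_cmeas].
- by apply: integrZ; apply: integrD; [apply: integrZ|]; exact: Lp_integr.
- move=> t; rewrite /pth -powRM ?nc_ge0// -ncM.
  by apply: le_trans (powRD_le _ _ _); rewrite ?nc_ge0//; apply: powR_le;
    rewrite ?nc_ge0// ncD.
Qed.

Lemma Lp0 : Lp (fun=> 0).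
Proof.
apply: (@Lp_mono _ (fun=> 0)); [exact: cmeas_cst|exact: integr_cst|].
by move=> t; rewrite /pth nc0 powR0// gt_eqF.
Qed.

Lemma LpZ (a : R[i]) f : Lp f -> Lp (fun t => a * f t).
Proof.
move=> lf; rewrite (_ : (fun t => _) = fun t => a * f t + 0).
  exact: Lp_comb Lp0.
by apply/funext => t; rewrite addr0.
Qed.

Lemma LpD f g : Lp f -> Lp g -> Lp (fun t => f t + g t).
Proof.
move=> lf lg; rewrite (_ : (fun t => _) = fun t => 1 * f t + g t).
  exact: Lp_comb.
by apply/funext => t; rewrite mul1r.
Qed.

Lemma LpB f g : Lp f -> Lp g -> Lp (fun t => f t - g t).
Proof.
move=> lf lg; rewrite (_ : (fun t => _) = fun t => -1 * g t + f t).
  exact: Lp_comb.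
by apply/funext => t; rewrite mulN1r addrC.
Qed.

Lemma Lp_bounded f (K : R) : cmeas f -> (forall t, nc (f t) <= K) -> Lp f.
Proof.
move=> mf fK; apply: (@Lp_mono _ (fun=> K `^ p)) => //; first exact: integr_cst.
by move=> t; apply: powR_le => //; exact: nc_ge0.
Qed.

Lemma Lp_indicM f A : measurable A -> Lp f ->
  Lp (fun t => f t * (\1_A t : R)%:C%C).
Proof.
move=> mA lf; apply: (@Lp_mono _ (pth f)); last 1 first.
- move=> t; apply: powR_le => //; first exact: nc_ge0.
  by rewrite ncM nc_real normr_nat ler_piMr ?nc_ge0// lern1 leq_b1.
- by apply: cmeasM; [exact: Lp_cmeas|exact: cmeas_indic].
- exact: Lp_integr.
Qed.

Lemma pth_indicM f A t :
  pth (fun t => f t * (\1_A t : R)%:C%C) t = pth f t * \1_A t.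
Proof.
rewrite /pth ncM nc_real normr_nat indicE; case: (t \in A).
  by rewrite !mulr1.
by rewrite !mulr0 powR0// gt_eqF.
Qed.

(* The tangent of [x ^ p] at the mean value of [g] on [A] lies below the graph. *)
Lemma jensen (g : T -> R) A : measurable A -> (forall t, 0 <= g t) ->
  integr mu g -> integr mu (fun t => g t `^ p) ->
  (int mu (fun t => g t * \1_A t) / fine (mu A)) `^ p * fine (mu A)
    <= int mu (fun t => g t `^ p * \1_A t).
Proof.
move=> mA g0 ig igp.
have ind0 t : 0 <= \1_A t :> R by rewrite indicE.
have [m0|m0] := eqVneq (fine (mu A)) 0.
  rewrite m0 mulr0; apply: int_ge0 => t; rewrite mulr_ge0// powR_ge0//.
set m := fine _ in m0 *; set J := int mu _; set s := J / m.
have s0 : 0 <= s.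
  by rewrite divr_ge0 ?measure_ge0R//; apply: int_ge0 => t; rewrite mulr_ge0.
have i1 : integr mu (\1_A : T -> R) by exact: integrable_indic.
have iA : integr mu (fun t => g t * \1_A t) by exact: integr_indicM.
pose h t := (s `^ p - p * s `^ (p - 1) * s) * \1_A t
  + p * s `^ (p - 1) * (g t * \1_A t).
have ih : integr mu h by apply: integrD; exact: integrZ.
have -> : s `^ p * m = int mu h.
  rewrite intD; [|exact: integrZ|exact: integrZ].
  rewrite !intZ// int_indic// -/m -/J.
  have -> : J = s * m by rewrite /s mulfVK.
  ring.
apply: le_int => //; first exact: integr_indicM.
move=> t; apply: le_trans (_ : (s `^ p + p * s `^ (p - 1) * (g t - s)) * \1_A t <= _).
  by rewrite /h le_eqVlt; apply/orP; left; apply/eqP; ring.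
by rewrite ler_wpM2r//; exact: powR_tangent.
Qed.

Section Partition.
Variables (I : finType) (c : T -> I).
Hypothesis mc : forall i, measurable (c @^-1` [set i]).

Definition cell i : set T := c @^-1` [set i].
Lemma mcell i : measurable (cell i). Proof. exact: mc. Qed.

Definition mass i : R := fine (mu (cell i)).
(* On null cells the average is 0, because of the division by 0. *)
Definition average f i : R[i] :=
  cint mu (fun t => f t * (\1_(cell i) t : R)%:C%C) / (mass i)%:C%C.
Definition cond_exp f (t : T) : R[i] := average f (c t).

Lemma cellE i t : \1_(cell i) t = (c t == i)%:R :> R.
Proof.
by rewrite indicE; congr (_%:R); congr nat_of_bool; apply/idP/idP => [/set_mem/eqP//|/eqP h]; apply/mem_set.
Qed.

Lemma simpleE (s : I -> R[i]) t :
  s (c t) = \sum_i s i * (\1_(cell i) t : R)%:C%C.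
Proof.
rewrite (bigD1 (c t))//= cellE eqxx mulr1 big1 ?addr0// => i ic.
by rewrite cellE eq_sym (negbTE ic) mulr0.
Qed.

Lemma simpleER (s : I -> R) t : s (c t) = \sum_i s i * \1_(cell i) t.
Proof.
rewrite (bigD1 (c t))//= cellE eqxx mulr1 big1 ?addr0// => i ic.
by rewrite cellE eq_sym (negbTE ic) mulr0.
Qed.

Lemma simple_bound (s : I -> R[i]) : exists K, forall t, nc (s (c t)) <= K.
Proof.
exists (\sum_i nc (s i)) => t; rewrite (bigD1 (c t))//= lerDl.
by apply: sumr_ge0 => i _; exact: nc_ge0.
Qed.

Lemma cmeas_sum (J : Type) (r : seq J) (f : J -> T -> R[i]) :
  (forall i, cmeas (f i)) -> cmeas (fun t => \sum_(i <- r) f i t).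
Proof.
move=> cf; elim: r => [|i r ih].
  rewrite (_ : (fun t => _) = fun=> 0); first exact: cmeas_cst.
  by apply/funext => t; rewrite big_nil.
rewrite (_ : (fun t => _) = fun t => f i t + \sum_(j <- r) f j t).
  exact: cmeasD.
by apply/funext => t; rewrite big_cons.
Qed.

Lemma cmeas_simple (s : I -> R[i]) : cmeas (fun t => s (c t)).
Proof.
rewrite (_ : (fun t => _) = fun t => \sum_i s i * (\1_(cell i) t : R)%:C%C).
  apply: cmeas_sum => i; apply: cmeasM; first exact: cmeas_cst.
  exact: cmeas_indic (mcell i).
by apply/funext => t; rewrite simpleE.
Qed.

Lemma Lp_simple (s : I -> R[i]) : Lp (fun t => s (c t)).
Proof.
by have [K hK] := simple_bound s; apply: Lp_bounded hK; exact: cmeas_simple.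
Qed.

Lemma int_cells (g : T -> R) : integr mu g ->
  int mu g = \sum_i int mu (fun t => g t * \1_(cell i) t).
Proof.
move=> ig; rewrite -int_sum; last by move=> i; exact: integr_indicM (mcell i) ig.
congr int; apply/funext => t; rewrite -mulr_sumr.
have := simpleER (fun=> 1) t; under eq_bigr do rewrite mul1r; move=> <-; exact/esym/mulr1.
Qed.

Lemma int_simple (s : I -> R) :
  int mu (fun t => s (c t)) = \sum_i s i * mass i.
Proof.
rewrite (_ : (fun t => _) = fun t => \sum_i s i * \1_(cell i) t); last first.
  by apply/funext => t; rewrite simpleER.
have ii i : integr mu (\1_(cell i) : T -> R) by exact: integrable_indic (mcell i).
rewrite int_sum; last by move=> i; exact: integrZ (ii i).
by apply: eq_bigr => i _; rewrite intZ// (int_indic _ (mcell i)).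
Qed.

Lemma cint_cells f : cintegr mu f ->
  cint mu f = \sum_i cint mu (fun t => f t * (\1_(cell i) t : R)%:C%C).
Proof.
move=> cf; rewrite -cint_sum; last by move=> i; exact: cintegr_indicM (mcell i) cf.
congr cint; apply/funext => t; rewrite -mulr_sumr.
have := simpleE (fun=> 1) t; under eq_bigr do rewrite mul1r; move=> <-; exact/esym/mulr1.
Qed.

(** Jensen's inequality on each cell, after the modulus has been moved under the integral. *)
Lemma mean_pth_cond_exp f : Lp f -> mean_pth (cond_exp f) <= mean_pth f.
Proof.
move=> lf; rewrite /mean_pth (int_cells (Lp_integr lf)).
rewrite [leLHS](int_simple (fun i => nc (average f i) `^ p)); apply: ler_sum => i _.
have ci := cintegr_indicM (mcell i) (Lp_cintegr lf).
apply: le_trans (jensen (mcell i) (fun t => nc_ge0 (f t)) (cintegr_nc (Lp_cintegr lf)) (Lp_integr lf)).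
rewrite ler_wpM2r ?measure_ge0R//; apply: powR_le => //; first exact: nc_ge0.
rewrite /average ncM ncV nc_real ger0_norm ?measure_ge0R//.
rewrite ler_wpM2r ?invr_ge0 ?measure_ge0R//.
apply: le_trans (le_cint ci) _; rewrite le_eqVlt; apply/orP; left; apply/eqP.
congr int; apply/funext => t.
by rewrite ncM nc_real normr_nat.
Qed.

Lemma cond_exp_comb (a : R[i]) f g : Lp f -> Lp g ->
  cond_exp (fun t => a * f t + g t) = fun t => a * cond_exp f t + cond_exp g t.
Proof.
move=> lf lg; apply/funext => t; rewrite /cond_exp /average mulrA -mulrDl.
have cf := cintegr_indicM (mcell (c t)) (Lp_cintegr lf).
have cg := cintegr_indicM (mcell (c t)) (Lp_cintegr lg).
rewrite -cintZ// -cintD//; last exact: cintegrZ.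
by congr (cint _ _ / _); apply/funext => u; rewrite mulrDl mulrA.
Qed.

Lemma average_simple (s : I -> R[i]) i : mass i != 0 ->
  average (fun t => s (c t)) i = s i.
Proof.
move=> m0; rewrite /average.
rewrite (_ : (fun t => _) = fun t => s i * (\1_(cell i) t : R)%:C%C).
  rewrite cintZ; last first.
    split; [exact: integrable_indic (mcell i)|exact: integr_cst].
  rewrite (cint_indic _ (mcell i)) mulfK//; apply/eqP => h; move/eqP: m0; apply.
  exact: (realc_inj h).
apply/funext => t; rewrite cellE; case: eqP => [->//|_].
by rewrite !mulr0.
Qed.

(** A simple function is reproduced except on null cells, where [average] is 0; hence equality is
    stated through a vanishing integral. *)
Lemma cond_exp_simple (s : I -> R[i]) :
  mean_pth (fun t => s (c t) - cond_exp (fun t => s (c t)) t) = 0.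
Proof.
rewrite /mean_pth.
rewrite [LHS](int_simple (fun i => nc (s i - average (fun t => s (c t)) i) `^ p)).
apply: big1 => i _.
have [->|m0] := eqVneq (mass i) 0; first by rewrite mulr0.
by rewrite average_simple// subrr nc0 powR0 ?mul0r// gt_eqF.
Qed.

(** On each cell a function and its average have the same integral. This is what removes the locally
    constant part of a density in [functional_approx]. *)
Lemma cint_cond_exp (s : I -> R[i]) f : Lp f ->
  cint mu (fun t => s (c t) * (f t - cond_exp f t)) = 0.
Proof.
move=> lf; have le : Lp (cond_exp f) by exact: Lp_simple.
have ld := LpB lf le; have cd := Lp_cintegr ld.
have [K hK] := simple_bound s.
have cs : cintegr mu (fun t => s (c t) * (f t - cond_exp f t)).
  rewrite (_ : (fun t => _) = fun t => (f t - cond_exp f t) * s (c t)).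
    by apply: (cintegrMb cd (cmeas_simple s) hK).
  by apply/funext => t; rewrite mulrC.
rewrite (cint_cells cs); apply: big1 => i _.
rewrite (_ : (fun t => _) =
    fun t => s i * (f t * (\1_(cell i) t : R)%:C%C
      + (- average f i) * (\1_(cell i) t : R)%:C%C)); last first.
  apply/funext => t; rewrite cellE /cond_exp; case: eqP => [->|_]; first by rewrite !mulr1.
  by rewrite !mulr0 addr0 mulr0.
have ci := cintegr_indicM (mcell i) (Lp_cintegr lf).
have c1 : cintegr mu (fun t => (\1_(cell i) t : R)%:C%C).
  by split; [exact: integrable_indic (mcell i)|exact: integr_cst].
rewrite cintZ; last by apply: cintegrD => //; exact: cintegrZ.
rewrite cintD//; last exact: cintegrZ.
rewrite cintZ// (cint_indic _ (mcell i)) -/(mass i).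
have [m0|m0] := eqVneq (mass i) 0; last first.
  rewrite /average mulNr mulfVK ?subrr ?mulr0//.
  by apply/eqP => h; move/eqP: m0; apply; exact: (realc_inj h).
by rewrite m0 mulr0 addr0 (cint_null (mcell i) m0 (Lp_cintegr lf)) mulr0.
Qed.

End Partition.

End LpFunctions.

(** * Refinement of partitions *)

Section Partitions.
Context d (T : measurableType d) (R : realType).

(** A finite partition is encoded by its labelling; cells may be empty, and the common refinement of
    two partitions is a pair of labels. *)
Definition mpartition (I : finType) (c : T -> I) : Prop :=
  forall i, measurable (c @^-1` [set i]).

(** A property of all partitions finer than some partition, where [c'] is finer than [c] when [c]
    factors through it. Finitely many such properties can be met at once. *)
Definition eventually_refined (Q : forall I : finType, (T -> I) -> Prop) : Prop :=
  exists (I : finType) (c : T -> I), mpartition c /\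
    forall (J : finType) (c' : T -> J) (h : J -> I), mpartition c' ->
      (forall t, c t = h (c' t)) -> Q J c'.

Lemma mpartition_pair (I J : finType) (c : T -> I) (c' : T -> J) :
  mpartition c -> mpartition c' -> mpartition (fun t => (c t, c' t)).
Proof.
move=> mc mc' [i j]; rewrite (_ : _ @^-1` _ = c @^-1` [set i] `&` c' @^-1` [set j]).
  exact: measurableI.
by apply/seteqP; split=> t /=; [case=> -> ->|case=> -> ->].
Qed.

Lemma eventually_refined_and Q1 Q2 :
  eventually_refined Q1 -> eventually_refined Q2 ->
  eventually_refined (fun I c => Q1 I c /\ Q2 I c).
Proof.
move=> [I [c [mc hc]]] [J [c' [mc' hc']]].
exists (I * J)%type, (fun t => (c t, c' t)); split; first exact: mpartition_pair.
move=> K e h me eh; split; [apply: (hc _ _ (fst \o h))|apply: (hc' _ _ (snd \o h))] => // t;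
  by rewrite /= -eh.
Qed.

Lemma eventually_refined_all n (Q : 'I_n -> forall I : finType, (T -> I) -> Prop) :
  (forall i, eventually_refined (Q i)) ->
  eventually_refined (fun I c => forall i, Q i I c).
Proof.
move=> hQ.
suff h (r : seq 'I_n) : eventually_refined (fun I c => forall i, i \in r -> Q i I c).
  have [I [c [mc hc]]] := h (enum 'I_n).
  exists I, c; split=> // J c' g mc' cg i.
  by apply: hc => //; rewrite mem_enum.
elim: r => [|i s ih].
  exists unit, (fun=> tt); split=> // -[]; rewrite (_ : _ @^-1` _ = setT)//.
  by apply/seteqP; split=> t.
have [I [c [mc hc]]] := eventually_refined_and (hQ i) (ih).
exists I, c; split=> // J c' g mc' cg j; have [h1 h2] := hc _ _ _ mc' cg.
by rewrite inE => /predU1P[->//|]; exact: h2.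
Qed.

Lemma mpartition_ffun (K : finType) (b : K -> T -> bool) :
  (forall k, measurable_fun setT (b k)) -> mpartition (fun t => [ffun k => b k t]).
Proof.
move=> mb v.
rewrite (_ : _ @^-1` _ = \bigcap_(k in [set: K]) (b k @^-1` [set v k])).
  apply: fin_bigcap_measurable; first exact: finite_finset.
  by move=> k _; rewrite -[X in measurable X]setTI; exact: mb.
apply/seteqP; split=> t /=.
  by move=> <- k _ /=; rewrite ffunE.
by move=> h; apply/ffunP => k; rewrite ffunE; exact: h.
Qed.

Lemma mpartition_bool (b : T -> bool) : measurable_fun setT b -> mpartition b.
Proof. by move=> mb v; rewrite -[X in measurable X]setTI; exact: mb. Qed.

(** The label of [t] records which thresholds [- L + k * r] lie above [g t]. Values in the range
    that differ by more than [r] are separated by a threshold. *)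
Lemma grid1 (g : T -> R) (L r : R) : measurable_fun setT g -> 0 < L -> 0 < r ->
  exists (I : finType) (c : T -> I) (good : I -> bool), [/\ mpartition c,
    forall t, good (c t) = (`|g t| < L) &
    forall t u, good (c t) -> c t = c u -> `|g t - g u| <= r].
Proof.
move=> mg L0 r0; pose N := (Num.truncn (2 * L / r)).+2.
pose a (k : 'I_N) := - L + k%:R * r.
pose c1 t := [ffun k => g t < a k].
exists ({ffun 'I_N -> bool} * bool)%type.
exists (fun t => (c1 t, `|g t| < L)), snd.
split.
- apply: mpartition_pair.
    apply: mpartition_ffun => k.
    by apply: measurable_fun_ltr => //; exact: measurable_cst.
  apply: mpartition_bool.
  by apply: measurable_fun_ltr; [exact: measurableT_comp|exact: measurable_cst].
- by [].
move=> t u /= gt [] tu; rewrite gt => /esym gu.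
have h v w : `|g v| < L -> `|g w| < L -> c1 v = c1 w -> g w - g v <= r.
  move=> gv gw /ffunP vw; rewrite leNgt; apply/negP => lt.
  have /andP[v1 v2] : (- L < g v) && (g v < L) by rewrite -ltr_norml.
  have /andP[w1 w2] : (- L < g w) && (g w < L) by rewrite -ltr_norml.
  have x0 : 0 <= (g v + L) / r by rewrite divr_ge0 ?(ltW r0)//; lra.
  set n := Num.truncn ((g v + L) / r).
  have /andP[n1 n2] := truncn_itv x0.
  rewrite ler_pdivlMr// in n1; rewrite ltr_pdivrMr// in n2.
  have nN : (n.+1 < N)%N.
    rewrite !ltnS; apply: le_truncn; rewrite ler_pM2r ?invr_gt0//; lra.
  have := vw (Ordinal nN); rewrite !ffunE /a /=.
  have -> : g v < - L + n.+1%:R * r by move: n2; rewrite -/n; lra.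
  move/esym; apply/negP; rewrite -leNgt -natr1 mulrDl.
  by move: n1; rewrite -/n; lra.
by rewrite ler_norml; have := h t u gt gu tu; have := h u t gu gt (esym tu); lra.
Qed.

Definition bad_set (g1 g2 : T -> R) (L : R) : set T :=
  [set t | ~~ ((`|g1 t| < L) && (`|g2 t| < L))].

Lemma measurable_bad_set g1 g2 L : measurable_fun setT g1 ->
  measurable_fun setT g2 -> measurable (bad_set g1 g2 L).
Proof.
move=> m1 m2.
have mb : measurable_fun setT (fun t => (`|g1 t| < L) && (`|g2 t| < L)).
  by apply: measurable_and; (apply: measurable_fun_ltr;
    [exact: measurableT_comp|exact: measurable_cst]).
rewrite (_ : bad_set g1 g2 L =
  (fun t => (`|g1 t| < L) && (`|g2 t| < L)) @^-1` [set false]).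
  exact: mpartition_bool.
by apply/seteqP; split=> t /=; [move/negbTE|move=> h; apply/negbT].
Qed.

Lemma grid2 (g1 g2 : T -> R) (L r : R) : measurable_fun setT g1 ->
  measurable_fun setT g2 -> 0 < L -> 0 < r ->
  exists (I : finType) (c : T -> I) (good : I -> bool), [/\ mpartition c,
    forall t, good (c t) = (t \notin bad_set g1 g2 L) &
    forall t u, good (c t) -> c t = c u ->
      `|g1 t - g1 u| <= r /\ `|g2 t - g2 u| <= r].
Proof.
move=> m1 m2 L0 r0.
have [I [c [good [mc cg cr]]]] := grid1 m1 L0 r0.
have [J [e [good' [me eg er]]]] := grid1 m2 L0 r0.
exists (I * J)%type, (fun t => (c t, e t)), (fun i => good i.1 && good' i.2).
split=> /=; first exact: mpartition_pair.
  move=> t; rewrite cg eg; apply/idP/idP => [h|].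
    by apply/negP => /set_mem /=; rewrite /bad_set /= h.
  by apply: contraNT => h; apply/mem_set.
by move=> t u /andP[gt gu] [ct et]; split; [exact: cr|exact: er].
Qed.

Section Tail.
Variable mu : {finite_measure set T -> \bar R}.

(** Chebyshev's inequality for |g1| + |g2|. *)
Lemma small_bad_set (g1 g2 : T -> R) (e : R) : integr mu g1 -> integr mu g2 ->
  0 < e -> exists2 L0 : R, 0 < L0 &
    forall L, L0 <= L -> fine (mu (bad_set g1 g2 L)) < e.
Proof.
move=> i1 i2 e0; pose h t := `|g1 t| + `|g2 t|.
have ih : integr mu h.
  by apply: integrD; [exact: (integrable_norm i1)|exact: (integrable_norm i2)].
have h0 t : 0 <= h t by rewrite addr_ge0.
have J0 : 0 <= int mu h by exact: int_ge0.
exists ((int mu h + 1) / e); first by rewrite divr_gt0//; lra.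
move=> L hL; have L0 : 0 < L by apply: lt_le_trans hL; rewrite divr_gt0//; lra.
have mb := measurable_bad_set L (integr_measurable i1) (integr_measurable i2).
have : L * fine (mu (bad_set g1 g2 L)) <= int mu h.
  rewrite -int_indic// -intZ; last exact: integrable_indic.
  apply: le_int => //; first by apply: integrZ; exact: integrable_indic.
  move=> t; rewrite indicE; case: (boolP (t \in _)) => [/set_mem|_] /=; last by rewrite mulr0.
  rewrite mulr1 /bad_set /= negb_and -!leNgt /h => /orP[] hh.
    by rewrite (le_trans hh)// lerDl.
  by rewrite (le_trans hh)// lerDr.
move: hL; rewrite ler_pdivrMr// => hL hm.
by rewrite -(ltr_pM2l L0) (le_lt_trans hm)//; lra.
Qed.

(** Absolute continuity of the integral of [h], on sets whose measure is small by
    [small_bad_set]. *)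
Lemma small_int_bad_set (g1 g2 h : T -> R) (e : R) :
  integr mu g1 -> integr mu g2 -> integr mu h -> (forall t, 0 <= h t) ->
  0 < e -> exists2 L0 : R, 0 < L0 &
    forall L, L0 <= L -> int mu (fun t => h t * \1_(bad_set g1 g2 L) t) < e.
Proof.
move=> i1 i2 ih h0 e0.
have [r [r0 hr]] := integral_normr_continuous ih e0.
have [L0 L00 hL] := small_bad_set i1 i2 r0.
exists L0 => // L /hL mL; rewrite int_indicM.
have mb := measurable_bad_set L (integr_measurable i1) (integr_measurable i2).
have : (mu (bad_set g1 g2 L) < r%:E)%E.
  by rewrite -[X in (X < _)%E]fineK ?lte_fin// fin_num_measure.
move/(hr _ mb).
rewrite (_ : \int[mu]_(x in bad_set g1 g2 L) `|h x| =
  \int[mu]_(x in bad_set g1 g2 L) h x)//.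
by apply: eq_Rintegral => t _; rewrite ger0_norm.
Qed.

End Tail.

End Partitions.

(** * The space L_p *)

Section LpSpace.
Context d (T : measurableType d) (R : realType).
Variables (mu : {finite_measure set T -> \bar R}) (p : R).
Hypothesis p1 : 1 <= p.
Variables (X : normedModType R[i]) (cls : (T -> R[i]) -> X).
Local Notation Lp := (complex_Lfun mu p).
Hypothesis cls_comb : forall (a : R[i]) (f g : T -> R[i]), Lp f -> Lp g ->
  cls (fun t => a * f t + g t) = a *: cls f + cls g.
Hypothesis cls_norm : forall f, Lp f ->
  (rnorm (cls f))%:E = complex_Lnorm mu p f.
Hypothesis cls_surj : forall x : X, exists2 f, Lp f & cls f = x.
Implicit Types (f g : T -> R[i]) (A B : set T).

Let p0 : 0 < p. Proof. by have := p1; lra. Qed.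

Lemma cls_pow f : Lp f -> rnorm (cls f) `^ p = mean_pth mu p f.
Proof.
move=> lf; have := complex_Lnorm_pow mu p1 f; rewrite -cls_norm// poweR_EFin.
by rewrite /mean_pth /int /Rintegral => <-.
Qed.

Lemma le_cls f g : Lp f -> Lp g -> mean_pth mu p f <= mean_pth mu p g ->
  rnorm (cls f) <= rnorm (cls g).
Proof. by move=> lf lg; rewrite -!cls_pow// => /(le_powR p1); apply; exact: rnorm_ge0. Qed.

Lemma cls_le f (e : R) : Lp f -> 0 <= e -> mean_pth mu p f <= e `^ p ->
  rnorm (cls f) <= e.
Proof. by move=> lf e0; rewrite -cls_pow// => /(le_powR p1); exact. Qed.

Lemma cls_eq0 f : Lp f -> mean_pth mu p f = 0 -> cls f = 0.
Proof.
move=> lf f0; apply: rnorm0_eq0; apply/eqP; rewrite eq_le rnorm_ge0 andbT.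
by apply: cls_le => //; rewrite f0 powR_ge0.
Qed.

Lemma cls0 : cls (fun=> 0) = 0.
Proof.
apply: cls_eq0; first exact: Lp0.
rewrite /mean_pth (_ : pth p _ = fun=> 0) ?int0//.
by apply/funext => t; rewrite /pth nc0 powR0// gt_eqF.
Qed.

Lemma clsZ a f : Lp f -> cls (fun t => a * f t) = a *: cls f.
Proof.
move=> lf; rewrite -[RHS]addr0 -cls0 -cls_comb//; last exact: Lp0.
by congr cls; apply/funext => t; rewrite addr0.
Qed.

Lemma clsD f g : Lp f -> Lp g -> cls (fun t => f t + g t) = cls f + cls g.
Proof.
move=> lf lg; rewrite -[X in X + _]scale1r -cls_comb//.
by congr cls; apply/funext => t; rewrite mul1r.
Qed.

Lemma clsB f g : Lp f -> Lp g -> cls (fun t => f t - g t) = cls f - cls g.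
Proof.
move=> lf lg; rewrite addrC -scaleN1r -cls_comb//.
by congr cls; apply/funext => t; rewrite mulN1r addrC.
Qed.

Lemma Lp_sum (J : Type) (r : seq J) (f : J -> T -> R[i]) :
  (forall j, Lp (f j)) -> Lp (fun t => \sum_(j <- r) f j t).
Proof.
move=> lf; elim: r => [|i r ih].
  rewrite (_ : (fun t => _) = fun=> 0); first exact: Lp0.
  by apply/funext => t; rewrite big_nil.
rewrite (_ : (fun t => _) = fun t => f i t + \sum_(j <- r) f j t).
  exact: LpD.
by apply/funext => t; rewrite big_cons.
Qed.

Lemma cls_sum (J : Type) (r : seq J) (f : J -> T -> R[i]) :
  (forall j, Lp (f j)) ->
  cls (fun t => \sum_(j <- r) f j t) = \sum_(j <- r) cls (f j).
Proof.
move=> lf; elim: r => [|i r ih].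
  by rewrite big_nil -[RHS]cls0; congr cls; apply/funext => t; rewrite big_nil.
rewrite big_cons -ih -clsD//; last exact: Lp_sum.
by congr cls; apply/funext => t; rewrite big_cons.
Qed.

Lemma cls_eq f g : Lp f -> Lp g -> mean_pth mu p (fun t => f t - g t) = 0 ->
  cls f = cls g.
Proof.
move=> lf lg h; apply/eqP; rewrite -subr_eq0 -clsB//.
by apply/eqP/cls_eq0 => //; exact: LpB.
Qed.

(** Holder's inequality against the constant 1, read off from [jensen] on the whole space; for
    [m > 0] the constant is m^(1 - 1/p). *)
Lemma int_nc_bound : exists2 K : R, 0 <= K &
  forall f, Lp f -> int mu (fun t => nc (f t)) <= K * rnorm (cls f).
Proof.
set m := fine (mu setT); have m0 : 0 <= m by exact: measure_ge0R.
exists (m * m^-1 `^ p^-1); first by rewrite mulr_ge0// powR_ge0.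
move=> f lf.
have := jensen p1 measurableT (fun t => nc_ge0 (f t)) (cintegr_nc (Lp_cintegr p1 lf))
  (Lp_integr p1 lf).
have indT (g : T -> R) : (fun t => g t * \1_setT t) = g.
  by apply/funext => t; rewrite indicT mulr1.
rewrite !indT -/m -/(mean_pth mu p f) -cls_pow// => h.
have [mz|mn] := eqVneq m 0.
  have := int_null measurableT mz (cintegr_nc (Lp_cintegr p1 lf)).
  by rewrite indT => ->; rewrite mz !mul0r.
have mp : 0 < m by rewrite lt_neqAle eq_sym mn.
have J0 : 0 <= int mu (fun t => nc (f t)) by apply: int_ge0 => t; exact: nc_ge0.
rewrite -mulrA -ler_pdivrMl// mulrC; apply: (le_powR p1).
  by rewrite mulr_ge0 ?rnorm_ge0 ?powR_ge0.
rewrite powRM ?powR_ge0 ?rnorm_ge0// powRK ?invr_ge0//.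
by rewrite [leRHS]mulrC ler_pdivlMr.
Qed.

Lemma rep_ex : exists rep : X -> T -> R[i], forall x, Lp (rep x) /\ cls (rep x) = x.
Proof.
have /choice[rep h] : forall x : X, exists f : T -> R[i], Lp f /\ cls f = x.
  by move=> x; have [f] := cls_surj x; exists f.
by exists rep.
Qed.

Definition rep : X -> T -> R[i] := sval (cid rep_ex).

Lemma Lp_rep x : Lp (rep x).
Proof. by rewrite /rep; case: cid => r /= /(_ x)[]. Qed.

Lemma repK x : cls (rep x) = x.
Proof. by rewrite /rep; case: cid => r /= /(_ x)[]. Qed.

Section Projection.
Variables (I : finType) (c : T -> I).
Hypothesis mc : mpartition c.

Definition cproj (x : X) : X := cls (cond_exp mu c (rep x)).

Lemma Lp_cond_exp f : Lp (cond_exp mu c f).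
Proof. exact: (Lp_simple mu p1 mc (average mu c f)). Qed.

(** Another representative changes the conditional expectation by that of a function of norm 0,
    which is null by contraction. Hence [cproj] is linear although [rep] is an arbitrary choice. *)
Lemma cproj_cls f : Lp f -> cproj (cls f) = cls (cond_exp mu c f).
Proof.
move=> lf; have lr := Lp_rep (cls f); apply: cls_eq; try exact: Lp_cond_exp.
have ld := LpB p1 lr lf.
rewrite (_ : (fun t => _) = cond_exp mu c (fun t => rep (cls f) t - f t)); last first.
  rewrite (_ : (fun t => rep (cls f) t - f t) = fun t => -1 * f t + rep (cls f) t).
    rewrite (cond_exp_comb p1 mc)//.
    by apply/funext => t; rewrite mulN1r addrC.
  by apply/funext => t; rewrite mulN1r addrC.
apply/eqP; rewrite eq_le mean_pth_ge0 andbT.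
apply: le_trans (mean_pth_cond_exp p1 mc ld) _.
by rewrite -cls_pow// clsB// repK subrr rnorm0 powR0// gt_eqF.
Qed.

Lemma cproj_linear : linear cproj.
Proof.
move=> a x y; rewrite -{1}(repK x) -{1}(repK y) -cls_comb; try exact: Lp_rep.
rewrite cproj_cls; last by apply: (Lp_comb p1); exact: Lp_rep.
rewrite (cond_exp_comb p1 mc); try exact: Lp_rep.
by rewrite cls_comb//; exact: Lp_cond_exp.
Qed.

Lemma cproj_le x : rnorm (cproj x) <= rnorm x.
Proof.
rewrite -[in leRHS](repK x); apply: le_cls; [exact: Lp_cond_exp|exact: Lp_rep|].
by apply: (mean_pth_cond_exp p1 mc); exact: Lp_rep.
Qed.

Lemma cproj_simple (s : I -> R[i]) :
  cproj (cls (fun t => s (c t))) = cls (fun t => s (c t)).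
Proof.
have ls := Lp_simple mu p1 mc s.
rewrite cproj_cls//; apply/esym/cls_eq => //; first exact: Lp_cond_exp.
exact: (cond_exp_simple mu p1 mc).
Qed.

Lemma cproj_idem x : cproj (cproj x) = cproj x.
Proof. exact: (cproj_simple (average mu c (rep x))). Qed.

Lemma cls_simple (s : I -> R[i]) : cls (fun t => s (c t)) =
  \sum_i s i *: cls (fun t => (\1_(cell c i) t : R)%:C%C).
Proof.
have li i : Lp (fun t => (\1_(cell c i) t : R)%:C%C).
  apply: (@Lp_bounded _ _ _ mu _ p1 _ 1); first exact: cmeas_indic (mcell mc i).
  by move=> t; rewrite nc_real normr_nat lern1 leq_b1.
rewrite (_ : (fun t => _) = fun t => \sum_i s i * (\1_(cell c i) t : R)%:C%C).
  by rewrite cls_sum => [|i]; [apply: eq_bigr => i _; rewrite clsZ|exact: (LpZ p1)].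
by apply/funext => t; rewrite (simpleE c).
Qed.

Lemma cproj_projection : (exists x : X, x <> 0) ->
  exists (F : submodClosed X) (pi : X -> subspace_of F),
    [/\ finite_dimensional F, norm_one_projection pi & forall x, val (pi x) = cproj x].
Proof.
move=> [x0 x0n].
pose e (k : 'I_#|I|) := cls (fun t => (\1_(cell c (enum_val k)) t : R)%:C%C).
apply: (@projection_of_idempotent _ _ _ _ e).
- exact: cproj_linear.
- exact: cproj_idem.
- apply/eqP; rewrite eq_le; apply/andP; split.
    by apply: ball_norm_le => x x1; exact: le_trans (cproj_le x) x1.
  (* The constant 1 is fixed by the projection, so the norm is attained; were its class 0, the
     measure and then [X] would be trivial. *)
  pose u := cls (fun=> 1).
  have l1 : Lp (fun=> 1) by exact: (Lp_simple mu p1 mc (fun=> 1)).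
  have u0 : u <> 0.
    move=> u0; apply: x0n; rewrite -(repK x0); apply: cls_eq0; first exact: Lp_rep.
    have mT : fine (mu setT) = 0.
      have := cls_pow l1; rewrite -/u u0 rnorm0 powR0 ?gt_eqF// => /esym.
      rewrite /mean_pth (_ : pth p _ = fun=> 1); first by rewrite int_cst mul1r.
      by apply/funext => t; rewrite /pth nc1 powR1.
    have := int_null measurableT mT (Lp_integr p1 (Lp_rep x0)).
    rewrite (_ : (fun t => _) = pth p (rep x0))//.
    by apply/funext => t; rewrite indicT mulr1.
  have un := rnorm_gt0 u0.
  pose v := ((rnorm u)^-1)%:C%C *: u.
  have v1 : rnorm v = 1.
    by rewrite rnormZ nc_real ger0_norm ?invr_ge0 ?(ltW un)// mulVf// gt_eqF.
  have Pv : cproj v = v.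
    rewrite /v -clsZ//; exact: (cproj_simple (fun=> ((rnorm u)^-1)%:C%C * 1)).
  rewrite -[leLHS]v1 -{1}Pv; apply: (le_ball_norm (M := 1)); last by rewrite /unit_ball /= v1.
  by move=> x x1; exact: le_trans (cproj_le x) x1.
- move=> x; split=> [Px|[a ->]].
    exists (fun k => average mu c (rep x) (enum_val k)).
    rewrite -{1}Px /cproj (cls_simple (average mu c (rep x))).
    by rewrite (reindex _ (onW_bij _ (@enum_val_bij I))).
  rewrite (lin_sum cproj_linear); apply: eq_bigr => k _.
  rewrite (linZ cproj_linear); congr (_ *: _).
  rewrite /e (_ : (fun t => _) = fun t => (fun i => (i == enum_val k)%:R) (c t)).
    exact: (cproj_simple (fun i => (i == enum_val k)%:R)).
  by apply/funext => t; rewrite cellE; case: (_ == _).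
Qed.

End Projection.

Lemma grid_values f (L r : R) : cmeas f -> 0 < L -> 0 < r ->
  exists (I : finType) (c : T -> I) (good : I -> bool) (a : I -> R[i]),
  [/\ mpartition c,
    forall t, good (c t) =
      (t \notin bad_set (@complex.Re R \o f) (@complex.Im R \o f) L) &
    forall t, good (c t) -> nc (f t - a (c t)) <= r].
Proof.
move=> [m1 m2] L0 r0; have r2 : 0 < r / 2 by lra.
have [I [c [good [mc cg cr]]]] := grid2 m1 m2 L0 r2.
have /choice[a ha] : forall i, exists a, forall t, good i -> c t = i -> nc (f t - a) <= r.
  move=> i; have [[u [gu cu]]|h] := pselect (exists u, good i /\ c u = i).
    exists (f u) => t gt ct; apply: le_trans (nc_le_ReIm _) _.
    have := cr t u; rewrite ct cu => /(_ gt erefl)[h1 h2].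
    by move: h1 h2; rewrite /= -!raddfB; lra.
  by exists 0 => t gt ct; case: h; exists t.
by exists I, c, good, a; split=> // t gt; exact: ha.
Qed.

(** The simple function is 0 on the bad cells, which carry little of the integral of |f|^p, and
    close to [f] on the good ones. *)
Lemma simple_approx f (e : R) : Lp f -> 0 < e ->
  exists (I : finType) (c : T -> I) (s : I -> R[i]), mpartition c /\
    rnorm (cls f - cls (fun t => s (c t))) <= e.
Proof.
move=> lf e0; have [m1 m2] := Lp_cmeas p1 lf; have [i1 i2] := Lp_cintegr p1 lf.
have ep : 0 < e `^ p / 2 by rewrite divr_gt0// powR_gt0.
have [L L0 hL] := small_int_bad_set i1 i2 (Lp_integr p1 lf) (pth_ge0 p f) ep.
have {}hL := hL L (lexx _); have mb := measurable_bad_set L m1 m2.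
set B := bad_set _ _ _ in hL mb.
have mT0 : 0 <= fine (mu setT) by exact: measure_ge0R.
(* The good cells contribute at most q^p times the total mass, hence at most half of e^p. *)
pose q := (e `^ p / 2 / (fine (mu setT) + 1)) `^ p^-1.
have q0 : 0 < q by rewrite powR_gt0// divr_gt0//; lra.
have [I [c [good [a [mc cg ha]]]]] := grid_values (Lp_cmeas p1 lf) L0 q0.
pose s i := if good i then a i else 0.
have ls := Lp_simple mu p1 mc s.
exists I, c, s; split=> //; rewrite -clsB//; apply: cls_le => //; first exact: LpB.
  exact: ltW.
have iB : integr mu (fun t => pth p f t * \1_B t).
  by apply: integr_indicM => //; exact: Lp_integr.
apply: le_trans (_ : int mu (fun t => pth p f t * \1_B t + q `^ p) <= _).
  apply: le_int; first by apply: Lp_integr => //; exact: LpB.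
    by apply: integrD => //; exact: integr_cst.
  move=> t; have := cg t; rewrite /s indicE; case: (boolP (t \in _)) => /= tB gt.
    by rewrite /pth gt subr0 mulr1 lerDl powR_ge0.
  rewrite /pth gt mulr0 add0r; apply: (powR_le p1); first exact: nc_ge0.
  exact: ha.
rewrite intD//; last exact: integr_cst.
rewrite int_cst /q powRK//; last by rewrite divr_ge0 ?(ltW ep)//; lra.
have : e `^ p / 2 / (fine (mu setT) + 1) * fine (mu setT) <= e `^ p / 2.
  rewrite -mulrA ler_piMr ?(ltW ep)// mulrC ler_pdivrMr; lra.
by move: hL; lra.
Qed.

(** A simple function [w] near [y] is fixed by the projections of all finer partitions, and a
    contraction moves [y - w] by at most twice its norm. *)
Lemma cproj_approx (y : X) (e : R) : 0 < e ->
  eventually_refined (fun J (c : T -> J) => rnorm (y - cproj c y) <= e).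
Proof.
move=> e0; have e2 : 0 < e / 2 by lra.
have [I [c [s [mc]]]] := simple_approx (Lp_rep y) e2; rewrite repK => h.
exists I, c; split=> // J c' g mc' cg.
set w := cls _ in h.
have Pw : cproj c' w = w.
  rewrite /w (_ : (fun t => s (c t)) = fun t => (s \o g) (c' t)).
    exact: cproj_simple.
  by apply/funext => t; rewrite /= cg.
have -> : y - cproj c' y = (y - w) - cproj c' (y - w).
  by rewrite (linB (cproj_linear mc')) Pw opprB addrA subrK.
have := rnormD (y - w) (- cproj c' (y - w)); rewrite rnormN.
by have := cproj_le mc' (y - w); move: h; lra.
Qed.

Definition cindic A (t : T) : R[i] := (\1_A t : R)%:C%C.

Lemma Lp_indic A : measurable A -> Lp (cindic A).
Proof.
move=> mA; apply: (@Lp_bounded _ _ _ mu _ p1 _ 1); first exact: cmeas_indic.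
by move=> t; rewrite nc_real normr_nat lern1 leq_b1.
Qed.

Lemma cls_indic_null A : measurable A -> fine (mu A) = 0 -> cls (cindic A) = 0.
Proof.
move=> mA A0; apply: cls_eq0; first exact: Lp_indic.
rewrite /mean_pth -[RHS]A0 -int_indic//; congr int; apply/funext => t.
rewrite /pth nc_real normr_nat indicE; case: (_ \in _); first by rewrite powR1.
by rewrite powR0// gt_eqF.
Qed.

(** The difference is the indicator of the union of the remaining sets; taking the values 0 and 1
    only, it equals its own p-th power. *)
Lemma sum_indic_trivIset (F : nat -> set T) n t : trivIset setT F ->
  (\1_(\bigcup_k F k) t - \sum_(0 <= i < n) \1_(F i) t : R) \in [:: 0; 1].
Proof.
move=> tF; rewrite indicE; case: (boolP (t \in _)) => [/set_mem[k _ Fk]|nt].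
  have Fi i : \1_(F i) t = (i == k)%:R :> R.
    rewrite indicE; congr (_%:R); congr nat_of_bool.
    apply/idP/eqP => [/set_mem Fi|->]; last exact: mem_set.
    by apply: (tF) => //; exists t.
  have -> : \sum_(0 <= i < n) \1_(F i) t = (k < n)%N%:R :> R.
    elim: n => [|n ih]; first by rewrite big_geq.
    rewrite big_nat_recr//= ih Fi ltnS [in RHS]leq_eqVlt eq_sym.
    by case: ltngtP => //=; rewrite ?addr0 ?add0r.
  by rewrite !inE; case: (k < n)%N; rewrite ?subrr ?subr0 eqxx ?orbT.
rewrite big1 ?subr0 ?inE ?eqxx// => i _; rewrite indicE.
case: (boolP (t \in F i)) => // /set_mem Fi.
by case/negP: nt; apply/mem_set; exists i.
Qed.

(** The p-th power of this norm is the measure of the remaining union, which tends to 0. *)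
Lemma cls_indic_sigma_additive (F : nat -> set T) (e : R) :
  (forall i, measurable (F i)) -> trivIset setT F -> 0 < e ->
  \forall n \near \oo,
    rnorm (cls (cindic (\bigcup_k F k)) - \sum_(0 <= i < n) cls (cindic (F i))) <= e.
Proof.
move=> mF tF e0; have mU : measurable (\bigcup_k F k) by exact: bigcup_measurable.
have := @measure_semi_sigma_additive _ _ _ mu F mF tF mU.
rewrite -[X in _ --> X](@fineK _ (mu (\bigcup_k F k))); last exact: fin_num_measure.
move=> /fine_cvgP[_] /cvgrPdist_le /(_ _ (powR_gt0 p e0)).
apply: filterS => n hn; rewrite -cls_sum => [|i]; last exact: Lp_indic.
have lU := Lp_indic mU.
have lS : Lp (fun t => \sum_(0 <= i < n) cindic (F i) t).
  by apply: Lp_sum => i; exact: Lp_indic.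
rewrite -clsB//; apply: cls_le; [exact: LpB|exact: ltW|].
have ii (B : set T) : measurable B -> integr mu (\1_B : T -> R).
  by move=> mB; exact: integrable_indic.
have -> : mean_pth mu p (fun t => cindic (\bigcup_k F k) t - \sum_(0 <= i < n) cindic (F i) t) =
    int mu (fun t => \1_(\bigcup_k F k) t - \sum_(0 <= i < n) \1_(F i) t).
  congr int; apply/funext => t; rewrite /pth /cindic -rmorph_sum -rmorphB nc_real.
  have := sum_indic_trivIset n t tF; rewrite !inE => /orP[] /eqP ->.
    by rewrite normr0 powR0// gt_eqF.
  by rewrite normr1 powR1.
rewrite intB; [|exact: ii|by apply: integr_sum => i; exact: ii].
rewrite int_sum => [|i]; last exact: ii.
rewrite int_indic//; under eq_bigr do rewrite int_indic//.
rewrite sum_fine => [|i _]; last exact: fin_num_measure.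
exact: le_trans (ler_norm _) hn.
Qed.

Lemma functional_density phi : dual X phi ->
  exists2 g : T -> R, integr mu g & forall A, measurable A ->
    complex.Re (phi (cls (cindic A))) = int mu (fun t => g t * \1_A t).
Proof.
move=> dphi; have [lphi _] := dphi; have [M M0 hM] := dual_bound dphi.
pose nu0 (A : set T) : \bar R := (complex.Re (phi (cls (cindic A))))%:E.
have ReB (a b : R[i]) : complex.Re (a - b) = complex.Re a - complex.Re b.
  by case: a b => [? ?] [? ?].
have Re_sum n (a : nat -> R[i]) :
    complex.Re (\sum_(0 <= i < n) a i) = \sum_(0 <= i < n) complex.Re (a i).
  exact: raddf_sum.
have nu00 : nu0 set0 = 0%E.
  by rewrite /nu0 cls_indic_null ?measure0// (lin0 lphi).
have nuF A : measurable A -> nu0 A \is a fin_num by [].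
have nuS : semi_sigma_additive nu0.
  move=> F mF tF mU; rewrite (_ : (fun n => _) = EFin \o
    (fun n => \sum_(0 <= i < n) complex.Re (phi (cls (cindic (F i)))))); last first.
    by apply/funext => n; rewrite /= sumEFin.
  apply: cvg_EFin; first exact: nearW.
  apply/cvgrPdist_le => e e0.
  have eM : 0 < e / M by rewrite divr_gt0.
  have := cls_indic_sigma_additive mF tF eM; apply: filterS => n hn /=.
  rewrite -Re_sum -(lin_sum lphi) -ReB -(linB lphi).
  apply: le_trans (normRe_le _) _; apply: le_trans (hM _) _.
  by rewrite mulrC -ler_pdivlMr.
pose nu : {charge set T -> \bar R} := HB.pack nu0 (isCharge.Build _ _ _ nu0 nu00 nuF nuS).
have numu : nu `<< mu.
  apply/null_content_dominatesP => A mA A0.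
  by rewrite /nu /= /nu0 cls_indic_null ?A0// (lin0 lphi).
have fing := Radon_Nikodym_fin_num _ numu.
have ig := Radon_Nikodym_integrable numu.
exists (fun t => fine (Radon_Nikodym nu mu t)).
  apply: eq_integrable ig => // t _; rewrite /= fineK//; exact: fing.
move=> A mA; rewrite int_indicM /Rintegral.
under eq_integral do rewrite fineK ?fing//.
by rewrite -Radon_Nikodym_integral.
Qed.

(** * Densities of functionals on L_p *)

Section Functional.
Variable phi : X -> R[i]^o.
Hypothesis dphi : dual X phi.
Let lphi : linear phi := dphi.1.

(** The imaginary part of [phi] is the real part of - i phi, so the real case is used twice. *)
Lemma complex_density : exists2 g : T -> R[i], cintegr mu g &
  forall A, measurable A -> phi (cls (cindic A)) = cint mu (fun t => g t * cindic A t).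
Proof.
have [g1 i1 h1] := functional_density dphi.
have dphi2 : dual X (fun x => - 'i%C * phi x).
  have [M _ hM] := dual_bound dphi.
  apply: (@dualI _ _ _ M); last by move=> x; rewrite ncM ncN nci mul1r.
  by move=> a x y; rewrite lphi mulrDr mulrCA.
have [g2 i2 h2] := functional_density dphi2.
exists (fun t => (g1 t +i* g2 t)%C); first by split.
move=> A mA; have := h1 A mA; have := h2 A mA.
rewrite /cint; case: (phi _) => a b /= .
have -> : @complex.Re R \o (fun t => (g1 t +i* g2 t)%C * cindic A t) =
    fun t => g1 t * \1_A t.
  apply/funext => t.
  transitivity (complex.Re ((g1 t +i* g2 t)%C * cindic A t)) => //.
  by rewrite ReM /= mulr0 subr0.
have -> : @complex.Im R \o (fun t => (g1 t +i* g2 t)%C * cindic A t) =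
    fun t => g2 t * \1_A t.
  apply/funext => t.
  transitivity (complex.Im ((g1 t +i* g2 t)%C * cindic A t)) => //.
  by rewrite ImM /= mulr0 add0r.
by move=> <- <-; congr (_ +i* _)%C; rewrite ?(mul0r, mulN1r, sub0r, opprK, subr0, oppr0, mul1r, add0r).
Qed.

Variable g : T -> R[i].
Hypothesis cg : cintegr mu g.
Hypothesis phig : forall A, measurable A ->
  phi (cls (cindic A)) = cint mu (fun t => g t * cindic A t).

(** On the good cells the functional [Psi] has density [g - a], of modulus at most [r]. For simple
    functions this gives the bound cell by cell; both sides are continuous for the L_p norm, so it
    extends to [f]. *)
Lemma good_part (I : finType) (c : T -> I) (good : I -> bool) (a : I -> R[i]) (r : R) f :
  mpartition c -> 0 <= r -> (forall t, good (c t) -> nc (g t - a (c t)) <= r) -> Lp f ->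
  nc (phi (cls (fun t => f t * (good (c t))%:R))
    - cint mu (fun t => f t * (a (c t) * (good (c t))%:R))) <= r * int mu (fun t => nc (f t)).
Proof.
move=> mc r0 ha lf.
have [M M0 hM] := dual_bound dphi.
have [K K0 hK] := int_nc_bound.
pose Psi f := phi (cls (fun t => f t * (good (c t))%:R))
    - cint mu (fun t => f t * (a (c t) * (good (c t))%:R)).
rewrite -/(Psi f).
pose b i := a i * (good i)%:R.
have [W W0 hW] : exists2 W, 0 <= W & forall t, nc (b (c t)) <= W.
  have [W hW] := simple_bound c b.
  by exists `|W| => // t; exact: le_trans (hW t) (ler_norm _).
have mgood : cmeas (fun t => (good (c t))%:R : R[i]).
  exact: (cmeas_simple mc (fun i => (good i)%:R)).
have mb : cmeas (fun t => b (c t)) by exact: (cmeas_simple mc).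
have Lgood u : Lp u -> Lp (fun t => u t * (good (c t))%:R).
  move=> lu; apply: (Lp_mono p1 (h := pth p u)).
  - by apply: cmeasM => //; exact: Lp_cmeas lu.
  - exact: Lp_integr.
  - move=> t; apply: (powR_le p1); first exact: nc_ge0.
    by rewrite ncM; case: (good _); rewrite ?nc1 ?nc0 ?mulr1// mulr0 nc_ge0.
have cb u : Lp u -> cintegr mu (fun t => u t * b (c t)).
  by move=> lu; apply: cintegrMb hW => //; exact: Lp_cintegr lu.
have PsiD u v : Lp u -> Lp v -> Psi (fun t => u t + v t) = Psi u + Psi v.
  move=> lu lv; rewrite /Psi.
  rewrite (_ : (fun t => (u t + v t) * (good (c t))%:R) =
    fun t => u t * (good (c t))%:R + v t * (good (c t))%:R); last first.
    by apply/funext => t; rewrite mulrDl.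
  rewrite (_ : (fun t => (u t + v t) * (a (c t) * (good (c t))%:R)) =
    fun t => u t * b (c t) + v t * b (c t)); last first.
    by apply/funext => t; rewrite mulrDl.
  rewrite clsD; try exact: Lgood.
  rewrite (linD lphi) cintD; try exact: cb.
  by rewrite opprD addrACA.
have Psi_le u : Lp u -> nc (Psi u) <= (M + W * K) * rnorm (cls u).
  move=> lu; apply: le_trans (ncD _ _) _; rewrite ncN mulrDl; apply: lerD.
    apply: le_trans (hM _) _; rewrite ler_wpM2l ?(ltW M0)//.
    apply: le_cls => //; first exact: Lgood.
    apply: le_int; [exact/Lp_integr/Lgood|exact: Lp_integr|].
    move=> t; apply: (powR_le p1); first exact: nc_ge0.
    by rewrite ncM; case: (good _); rewrite ?nc1 ?nc0 ?mulr1// mulr0 nc_ge0.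
  apply: le_trans (le_cint (cb u lu)) _.
  rewrite -mulrA; apply: le_trans (ler_wpM2l W0 (hK _ lu)).
  rewrite -intZ; last exact/cintegr_nc/Lp_cintegr/lu.
  apply: le_int.
  - exact/cintegr_nc/cb.
  - exact/integrZ/cintegr_nc/Lp_cintegr/lu.
  - by move=> t; rewrite ncM mulrC ler_wpM2r ?nc_ge0.
have simple_le (J : finType) (c' : T -> J) (h : J -> I) (s : J -> R[i]) :
    mpartition c' -> (forall t, c t = h (c' t)) ->
    nc (Psi (fun t => s (c' t))) <= r * int mu (fun t => nc (s (c' t))).
  move=> mc' ch.
  have mB j := mcell mc' j.
  have li j : Lp (cindic (cell c' j)) by exact: Lp_indic.
  have -> : Psi (fun t => s (c' t)) =
      \sum_j (s j * (good (h j))%:R) *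
        cint mu (fun t => (g t - a (h j)) * cindic (cell c' j) t).
    rewrite /Psi (_ : (fun t => s (c' t) * (good (c t))%:R) =
      fun t => \sum_j (s j * (good (h j))%:R) * cindic (cell c' j) t); last first.
      apply/funext => t; rewrite ch.
      exact: (simpleE c' (fun j => s j * (good (h j))%:R)).
    rewrite (_ : (fun t => s (c' t) * (a (c t) * (good (c t))%:R)) =
      fun t => \sum_j (s j * (good (h j))%:R * a (h j)) * cindic (cell c' j) t); last first.
      apply/funext => t; rewrite ch mulrCA mulrC.
      exact: (simpleE c' (fun j => s j * (good (h j))%:R * a (h j))).
    have ci j : cintegr mu (cindic (cell c' j)) by exact: Lp_cintegr (li j).
    rewrite cls_sum => [|j]; last exact: LpZ.
    rewrite cint_sum => [|j]; last exact: cintegrZ.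
    rewrite (lin_sum lphi) -sumrB; apply: eq_bigr => j _.
    rewrite clsZ// (linZ lphi) phig// cintZ//.
    have -> : cint mu (fun t => (g t - a (h j)) * cindic (cell c' j) t) =
        cint mu (fun t => g t * cindic (cell c' j) t)
          - a (h j) * cint mu (cindic (cell c' j)).
      rewrite -mulNr -cintZ// -cintD.
      - by congr cint; apply/funext => t; rewrite mulrBl mulNr.
      - exact: cintegr_indicM.
      - exact: cintegrZ.
    by rewrite mulrBr mulrA.
  rewrite (int_simple mu mc' (fun j => nc (s j))) mulr_sumr.
  apply: le_trans (nc_sum _ _ _) _; apply: ler_sum => j _.
  rewrite !ncM; case gj : (good (h j)); last first.
    by rewrite nc0 mulr0 mul0r !mulr_ge0 ?nc_ge0 ?measure_ge0R.
  rewrite nc1 mulr1 mulrCA ler_wpM2l ?nc_ge0//.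
  have cj : cintegr mu (fun t => (g t - a (h j)) * cindic (cell c' j) t).
    apply: cintegr_indicM => //; apply: cintegrD => //.
    by split; exact: integr_cst.
  apply: le_trans (le_cint cj) _; rewrite /mass -int_indic// -intZ; last exact: integrable_indic.
  apply: le_int; first exact: cintegr_nc.
    by apply: integrZ; exact: integrable_indic.
  move=> t; rewrite ncM nc_real cellE normr_nat.
  case: (c' t =P j) => [e|_] /=; last by rewrite !mulr0.
  by rewrite !mulr1 -e -ch ha// ch e.
apply/ler_addgt0Pr => e e0.
(* Collects the costs of replacing [f] by a simple function: [r * K] for the L_1 norm and
   [M + W * K] for [Psi]. *)
pose C := r * K + (M + W * K) + 1.
have C0 : 0 < C.
  by rewrite ltr_wpDl// !addr_ge0 ?mulr_ge0// ltW.
have eC : 0 < e / C by rewrite divr_gt0.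
have [J [e1 [s [me hs]]]] := simple_approx lf eC.
(* Pairing with [c] puts each cell of the simple function inside one cell of [c], where [a] and
   [good] are constant. *)
pose c' t := (e1 t, c t).
have mc' : mpartition c' by exact: mpartition_pair.
pose u t := s (e1 t).
have lu : Lp u by exact: Lp_simple.
have ld : Lp (fun t => f t - u t) by exact: LpB.
have hu := simple_le _ c' snd (fun j => s j.1) mc' (fun t => erefl).
have fE : f = fun t => u t + (f t - u t) by apply/funext => t; rewrite addrC subrK.
have hPsi : nc (Psi f) <= nc (Psi u) + nc (Psi (fun t => f t - u t)).
  by rewrite {1}fE PsiD//; exact: ncD.
have hd : rnorm (cls (fun t => f t - u t)) <= e / C by rewrite clsB.
have h1 : int mu (fun t => nc (u t)) <= int mu (fun t => nc (f t))
    + int mu (fun t => nc (f t - u t)).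
  rewrite -(intD (cintegr_nc (Lp_cintegr p1 lf)) (cintegr_nc (Lp_cintegr p1 ld))).
  apply: le_int; first exact/cintegr_nc/Lp_cintegr/lu.
    by apply: integrD; apply/cintegr_nc; [exact: Lp_cintegr lf|exact: Lp_cintegr ld].
  by move=> t; rewrite -{1}(subKr (f t) (u t)); apply: le_trans (ncD _ _) _; rewrite ncN.
have h2 : r * int mu (fun t => nc (u t)) <= r * int mu (fun t => nc (f t)) + r * (K * (e / C)).
  rewrite -mulrDr ler_wpM2l//; apply: le_trans h1 _; rewrite lerD2l.
  by apply: le_trans (hK _ ld) _; rewrite ler_wpM2l.
have h3 : nc (Psi (fun t => f t - u t)) <= (M + W * K) * (e / C).
  apply: le_trans (Psi_le _ ld) _.
  by rewrite ler_wpM2l// addr_ge0 ?mulr_ge0// ltW.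
have h4 : C * (e / C) = e by rewrite mulrC divfK// gt_eqF.
move: h4 hPsi hu h2 h3; rewrite /C !mulrDl mul1r -!mulrA.
have := ltW eC.
lra.
Qed.

Lemma density_rotation (l : R[i]) A : measurable A ->
  complex.Re (l * phi (cls (cindic A))) =
    int mu (fun t => complex.Re (l * g t) * \1_A t).
Proof.
move=> mA; rewrite phig// -cintZ; last exact: cintegr_indicM.
rewrite /cint /=; congr int; apply/funext => t.
transitivity (complex.Re ((l * g t) * cindic A t)); first by congr complex.Re; exact: mulrA.
by rewrite ReM /= mulr0 subr0.
Qed.

(** For p = 1 the norm of the indicator of [B] is its measure, so that L mu(B) <= Re (l phi (1_B))
    <= M mu(B) with M < L. *)
Lemma density_bound1 M (l : R[i]) (L : R) : p = 1 ->
  (forall x, nc (phi x) <= M * rnorm x) -> nc l = 1 -> M < L ->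
  measurable [set t | L <= complex.Re (l * g t)] /\
  fine (mu [set t | L <= complex.Re (l * g t)]) = 0.
Proof.
move=> pe hM l1 ML; set B := [set t | _].
have [ih _] : cintegr mu (fun t => l * g t) by exact: cintegrZ.
have mB : measurable B.
  rewrite (_ : B = (fun t => complex.Re (l * g t) < L) @^-1` [set false]).
    apply: mpartition_bool; apply: measurable_fun_ltr; last exact: measurable_cst.
    exact: integr_measurable ih.
  by apply/seteqP; split=> t; rewrite /B /= leNgt; [move/negbTE|move=> ->].
split=> //.
have B0 := measure_ge0R mu B.
have h1 : L * fine (mu B) <= int mu (fun t => complex.Re (l * g t) * \1_B t).
  have iB : integr mu (\1_B : T -> R) by exact: integrable_indic.
  rewrite -int_indic// -intZ//; apply: le_int.
  - exact: integrZ.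
  - exact: integr_indicM ih.
  - move=> t; rewrite indicE; case: (boolP (t \in B)) => [/set_mem tB|_] /=.
      by rewrite !mulr1.
    by rewrite !mulr0.
have h2 : rnorm (cls (cindic B)) = fine (mu B).
  have := cls_pow (Lp_indic mB); rewrite pe powRr1 ?rnorm_ge0// => ->.
  rewrite /mean_pth -int_indic//; congr int; apply/funext => t.
  by rewrite /pth powRr1 ?nc_ge0// nc_real ger0_norm// indicE.
move: h1; rewrite -density_rotation// => h1.
have h3 := le_trans h1 (Re_le _); rewrite ncM l1 mul1r in h3.
have := le_trans h3 (hM _); rewrite h2 => h4.
apply/eqP; rewrite eq_le B0 andbT leNgt; apply/negP => Bp.
by move: h4; rewrite ler_pM2r//; lra.
Qed.

Local Notation bad := (bad_set (@complex.Re R \o g) (@complex.Im R \o g)).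

Lemma measurable_bad L : measurable (bad L).
Proof. by have [m1 m2] := cintegr_meas cg; exact: measurable_bad_set. Qed.

(** The bad set is covered by the four sets of [density_bound1] for the rotations 1, -1, i and -
    i. *)
Lemma bad_null1 M (L : R) : p = 1 ->
  (forall x, nc (phi x) <= M * rnorm x) -> M < L -> fine (mu (bad L)) = 0.
Proof.
move=> pe hM ML.
pose B l := [set t | L <= complex.Re (l * g t)].
have hB l : nc l = 1 -> measurable (B l) /\ fine (mu (B l)) = 0.
  by move=> l1; exact: density_bound1 hM l1 ML.
have [m1 z1] := hB 1 (@nc1 R).
have [m2 z2] := hB (-1) (etrans (ncN 1) (@nc1 R)).
have [m3 z3] := hB 'i%C (@nci R).
have [m4 z4] := hB (- 'i%C) (etrans (ncN 'i%C) (@nci R)).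
have mb := measurable_bad L.
have ii (A : set T) : measurable A -> integr mu (\1_A : T -> R).
  by move=> mA; exact: integrable_indic.
apply/eqP; rewrite eq_le measure_ge0R andbT.
have : int mu (\1_(bad L)) <= int mu (fun t => (\1_(B 1%R) t + \1_(B (-1)%R) t)
    + (\1_(B 'i%C) t + \1_(B (- 'i%C)%R) t)).
  apply: le_int; [exact: ii|by do 2 (apply: integrD); exact: ii|move=> t].
  have i0 (A : set T) : 0 <= \1_A t :> R by rewrite indicE.
  have iT (A : set T) : A t -> \1_A t = 1 :> R by move=> At; rewrite indicE mem_set.
  rewrite {1}indicE; case: (boolP (t \in _)) => [/set_mem|_] /=; last by rewrite !addr_ge0.
  have := i0 (B 1); have := i0 (B (-1)); have := i0 (B 'i%C); have := i0 (B (- 'i%C)).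
  move=> i4 i3 i2 i1; rewrite /bad_set /= negb_and -!leNgt => /orP[].
    rewrite ler_normr => /orP[] h.
      by have := iT (B 1); rewrite {1}/B /= mul1r => /(_ h); lra.
    have := iT (B (-1)); rewrite {1}/B /= mulN1r.
    have -> : complex.Re (- g t) = - complex.Re (g t) by case: (g t).
    by move=> /(_ h); lra.
  rewrite ler_normr => /orP[] h.
    have := iT (B (- 'i%C)); rewrite {1}/B /=.
    have -> : complex.Re (- 'i%C * g t) = complex.Im (g t).
      by case: (g t) => x y /=; ring.
    by move=> /(_ h); lra.
  have := iT (B 'i%C); rewrite {1}/B /=.
  have -> : complex.Re ('i%C * g t) = - complex.Im (g t).
    by case: (g t) => x y /=; ring.
  by move=> /(_ h); lra.
rewrite int_indic//; rewrite !intD; try exact: ii; try by apply: integrD; exact: ii.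
by rewrite !int_indic// z1 z2 z3 z4; lra.
Qed.

(* For [p > 1]: if [x0] nearly norms [phi] and [y] lives on a set where [x0] is
   small, then [x0 + t y] has norm about [(1 + t ^ p) ^ (1 / p)], so
   [|phi y|] is of order [t ^ (p - 1)] at most. *)
Lemma bad_part (e : R) : 0 < e -> exists2 L : R, 0 < L & forall f, Lp f ->
  nc (phi (cls (fun t => f t * cindic (bad L) t))) <= e * rnorm (cls f).
Proof.
move=> e0; have [M M0 hM] := dual_bound dphi.
have [pe|/eqP pn] := eqVneq p 1.
  exists (M + 1); first by lra.
  move=> f lf; have ML : M < M + 1 by lra.
  rewrite cls_eq0; first by rewrite (lin0 lphi) nc0 mulr_ge0 ?rnorm_ge0// ltW.
    by apply: Lp_indicM => //; exact: measurable_bad.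
  rewrite /mean_pth -(int_null (measurable_bad _) (bad_null1 pe hM ML) (Lp_integr p1 lf)).
  by congr int; apply/funext => t; exact: pth_indicM.
have pm : 0 < p - 1 by have := p1; move: pn; lra.
set N := ball_norm (phi : X -> R[i]^o).
have hN x : unit_ball X x -> nc (phi x) <= N.
  move=> x1; apply: (@le_ball_norm _ _ _ (phi : X -> R[i]^o) M) => // y y1.
  by apply: le_trans (hM y) _; rewrite ler_piMr// ltW.
have N0 : 0 <= N by apply: le_trans (hN 0 _); [exact: nc_ge0|exact: unit_ball0].
have hNb x : nc (phi x) <= N * rnorm x by exact: lin_ball_bound lphi _ _ hN.
pose q := e / (2 * (N + 1)).
have q0 : 0 < q by rewrite divr_gt0// mulr_gt0//; lra.
(* Chosen so that s^p = s q, whence N s^p <= s e / 2; this uses p > 1. *)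
pose s := q `^ (p - 1)^-1.
have s0 : 0 < s by exact: powR_gt0.
have sp : s `^ p = s * q.
  by rewrite -mulr_powRB1 ?(ltW s0)// /s -powRrM mulVf ?gt_eqF// powRr1 ?(ltW q0).
have se : 0 < s * e by exact: mulr_gt0.
have [x0 [x01 hx0]] : exists x0, unit_ball X x0 /\ N - s * e / 4 < nc (phi x0).
  have hs : has_sup [set rnorm (phi x : R[i]^o) | x in unit_ball X].
    split; first by exists (rnorm (phi 0 : R[i]^o)), 0 => //; exact: unit_ball0.
    by exists N => _ [x x1 <-]; exact: hN.
  have e4 : 0 < s * e / 4 by lra.
  by have [_ [x x1 <-] h] := sup_adherent e4 hs; exists x.
have [a0 [a01 ha0]] := phase_ex (phi x0).
pose f0 := rep (a0 *: x0); have lf0 : Lp f0 by exact: Lp_rep.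
have clsf0 : cls f0 = a0 *: x0 by exact: repK.
(* The part of [f0] on the bad set has norm at most [r], which costs at most [s * e / 4], as much as
   the defect of [x0] from norming [phi]. *)
pose r := s * e / (4 * (N + 1)).
have r0 : 0 < r by rewrite divr_gt0// mulr_gt0//; lra.
have [i1 i2] := cg.
have [L L0 hL] := small_int_bad_set i1 i2 (Lp_integr p1 lf0) (pth_ge0 p f0) (powR_gt0 p r0).
exists L => //; have {}hL := hL L (lexx _).
have mb := measurable_bad L; set A := bad L in hL mb *.
have unit_case f : Lp f -> rnorm (cls f) <= 1 ->
    nc (phi (cls (fun t => f t * cindic A t))) <= e.
  move=> lf f1; have lfA := Lp_indicM p1 mb lf; have lf0A := Lp_indicM p1 mb lf0.
  have [a [a1 ha]] := phase_ex (phi (cls (fun t => f t * cindic A t))).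
  have pow1 (v : R) : 0 <= v -> v <= 1 -> v `^ p <= 1.
    by move=> v0 v1; have := powR_le p1 v0 v1; rewrite powR1.
  (* The two summands have disjoint supports, so the p-th power of the norm of [u] is at most 1 +
     s^p. Dividing the resulting bound on [phi] by [s] leaves e/2 + e/4 + e/4. *)
  pose u t := (s%:C%C * a) * (f t * cindic A t) + (f0 t - f0 t * cindic A t).
  have lB := LpB p1 lf0 lf0A.
  have lu : Lp u by exact: Lp_comb.
  have hu : rnorm (cls u) <= 1 + s `^ p.
    have s1 : 1 <= 1 + s `^ p by rewrite lerDl powR_ge0.
    apply: cls_le => //; first exact: le_trans s1.
    apply: le_trans (le1r_powR s1 p1).
    apply: le_trans (_ : int mu (fun t => s `^ p * pth p f t + pth p f0 t) <= _).
      apply: le_int; first exact: Lp_integr.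
        by apply: integrD; [apply: integrZ|]; exact: Lp_integr.
      move=> t; rewrite /pth /u /cindic indicE; case: (t \in A).
        rewrite !mulr1 subrr addr0 ncM ncM a1 mulr1 nc_real (ger0_norm (ltW s0)).
        by rewrite powRM ?nc_ge0 ?(ltW s0)// lerDl powR_ge0.
      by rewrite !mulr0 subr0 add0r lerDr mulr_ge0 ?powR_ge0.
    rewrite intD; [|by apply: integrZ; exact: Lp_integr|exact: Lp_integr].
    rewrite intZ; last exact: Lp_integr.
    rewrite -/(mean_pth mu p f) -/(mean_pth mu p f0) -!cls_pow// addrC; apply: lerD.
      by apply: pow1; [exact: rnorm_ge0|rewrite clsf0 rnormZ a01 mul1r].
    by rewrite ler_piMr ?powR_ge0//; apply: pow1 => //; exact: rnorm_ge0.
  have hphi : phi (cls u) = s%:C%C * (nc (phi (cls (fun t => f t * cindic A t))))%:C%C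
      + ((nc (phi x0))%:C%C - phi (cls (fun t => f0 t * cindic A t))).
    rewrite /u cls_comb// clsB// lphi (linB lphi) clsf0 (linZ lphi) -ha -ha0.
    by rewrite mulrA.
  have hr : rnorm (cls (fun t => f0 t * cindic A t)) <= r.
    apply: cls_le => //; first exact: ltW.
    apply: le_trans (ltW hL); rewrite le_eqVlt; apply/orP; left; apply/eqP.
    by congr int; apply/funext => t; exact: pth_indicM.
  have h1 := le_trans (Re_le (phi (cls u))) (hNb (cls u)).
  have h2 := le_trans h1 (ler_wpM2l N0 hu).
  have h3 := le_trans (Re_le _) (le_trans (hNb _) (ler_wpM2l N0 hr)).
  have N1 : N + 1 != 0 by rewrite gt_eqF//; lra.
  have Nr : N * r <= s * e / 4.
    apply: le_trans (_ : (N + 1) * r <= _); first by rewrite ler_wpM2r ?(ltW r0)//; lra.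
    by rewrite le_eqVlt; apply/orP; left; apply/eqP; rewrite /r; field.
  have Nq : N * (s `^ p) <= s * e / 2.
    apply: le_trans (_ : (N + 1) * s `^ p <= _).
      by rewrite ler_wpM2r ?powR_ge0//; lra.
    by rewrite sp le_eqVlt; apply/orP; left; apply/eqP; rewrite /q; field.
  rewrite -(ler_pM2l s0); move: h2; rewrite hphi.
  set w := phi (cls (fun t => f0 t * _)) in h3 *; set v := nc _.
  have -> : complex.Re (s%:C%C * v%:C%C + ((nc (phi x0))%:C%C - w)) =
      s * v + (nc (phi x0) - complex.Re w).
    by rewrite /=; case: (w) => wa wb /=; ring.
  by move: h3 Nr Nq hx0; lra.
move=> f lf; have [k0|/eqP kn] := eqVneq (rnorm (cls f)) 0.
  have h : rnorm (cls (fun t => f t * cindic A t)) <= rnorm (cls f).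
    apply: le_cls => //; first exact: Lp_indicM.
    apply: le_int; [exact/Lp_integr/Lp_indicM|exact: Lp_integr|].
    by move=> t; rewrite (pth_indicM p1) ler_piMr ?pth_ge0.
  apply: le_trans (hNb _) _; rewrite (_ : rnorm _ = 0) ?mulr0 ?k0 ?mulr0//.
  by apply/eqP; rewrite eq_le rnorm_ge0 andbT -k0.
set k := rnorm (cls f) in kn *.
have kp : 0 < k by rewrite lt_neqAle eq_sym rnorm_ge0 andbT; apply/eqP.
have lk : Lp (fun t => (k^-1)%:C%C * f t) by exact: LpZ.
have := unit_case _ lk.
rewrite clsZ// rnormZ nc_real ger0_norm ?invr_ge0 ?(ltW kp)// -/k mulVf ?gt_eqF//.
rewrite (_ : (fun t => (k^-1)%:C%C * f t * cindic A t) =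
  fun t => (k^-1)%:C%C * (f t * cindic A t)); last first.
  by apply/funext => t; rewrite mulrA.
rewrite clsZ; last exact: Lp_indicM.
rewrite (linZ lphi) ncM nc_real ger0_norm ?invr_ge0 ?(ltW kp)// => /(_ (lexx _)).
by rewrite mulrC ler_pdivrMr.
Qed.

End Functional.

(** The difference [z] of [x] and its projection is split along the bad set. Off it, [phi] is nearly
    integration against [a], which vanishes on [z] because [a] is constant on the finer cells; on it
    [bad_part] applies. *)
Lemma functional_approx phi (e : R) : dual X phi -> 0 < e ->
  eventually_refined (fun J (c : T -> J) =>
    forall x, nc (phi (x - cproj c x)) <= e * rnorm x).
Proof.
move=> dphi e0; have [lphi _] := dphi.
have [g cg phig] := complex_density dphi.
have [K K0 hK] := int_nc_bound.
have e4 : 0 < e / 4 by lra.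
have [L L0 hL] := bad_part dphi cg phig e4.
(* Each of the two parts costs at most [e / 4] times the norm of [z], which is at most twice that of
   [x]. *)
pose r := e / (4 * (K + 1)).
have r0 : 0 < r by rewrite divr_gt0// mulr_gt0//; lra.
have rK : r * K <= e / 4.
  apply: le_trans (_ : r * (K + 1) <= _); first by rewrite ler_wpM2l ?(ltW r0)//; lra.
  by rewrite le_eqVlt; apply/orP; left; apply/eqP; rewrite /r; field; rewrite gt_eqF//; lra.
have [I [c [good [a [mc hgood ha]]]]] := grid_values (cintegr_meas cg) L0 r0.
exists I, c; split=> // J c' h mc' ch x.
have lx := Lp_rep x; have lE := Lp_cond_exp mc' (rep x).
pose z t := rep x t - cond_exp mu c' (rep x) t.
have lz : Lp z by exact: LpB.
have clsz : cls z = x - cproj c' x by rewrite clsB// repK.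
have z2 : rnorm (cls z) <= 2 * rnorm x.
  rewrite clsz; have := rnormD x (- cproj c' x); rewrite rnormN.
  by have := cproj_le mc' x; lra.
rewrite -clsz.
have mb : measurable (bad_set (@complex.Re R \o g) (@complex.Im R \o g) L).
  exact: measurable_bad.
have zE : z = fun t => z t * (good (c t))%:R +
    z t * cindic (bad_set (@complex.Re R \o g) (@complex.Im R \o g) L) t.
  apply/funext => t; rewrite hgood /cindic indicE.
  by case: (t \in _); rewrite /= ?mulr0 ?mulr1 ?add0r ?addr0.
have lzb := Lp_indicM p1 mb lz.
have lzg : Lp (fun t => z t * (good (c t))%:R).
  rewrite (_ : (fun t => _) = fun t => z t -
      z t * cindic (bad_set (@complex.Re R \o g) (@complex.Im R \o g) L) t).
    exact: LpB.
  by apply/funext => t; rewrite {2}zE addrK.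
rewrite {1}zE clsD// (linD lphi).
have h1 := good_part dphi cg phig mc (ltW r0) ha lz.
have := cint_cond_exp p1 mc' (fun j => a (h j) * (good (h j))%:R) lx.
rewrite (_ : (fun t => _) = fun t => z t * (a (c t) * (good (c t))%:R)); last first.
  by apply/funext => t; rewrite mulrC ch.
move=> h0; rewrite h0 subr0 in h1.
have h2 := hL _ lz.
apply: le_trans (ncD _ _) _.
have h3 : r * int mu (fun t => nc (z t)) <= e / 4 * (2 * rnorm x).
  apply: le_trans (_ : r * K * rnorm (cls z) <= _).
    by rewrite -mulrA ler_wpM2l ?(ltW r0)// hK.
  by apply: ler_pM => //; [rewrite mulr_ge0// ltW|exact: rnorm_ge0].
have h4 : e / 4 * rnorm (cls z) <= e / 4 * (2 * rnorm x) by rewrite ler_wpM2l ?(ltW e4).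
apply: le_trans (lerD (le_trans h1 h3) (le_trans h2 h4)) _.
by rewrite le_eqVlt; apply/orP; left; apply/eqP; field.
Qed.

Lemma Lp_approximating : (exists x : X, x <> 0) -> approximating_projections X.
Proof.
move=> x0 n phi m y e dphi e0.
have [I [c [mc hc]]] := eventually_refined_and
  (eventually_refined_all (fun i => functional_approx (dphi i) e0))
  (eventually_refined_all (fun j => cproj_approx (y j) e0)).
have [h1 h2] := hc I c id mc (fun t => erefl).
have [F [pi [fdF npi hpi]]] := cproj_projection mc x0.
exists F, pi; split=> // [i x x1|j]; rewrite hpi; last exact: h2.
by apply: le_trans (h1 i x) _; rewrite ler_piMr// ltW.
Qed.

End LpSpace.

Theorem corollary2p9 (R : realType) (X : completeNormedModType R[i])
  (X_nontrivial : exists x : X, x <> 0)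
  (hX : has_shrinking_monotone_fdd X \/ is_Lp_finite_measure X) :
  dense_in (peak_numerical_peak_polynomials X) (A_wu X).
Proof.
apply: density_of_peak_polynomials.
case: hX => [[E [c [hE hs hm]]]|[d [T [mu [p [p1 [cls [h1 h2 h3]]]]]]]].
  exact: shrinking_approximating hE hm hs.
exact: (@Lp_approximating _ _ _ mu p p1 X cls h1 h2 h3 X_nontrivial).
Qed.
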